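(* Let $E$ be a row-finite directed graph, and let $W$ denote the collection of paths $\alpha \in E^*$ such that $\alpha \neq \beta\mu$ for any $\beta \in E^*$ and any cycle $\mu$ with no entrance in $E$. (1) The $C^*$-algebra $C^*_{\min}(E)$ satisfies $$C^*_{\min}(E) = \overline{\operatorname{span}}\{s^m_\alpha (s^m_\beta)^* : \alpha, \beta \in W,\ s(\alpha) = s(\beta)\}.$$ (2) Let $D := \overline{\operatorname{span}}\{s^m_\alpha (s^m_\alpha)^* : \alpha \in E^*\}$. There is a faithful conditional expectation $\Psi : C^*_{\min}(E) \to D$ such that $$\Psi(s^m_\alpha (s^m_\beta)^* ) = \begin{cases} s^m_\alpha (s^m_\alpha)^* & \text{if } \alpha = \beta \\ 0 & \text{otherwise} \end{cases}$$ for all $\alpha, \beta \in W$ with $s(\alpha) = s(\beta)$.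
   Context: A directed graph $E$ consists of countable sets $E^0$ (vertices) and $E^1$ (edges) and maps $r,s : E^1 \to E^0$; the edge $e$ points from $s(e)$ to $r(e)$. Write $vE^1 = r^{-1}(v)$. $E$ is row-finite if $vE^1$ is finite for every $v \in E^0$. A path is a sequence $\lambda = \lambda_1 \cdots \lambda_n$ of edges with $s(\lambda_i) = r(\lambda_{i+1})$ for $i<n$; $r(\lambda) = r(\lambda_1)$, $s(\lambda) = s(\lambda_n)$, $|\lambda| = n$. Vertices are paths of length $0$, with $r(v)=s(v)=v$. $E^*$ is the set of all paths. For a family $\{p_v\},\{s_e\}$, $s_\lambda := s_{\lambda_1}\cdots s_{\lambda_n}$ and $s_v := p_v$ for a vertex $v$. A cycle is a path $\mu = \mu_1 \cdots \mu_{|\mu|}$ with $|\mu| \ge 1$, $r(\mu) = s(\mu)$ and $s(\mu_i) \ne s(\mu_j)$ for $i<j$. It has no entrance in $E$ if $e \in E^1$ and $r(e) = r(\mu_i)$ imply $e = \mu_i$, for all $i$. For a cycle $\mu$, $[\mu]$ is the set of its cyclic permutations and $[\mu]^1 = \{\mu_i : 1 \le i \le |\mu|\}$. $C(E)$ is the set of all $[\mu]$ where $\mu$ is a cycle with no entrance in $E$, and $C(E)^1 = \bigcup_{C \in C(E)} C^1$. A cutting set for $E$ is a subset $X \subset C(E)^1$ such that $X \cap C^1$ is a singleton for each $C \in C(E)$. A Toeplitz-Cuntz-Krieger $E$-family in a $C^*$-algebra consists of elements $\{p_v : v \in E^0\}$, $\{s_e : e \in E^1\}$ such that (T1) the $p_v$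 are mutually orthogonal projections; (T2) $s_e^* s_e = p_{s(e)}$ for all $e \in E^1$; (T3) $p_v \ge \sum_{e \in F} s_e s_e^*$ for all $v \in E^0$ and finite $F \subset r^{-1}(v)$. It is a Cuntz-Krieger $E$-family if moreover (CK) $p_v = \sum_{r(e)=v} s_e s_e^*$ whenever $0 < |r^{-1}(v)| < \infty$. A normalised reduced Cuntz-Krieger $E$-family is a Cuntz-Krieger $E$-family such that $s_\mu = p_{r(\mu)}$ for each cycle $\mu$ with no entrance in $E$. $C^*_{\min}(E)$ denotes the co-universal $C^*$-algebra of $E$ (existing for row-finite $E$, and unique up to isomorphism): it is generated by a normalised reduced Cuntz-Krieger $E$-family $\{p^m_v : v \in E^0\}$, $\{s^m_e : e \in E^1\}$ such that (a) every $p^m_v$ is nonzero; (b) given any Toeplitz-Cuntz-Krieger $E$-family $\{q_v\}, \{t_e\}$ in a $C^*$-algebra with each $q_v \ne 0$ and any cutting set $X$ for $E$, there are a function $\kappa : X \to \mathbb{T}$ and a homomorphism $\psi_{q,t} : C^*(\{q_v, t_e : v \in E^0, e \in E^1\}) \to C^*_{\min}(E)$ with $\psi_{q,t}(q_v) = p^m_v$ for all $v \in E^0$, $\psi_{q,t}(t_e) = s^m_e$ for all $e \in E^1 \setminus X$, and $\psi_{q,t}(t_x) = \kappa(x) s^m_x$ for all $x \in X$. *)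

(* Defs.v *)
From HB Require Import structures.
From mathcomp Require Import all_boot all_order all_algebra.
From mathcomp Require Import complex.
From mathcomp Require Import all_classical all_reals all_analysis.

Set Implicit Arguments.
Unset Strict Implicit.
Unset Printing Implicit Defensive.

Import Order.TTheory GRing.Theory Num.Theory.
Import numFieldNormedType.Exports.

Local Open Scope classical_set_scope.
Local Open Scope ring_scope.

(** * C*-algebras *)

(* Not necessarily unital, hence not built on MathComp's ring structures. *)
HB.mixin Record isCStarAlgebra (R : realType) A
    of CompleteNormedModule R[i] A := {
  cmul : A -> A -> A ;
  cadj : A -> A ;
  cmulA : associative cmul ;
  cmulDl : left_distributive cmul +%R ;
  cmulDr : right_distributive cmul +%R ;
  cscalerAl : forall (a : R[i]) (x y : A), a *: cmul x y = cmul (a *: x) y ;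
  cscalerAr : forall (a : R[i]) (x y : A), a *: cmul x y = cmul x (a *: y) ;
  cadjD : {morph cadj : x y / x + y} ;
  cadjZ : forall (a : R[i]) (x : A), cadj (a *: x) = (a^*)%C *: cadj x ;
  cadjM : forall x y : A, cadj (cmul x y) = cmul (cadj y) (cadj x) ;
  cadjK : involutive cadj ;
  cnormM : forall x y : A, `|cmul x y| <= `|x| * `|y| ;
  cnorm_adj : forall x : A, `|cmul (cadj x) x| = `|x| ^+ 2
}.

#[short(type="cstarType")]
HB.structure Definition CStarAlgebra (R : realType) :=
  {A of CompleteNormedModule R[i] A & isCStarAlgebra R A}.

Declare Scope cstar_scope.
Notation "x ** y" := (cmul x y) (at level 40, left associativity) : cstar_scope.
Local Open Scope cstar_scope.

Section CStar.
Variables (R : realType) (A : cstarType R).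

Definition cpositive (x : A) : Prop := exists y : A, x = cadj y ** y.

Definition is_projection (x : A) : Prop := x ** x = x /\ cadj x = x.

Definition lin_span (S : set A) : set A :=
  [set x | exists (n : nat) (c : 'I_n -> R[i]) (v : 'I_n -> A),
     (forall i, S (v i)) /\ x = \sum_(i < n) c i *: v i].

Record cstar_subalgebra (D : set A) : Prop := {
  csub_closed : closed D ;
  csub0 : D 0 ;
  csubD : forall x y, D x -> D y -> D (x + y) ;
  csubZ : forall (a : R[i]) x, D x -> D (a *: x) ;
  csubM : forall x y, D x -> D y -> D (x ** y) ;
  csub_adj : forall x, D x -> D (cadj x)
}.

Definition cstar_generated (S : set A) : set A := smallest cstar_subalgebra S.

Record conditional_expectation (D : set A) (Psi : A -> A) : Prop := {
  cexp_subalgebra : cstar_subalgebra D ;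
  cexp_range : forall x, D (Psi x) ;
  cexp_id : forall x, D x -> Psi x = x ;
  cexpD : forall x y, Psi (x + y) = Psi x + Psi y ;
  cexpZ : forall (a : R[i]) x, Psi (a *: x) = a *: Psi x ;
  cexp_norm : forall x, `|Psi x| <= `|x| ;
  cexp_positive : forall x, cpositive x -> cpositive (Psi x) ;
  cexpMl : forall d x, D d -> Psi (d ** x) = d ** Psi x ;
  cexpMr : forall x d, D d -> Psi (x ** d) = Psi x ** d
}.

Definition faithful (Psi : A -> A) : Prop :=
  forall x : A, Psi (cadj x ** x) = 0 -> x = 0.

End CStar.

(* [f] restricts to a *-homomorphism on [D]; its values off [D] are junk. *)
Record star_hom_on (R : realType) (B A : cstarType R) (D : set B)
    (f : B -> A) : Prop := {
  shomD : forall x y, D x -> D y -> f (x + y) = f x + f y ;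
  shomZ : forall (a : R[i]) x, D x -> f (a *: x) = a *: f x ;
  shomM : forall x y, D x -> D y -> f (x ** y) = f x ** f y ;
  shom_adj : forall x, D x -> f (cadj x) = cadj (f x)
}.

(** * Directed graphs *)

Record digraph := Digraph {
  vertex : countType ;
  edge : countType ;
  erange : edge -> vertex ;
  esource : edge -> vertex
}.

Section Graph.
Variable E : digraph.
Implicit Types (v : vertex E) (e : edge E).

Definition incoming v : set (edge E) := [set e | erange e = v].

Definition row_finite : Prop := forall v, finite_set (incoming v).

(* A path is encoded by its range and its list of edges: [(v, [::])] is the
   vertex [v], and for a nonempty list the range is that of the first edge.
   Edges are composed right to left: s(lambda_i) = r(lambda_(i+1)). *)
Fixpoint is_path v (l : seq (edge E)) : bool :=
  if l is e :: l' then (erange e == v) && is_path (esource e) l' else true.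

Record gpath := GPath {
  path_val : vertex E * seq (edge E) ;
  path_valP : is_path path_val.1 path_val.2
}.
HB.instance Definition _ := [isSub for path_val].
HB.instance Definition _ := [Equality of gpath by <:].

Definition prange (a : gpath) : vertex E := (path_val a).1.
Definition pedges (a : gpath) : seq (edge E) := (path_val a).2.
Definition psource (a : gpath) : vertex E :=
  last (prange a) (map (@esource E) (pedges a)).
Definition plength (a : gpath) : nat := size (pedges a).

Definition is_concat (a b m : gpath) : Prop :=
  [/\ psource b = prange m, prange a = prange b
    & pedges a = pedges b ++ pedges m].

Definition is_cycle (m : gpath) : Prop :=
  [/\ (1 <= plength m)%N, prange m = psource m
    & uniq (map (@esource E) (pedges m))].

Definition no_entrance (m : gpath) : Prop :=
  forall e f, f \in pedges m -> erange e = erange f -> e = f.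

Definition entry_free_cycle (m : gpath) : Prop := is_cycle m /\ no_entrance m.

Definition cyclic_class (m : gpath) : set gpath :=
  [set n | exists k, pedges n = rot k (pedges m)].

Definition class_edges (C : set gpath) : set (edge E) :=
  [set e | exists2 m, C m & e \in pedges m].

Definition entry_free_classes : set (set gpath) :=
  [set C | exists2 m, entry_free_cycle m & C = cyclic_class m].

Definition entry_free_edges : set (edge E) :=
  \bigcup_(C in entry_free_classes) class_edges C.

Definition cutting_set (X : set (edge E)) : Prop :=
  X `<=` entry_free_edges /\
  forall C, entry_free_classes C -> exists e, X `&` class_edges C = [set e].

Definition pathsW : set gpath :=
  [set a | ~ exists b m, entry_free_cycle m /\ is_concat a b m].

End Graph.

(** * Families of generators *)

Section Families.
Variables (R : realType) (E : digraph) (A : cstarType R).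
Variables (p : vertex E -> A) (s : edge E -> A).

Record toeplitz_CK_family : Prop := {
  tck_proj : forall v, is_projection (p v) ;
  tck_orth : forall v w, v <> w -> p v ** p w = 0 ;
  tck_source : forall e, cadj (s e) ** s e = p (esource e) ;
  tck_range : forall v (F : set (edge E)), finite_set F -> F `<=` incoming v ->
    cpositive (p v - \sum_(e \in F) s e ** cadj (s e))
}.

Record CK_family : Prop := {
  ck_toeplitz : toeplitz_CK_family ;
  ck_range : forall v, finite_set (incoming v) -> incoming v !=set0 ->
    p v = \sum_(e \in incoming v) s e ** cadj (s e)
}.

Fixpoint edges_elt (e : edge E) (l : seq (edge E)) : A :=
  if l is f :: l' then s e ** edges_elt f l' else s e.

Definition path_elt (a : gpath E) : A :=
  if pedges a is e :: l then edges_elt e l else p (prange a).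

Record normalised_reduced_CK_family : Prop := {
  nrck_CK : CK_family ;
  nrck_cycle : forall m, entry_free_cycle m -> path_elt m = p (prange m)
}.

Definition family_algebra : set A := cstar_generated (range p `|` range s).

End Families.

(* [A], generated by the family [p], [s], is the co-universal C*-algebra
   C*_min(E), which is only defined up to isomorphism. *)
Record is_Cmin (R : realType) (E : digraph) (A : cstarType R)
    (p : vertex E -> A) (s : edge E -> A) : Prop := {
  cmin_family : normalised_reduced_CK_family p s ;
  cmin_generated : family_algebra p s = setT ;
  cmin_neq0 : forall v, p v <> 0 ;
  cmin_couniversal : forall (B : cstarType R) (q : vertex E -> B)
      (t : edge E -> B) (X : set (edge E)),
    toeplitz_CK_family q t -> (forall v, q v <> 0) -> cutting_set X ->
    exists (kappa : edge E -> R[i]) (psi : B -> A),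
      [/\ forall x, X x -> `|kappa x| = 1,
          star_hom_on (family_algebra q t) psi,
          forall v, psi (q v) = p v,
          forall e, ~ X e -> psi (t e) = s e
        & forall x, X x -> psi (t x) = kappa x *: s x]
}.

(* Main.v *)
Require Import Defs.
From HB Require Import structures.
From mathcomp Require Import all_boot all_order all_algebra.
From mathcomp Require Import complex.
From mathcomp Require Import all_classical all_reals all_analysis.
From mathcomp Require Import ring lra.
Import Order.TTheory GRing.Theory Num.Theory.
Import numFieldNormedType.Exports.
Set Implicit Arguments.
Unset Strict Implicit.
Unset Printing Implicit Defensive.
Local Open Scope classical_set_scope.
Local Open Scope ring_scope.
Local Open Scope cstar_scope.

(** Why the theorem holds.

    Represent the graph on the Hilbert space whose basis consists of boundary paths
    equipped with an integer degree: the edge [e] prepends itself to a boundary path and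
    adds its weight to the degree, where edges of entry-free cycles have weight 0 and
    all other edges weight 1. To have enough boundary paths it suffices to choose one
    incoming edge at each vertex that has one. This gives a Toeplitz-Cuntz-Krieger family
    with nonzero vertex projections ([bfamily_toeplitz], [bvertex_neq0]) in the
    C*-algebra of bounded operators, in which entry-free cycles already act as vertices.
    Co-universality provides a homomorphism [psi] from the algebra [T] generated by this
    family to the given algebra. The scalars [kappa] are 1, because both families
    are normalised ([cutting_scalar_trivial]).

    The point is that [psi] is isometric, so that the given algebra is a copy of [T].
    It is contractive because every *-homomorphism is ([shom_contractive]). Conversely,
    let [X] be a finite combination of elements [s_a s_b^*] and [z] a boundary path.
    Compressing [X] by a long initial segment of [z] leaves a scalar and closed paths at
    one vertex. A closed path of positive weight has an entrance, and compressing further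
    by a path that leaves through the entrance removes it. Hence the diagonal entry of
    [X] at [z] is the coefficient of a vertex projection in a compression of [X]
    ([entry_as_compression]), and it is bounded by the norm of [psi X]
    ([diag_part_le_psi]). Applied to the powers of [X^* X] this bounds the norm of [X]
    itself ([nrm_le_diag_powers], [psi_isometry]).

    It remains to work in [T]. Its elements [s_a s_b^*] span a dense subspace, and since
    entry-free cycles act as vertices only paths of [W] are needed ([span_pathsW]).
    Compression to the diagonal is a faithful contraction on all operators. It sends
    [s_a s_b^*] to zero for distinct [a], [b] in [W]: a boundary path with degree fixed
    by [s_a s_b^*] would force one of the two paths to be the other followed by a closed
    path of weight 0, that is by entry-free cycles ([entry_generator]). Therefore the
    compression maps [T] onto the closed span of the projections [s_a s_a^*], and it is
    the required conditional expectation. *)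

(** * Real-valued norms and sequential completeness *)

(** The norm of a normed module over [R[i]] takes its values in [R[i]], whose order
    is partial; estimates are made with its real part. *)
Definition nrm (R : realType) (V : normedZmodType R[i]) (x : V) : R := complex.Re `|x|.

Section RealNorm.
Variables (R : realType).
Local Notation C := R[i].

Lemma ltr0C (a : R) : (0 < a%:C%C :> C) = (0 < a).
Proof. by rewrite ltcE /= eqxx. Qed.

Lemma nrmE (V : normedZmodType C) (x : V) : `|x| = (nrm x)%:C%C.
Proof. by rewrite /nrm RRe_real// normr_real. Qed.

Lemma nrm_ge0 (V : normedZmodType C) (x : V) : 0 <= nrm x.
Proof. by rewrite -ler0c -nrmE. Qed.

Lemma nrm0 (V : normedZmodType C) : nrm (0 : V) = 0.
Proof. by rewrite /nrm normr0. Qed.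

Lemma nrm0_eq0 (V : normedZmodType C) (x : V) : nrm x = 0 -> x = 0.
Proof. by move=> x0; apply: normr0_eq0; rewrite nrmE x0. Qed.

Lemma nrmN (V : normedZmodType C) (x : V) : nrm (- x) = nrm x.
Proof. by rewrite /nrm normrN. Qed.

Lemma nrmD (V : normedZmodType C) (x y : V) : nrm (x + y) <= nrm x + nrm y.
Proof. by rewrite -lecR rmorphD/= -!nrmE ler_normD. Qed.

Lemma nrmB (V : normedZmodType C) (x y : V) : nrm (x - y) <= nrm x + nrm y.
Proof. by rewrite -(nrmN y) nrmD. Qed.

Lemma nrmBC (V : normedZmodType C) (x y : V) : nrm (x - y) = nrm (y - x).
Proof. by rewrite -nrmN opprB. Qed.

Lemma nrm_triang (V : normedZmodType C) (y x z : V) :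
  nrm (x - z) <= nrm (x - y) + nrm (y - z).
Proof. by rewrite -{1}(subrK y x) -addrA nrmD. Qed.

Lemma nrm_sum (V : normedZmodType C) I (r : seq I) (P : pred I) (F : I -> V) :
  nrm (\sum_(i <- r | P i) F i) <= \sum_(i <- r | P i) nrm (F i).
Proof.
elim/big_ind2 : _ => [|x1 x2 y1 y2 h1 h2|//]; first by rewrite nrm0.
by rewrite (le_trans (nrmD _ _))// lerD.
Qed.

Lemma nrmcM (a b : C) : nrm (a * b) = nrm a * nrm b.
Proof. by apply: complexI; rewrite rmorphM/= -!nrmE normrM. Qed.

Lemma nrmZ (V : normedModType C) (a : C) (x : V) : nrm (a *: x) = nrm a * nrm x.
Proof. by apply: complexI; rewrite rmorphM/= -!nrmE normrZ. Qed.

Lemma nrm_real (a : R) : nrm (a%:C%C : C) = `|a|.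
Proof. by rewrite /nrm normc_def /= expr0n addr0 sqrtr_sqr. Qed.

Lemma nrmcE (a : C) : (nrm a ^+ 2)%:C%C = a * (a^*)%C.
Proof. by rewrite rmorphXn/= -nrmE sqr_normc. Qed.

Lemma nrm_conj (a : C) : nrm (a^*)%C = nrm a.
Proof. by case: a => x y; rewrite /nrm !normc_def /= sqrrN. Qed.

Lemma Re_le_nrm (a : C) : `|complex.Re a| <= nrm a.
Proof.
by rewrite /nrm normc_def /= -sqrtr_sqr ler_wsqrtr// lerDl sqr_ge0.
Qed.

Lemma Im_le_nrm (a : C) : `|complex.Im a| <= nrm a.
Proof.
by rewrite /nrm normc_def /= -sqrtr_sqr ler_wsqrtr// lerDr sqr_ge0.
Qed.

Lemma nrm_ReIm (a : C) : nrm a <= `|complex.Re a| + `|complex.Im a|.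
Proof.
case: a => x y; rewrite /= /nrm normc_def /=.
rewrite -[leRHS]ger0_norm ?addr_ge0// -sqrtr_sqr ler_wsqrtr//.
by rewrite sqrrD !real_normK ?num_real// addrAC lerDl mulrn_wge0// mulr_ge0.
Qed.

Lemma le_epsP (x y : R) : (forall e, 0 < e -> x <= y + e) -> x <= y.
Proof. by move=> h; apply/ler_addgt0Pr. Qed.

Section Top.
Variable V : normedModType C.

Lemma pos_nbhs (x : V) (S : set V) : nbhs x S ->
  exists2 e : R, 0 < e & forall y, nrm (x - y) < e -> S y.
Proof.
move=> /nbhs_normP[d d0 dS]; exists (complex.Re d).
  by rewrite -ltr0C RRe_real// gtr0_real.
move=> y xy; apply: dS => /=.
by rewrite nrmE -(@RRe_real _ d) ?gtr0_real// ltcR.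
Qed.

Lemma nbhs_pos (x : V) (S : set V) (e : R) : 0 < e ->
  (forall y, nrm (x - y) < e -> S y) -> nbhs x S.
Proof.
move=> e0 eS; apply/nbhs_normP; exists (e%:C)%C; first by rewrite /= ltr0C.
by move=> y /=; rewrite nrmE ltcR => /eS.
Qed.

Lemma closure_nrmP (S : set V) (x : V) :
  closure S x <-> forall e : R, 0 < e -> exists2 y, S y & nrm (x - y) < e.
Proof.
split=> [Sx e e0|h B /pos_nbhs[e e0 eB]].
  have /Sx[y [Sy xy]] : nbhs x [set y | nrm (x - y) < e] by apply: nbhs_pos e0 _.
  by exists y.
by have [y Sy /eB By] := h _ e0; exists y.
Qed.

Lemma closed_nrmP (S : set V) :
  closed S <-> forall x, (forall e : R, 0 < e -> exists2 y, S y & nrm (x - y) < e) -> S x.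
Proof.
split=> [cS x /closure_nrmP/cS//|h x /closure_nrmP]; exact: h.
Qed.

End Top.

Definition cauchy_nrm (V : normedZmodType C) (u : nat -> V) :=
  forall e : R, 0 < e -> exists N, forall m n, (N <= m)%N -> (N <= n)%N ->
    nrm (u m - u n) < e.

Definition cvg_nrm (V : normedZmodType C) (u : nat -> V) (l : V) :=
  forall e : R, 0 < e -> exists N, forall n, (N <= n)%N -> nrm (u n - l) < e.

Lemma complete_seq (V : completeNormedModType C) (u : nat -> V) :
  cauchy_nrm u -> exists l, cvg_nrm u l.
Proof.
move=> cu; have : cvg (u @ \oo).
  apply: cauchy_cvg; apply/cauchy_ballP => e e0.
  have e0' : 0 < complex.Re e by rewrite -ltr0C RRe_real// gtr0_real.
  have [N hN] := cu _ e0'.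
  exists (u @` [set n | (N <= n)%N], u @` [set n | (N <= n)%N]).
    by split; exists N => // n Nn /=; exists n.
  move=> [x y] /= [[m Nm <-] [n Nn <-]].
  rewrite -ball_normE /= nrmE -(@RRe_real _ e) ?gtr0_real// ltcR.
  exact: hN.
move=> /cvg_ex[l ul]; exists l => e e0.
have : nbhs l [set x | nrm (l - x) < e] by apply: nbhs_pos e0 _.
by move=> /ul[N _ hN]; exists N => n Nn; rewrite nrmBC; exact: hN.
Qed.

Lemma cvg_nrm_unique (V : normedZmodType C) (u : nat -> V) (l l' : V) :
  cvg_nrm u l -> cvg_nrm u l' -> l = l'.
Proof.
move=> ul ul'; apply/subr0_eq/nrm0_eq0/eqP; rewrite eq_le nrm_ge0 andbT.
apply: le_epsP => e e0; have e20 : 0 < e / 2 by rewrite divr_gt0.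
have [N hN] := ul _ e20; have [N' hN'] := ul' _ e20.
rewrite add0r (le_trans (nrm_triang (u (maxn N N')) _ _))//.
rewrite (splitr e) lerD// ltW//; last by rewrite hN'// leq_maxr.
by rewrite nrmBC hN// leq_maxl.
Qed.

Lemma cvg_nrm_le (V : normedZmodType C) (u : nat -> V) (l : V) (M : R) :
  cvg_nrm u l -> (exists N, forall n, (N <= n)%N -> nrm (u n) <= M) -> nrm l <= M.
Proof.
move=> ul [N hN]; apply: le_epsP => e e0; have [N' hN'] := ul _ e0.
have /hN h1 := leq_maxl N N'; have /hN' h2 := leq_maxr N N'.
rewrite -(subrK (u (maxn N N')) l) (le_trans (nrmD _ _))// addrC lerD//.
by rewrite nrmBC ltW.
Qed.

Lemma cauchy_bounded (V : normedZmodType C) (u : nat -> V) :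
  cauchy_nrm u -> exists N M, forall n, (N <= n)%N -> nrm (u n) <= M.
Proof.
move=> /(_ 1 ltr01)[N hN]; exists N, (1 + nrm (u N)) => n Nn.
by rewrite -{1}(subrK (u N) (u n)) (le_trans (nrmD _ _))// lerD2r ltW// hN.
Qed.

(** Completeness of a normed module is stated with filters; sequences suffice
    because the uniformity has the countable base given by the balls of
    radius [1/n]. *)
Lemma seq_complete_filter (V : normedModType C) :
  (forall u : nat -> V, cauchy_nrm u -> exists l, cvg_nrm u l) ->
  forall F : set_system V, ProperFilter F -> cauchy F -> cvg F.
Proof.
move=> h F FF /cauchy_ballP cF.
have small n : exists A, F A /\ forall x y, A x -> A y -> nrm (x - y) < n.+1%:R^-1.
  have e0 : 0 < ((n.+1%:R^-1 : R)%:C)%C :> C by rewrite ltr0C invr_gt0.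
  have [[A B]/= [FA FB] AB] := cF _ e0.
  exists (A `&` B); split; first exact: filterI.
  move=> x y [Ax _] [_ By]; have := AB (x, y) (conj Ax By).
  by rewrite -ball_normE /= nrmE ltcR.
pose A n := sval (cid (small n)).
have FA n : F (A n) by rewrite /A; case: cid => B [].
have Asmall n x y : A n x -> A n y -> nrm (x - y) < n.+1%:R^-1.
  by rewrite /A; case: cid => B [? ] /=; exact.
pose D n := [set x | forall k, (k <= n)%N -> A k x].
have FD n : F (D n).
  elim: n => [|n IH]; first by apply: filterS (FA 0) => x Ax k; rewrite leqn0 => /eqP->.
  apply: filterS (filterI IH (FA n.+1)) => x [Dx Ax] k.
  by rewrite leq_eqVlt ltnS => /predU1P[->//|/Dx].
have u_ n : exists x, D n x by have /filter_ex := FD n.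
pose u n := sval (cid (u_ n)).
have Du n : D n (u n) by rewrite /u; case: cid.
have cu : cauchy_nrm u.
  move=> e e0; have [N _ hN] := near_infty_natSinv_lt (PosNum e0).
  exists N => m n Nm Nn; apply: lt_trans (hN N (leqnn N)).
  by apply: Asmall; [exact: (Du m)|exact: (Du n)].
have [l ul] := h _ cu; apply/cvg_ex; exists l => S /pos_nbhs[e e0 eS].
have e20 : 0 < e / 2 by rewrite divr_gt0.
have [N hN] := ul _ e20; have [N' _ hN'] := near_infty_natSinv_lt (PosNum e20).
apply: filterS (FA N') => x Ax; apply: eS.
apply: le_lt_trans (nrm_triang (u (maxn N N')) _ _) _.
rewrite (splitr e) ltrD//; first by rewrite nrmBC hN// leq_maxl.
apply: lt_trans (hN' N' (leqnn N')); apply: Asmall => //.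
exact/(Du (maxn N N'))/leq_maxr.
Qed.

End RealNorm.

(** * C*-algebras and automatic contractivity *)

Section CStarBasics.
Variables (R : realType) (A : cstarType R).
Local Notation C := R[i].
Implicit Types (x y z : A).

Lemma cmul0l x : 0 ** x = 0 :> A.
Proof. by apply: (addIr (0 ** x)); rewrite -cmulDl !add0r. Qed.

Lemma cmul0r x : x ** 0 = 0 :> A.
Proof. by apply: (addIr (x ** 0)); rewrite -cmulDr !add0r. Qed.

Lemma cmulNl x y : (- x) ** y = - (x ** y).
Proof. by rewrite -scaleN1r -cscalerAl scaleN1r. Qed.

Lemma cmulNr x y : x ** (- y) = - (x ** y).
Proof. by rewrite -scaleN1r -cscalerAr scaleN1r. Qed.

Lemma cmulBl x y z : (x - y) ** z = x ** z - y ** z.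
Proof. by rewrite cmulDl cmulNl. Qed.

Lemma cmulBr x y z : x ** (y - z) = x ** y - x ** z.
Proof. by rewrite cmulDr cmulNr. Qed.

Lemma cmul_suml I (r : seq I) (P : pred I) (F : I -> A) x :
  (\sum_(i <- r | P i) F i) ** x = \sum_(i <- r | P i) F i ** x.
Proof. by apply: (big_morph (fun y => y ** x)) => [y z|]; rewrite ?cmulDl ?cmul0l. Qed.

Lemma cmul_sumr I (r : seq I) (P : pred I) (F : I -> A) x :
  x ** (\sum_(i <- r | P i) F i) = \sum_(i <- r | P i) x ** F i.
Proof. by apply: (big_morph (cmul x)) => [y z|]; rewrite ?cmulDr ?cmul0r. Qed.

Lemma cadj0 : cadj (0 : A) = 0.
Proof. by rewrite -{1}(scale0r (0 : A)) cadjZ conjc0 scale0r. Qed.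

Lemma cadjN x : cadj (- x) = - cadj x.
Proof. by rewrite -scaleN1r cadjZ rmorphN1 scaleN1r. Qed.

Lemma cadjB x y : cadj (x - y) = cadj x - cadj y.
Proof. by rewrite cadjD cadjN. Qed.

Lemma nrmM x y : nrm (x ** y) <= nrm x * nrm y.
Proof. by rewrite -lecR rmorphM/= -!nrmE cnormM. Qed.

Lemma nrm_cstar x : nrm (cadj x ** x) = nrm x ^+ 2.
Proof. by apply: complexI; rewrite rmorphXn/= -!nrmE cnorm_adj. Qed.

Lemma nrm_adj x : nrm (cadj x) = nrm x.
Proof.
suff h y : nrm y <= nrm (cadj y).
  by apply/le_anti/andP; split=> //; rewrite -{2}(cadjK x) h.
have [->|y0] := eqVneq (nrm y) 0; first exact: nrm_ge0.
have yp : 0 < nrm y by rewrite lt_neqAle eq_sym y0 nrm_ge0.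
by rewrite -(ler_pM2r yp) -expr2 -nrm_cstar nrmM.
Qed.

Lemma nrm_proj x : is_projection x -> x <> 0 -> nrm x = 1.
Proof.
move=> [xx xa] x0; have := nrm_cstar x; rewrite xa xx expr2.
have n0 : nrm x != 0 by apply/eqP => /nrm0_eq0.
by move/eqP; rewrite -{1}(mulr1 (nrm x)) => /eqP/(mulfI n0).
Qed.

Lemma nrm_selfadj x : cadj x = x -> nrm (x ** x) = nrm x ^+ 2.
Proof. by move=> xa; rewrite -nrm_cstar xa. Qed.

End CStarBasics.

Section Span.
Variables (R : realType) (A : cstarType R).
Local Notation C := R[i].
Implicit Types (S : set A) (x y z : A).

(** The definition of [lin_span S] gives an unstructured finite combination;
    span arguments peel off one generator at a time instead. *)
Lemma lin_span_ind S (P : A -> Prop) : P 0 ->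
  (forall (c : C) x y, S x -> P y -> P (c *: x + y)) ->
  forall x, lin_span S x -> P x.
Proof.
move=> P0 PS x [n [c [v [Sv ->]]]].
elim: n c v Sv => [|n IH] c v Sv; first by rewrite big_ord0.
by rewrite big_ord_recl; apply: PS => //; apply: IH => i.
Qed.

Lemma lin_span0 S : lin_span S 0.
Proof.
by exists 0%N, (fun=> 0), (fun=> 0); split; [case|rewrite big_ord0].
Qed.

Lemma lin_span_cons S (c : C) x y : S x -> lin_span S y -> lin_span S (c *: x + y).
Proof.
move=> Sx [n [d [v [Sv ->]]]]; exists n.+1,
  (fun i => if unlift ord0 i is Some j then d j else c),
  (fun i => if unlift ord0 i is Some j then v j else x); split.
  by move=> i; case: unliftP.
rewrite big_ord_recl unlift_none; congr (_ + _).
by apply: eq_bigr => i _; rewrite liftK.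
Qed.

Lemma lin_span_gen S x : S x -> lin_span S x.
Proof.
by move=> Sx; rewrite -(addr0 x) -(scale1r x); apply: lin_span_cons => //; exact: lin_span0.
Qed.

Lemma lin_spanD S x y : lin_span S x -> lin_span S y -> lin_span S (x + y).
Proof.
move=> Sx Sy; apply: (@lin_span_ind S (fun x => lin_span S (x + y))) Sx.
  by rewrite add0r.
by move=> c {}x z Sx Sz; rewrite -addrA; exact: lin_span_cons.
Qed.

Lemma lin_spanZ S (a : C) x : lin_span S x -> lin_span S (a *: x).
Proof.
apply: (@lin_span_ind S (fun x => lin_span S (a *: x))) => [|c {}x z Sx Sz].
  by rewrite scaler0; exact: lin_span0.
by rewrite scalerDr scalerA; exact: lin_span_cons.
Qed.

Lemma lin_spanM S : (forall x y, S x -> S y -> lin_span S (x ** y)) ->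
  forall x y, lin_span S x -> lin_span S y -> lin_span S (x ** y).
Proof.
move=> SM x y Sx Sy; apply: (@lin_span_ind S (fun x => lin_span S (x ** y))) Sx.
  by rewrite cmul0l; exact: lin_span0.
move=> c {}x z Sx Sz; rewrite cmulDl -cscalerAl; apply: lin_spanD => //.
apply: lin_spanZ; apply: (@lin_span_ind S (fun y => lin_span S (x ** y))) Sy.
  by rewrite cmul0r; exact: lin_span0.
move=> d y' w Sy' Sw; rewrite cmulDr -cscalerAr.
by apply: lin_spanD => //; apply/lin_spanZ/SM.
Qed.

Lemma lin_span_adj S : (forall x, S x -> S (cadj x)) ->
  forall x, lin_span S x -> lin_span S (cadj x).
Proof.
move=> Sa; apply: lin_span_ind => [|c x y Sx Sy]; first by rewrite cadj0; exact: lin_span0.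
by rewrite cadjD cadjZ; apply: lin_span_cons => //; exact: Sa.
Qed.

Lemma lin_span_sub S (D : set A) : cstar_subalgebra D -> S `<=` D -> lin_span S `<=` D.
Proof.
move=> hD SD; apply: lin_span_ind => [|c x y /SD Dx Dy]; first exact: csub0.
by apply: (csubD hD) => //; exact: (csubZ hD).
Qed.

Lemma closure_sub_closed S (D : set A) : closed D -> S `<=` D -> closure S `<=` D.
Proof. by move=> cD SD x Sx; apply: cD; exact: closureS Sx. Qed.

Lemma closure_span_subalgebra S :
  (forall x y, S x -> S y -> lin_span S (x ** y)) ->
  (forall x, S x -> S (cadj x)) ->
  cstar_subalgebra (closure (lin_span S)).
Proof.
move=> SM Sa; split.
- exact: closed_closure.
- by apply: subset_closure; exact: lin_span0.
- move=> x y /closure_nrmP Sx /closure_nrmP Sy; apply/closure_nrmP => e e0.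
  have e20 : 0 < e / 2 by rewrite divr_gt0.
  have [x' Sx' xx'] := Sx _ e20; have [y' Sy' yy'] := Sy _ e20.
  exists (x' + y'); first exact: lin_spanD.
  by rewrite opprD addrACA (le_lt_trans (nrmD _ _))// (splitr e) ltrD.
- move=> a x /closure_nrmP Sx; apply/closure_nrmP => e e0.
  have a1 : 0 < nrm a + 1 by rewrite ltr_wpDl// nrm_ge0.
  have [x' Sx' xx'] := Sx _ (divr_gt0 e0 a1).
  exists (a *: x'); first exact: lin_spanZ.
  rewrite -scalerBr nrmZ; move: xx'; rewrite ltr_pdivlMr// => xx'.
  by apply: le_lt_trans xx'; rewrite mulrC ler_wpM2l ?nrm_ge0// lerDl.
- move=> x y /closure_nrmP Sx /closure_nrmP Sy; apply/closure_nrmP => e e0.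
  pose K := nrm x + nrm y + 1.
  have K0 : 0 < K by rewrite ltr_wpDl// addr_ge0// nrm_ge0.
  have d0 : 0 < Num.min 1 (e / (2 * K)) by rewrite lt_min ltr01 divr_gt0// mulr_gt0.
  have [x' Sx'] := Sx _ d0; rewrite lt_min => /andP[xx1 xx2].
  have [y' Sy'] := Sy _ d0; rewrite lt_min => /andP[yy1 yy2].
  exists (x' ** y'); first exact: lin_spanM.
  have -> : x ** y - x' ** y' = (x - x') ** y + x' ** (y - y').
    by rewrite cmulBl cmulBr addrA subrK.
  have x'K : nrm x' <= K.
    rewrite -(subrK x x') (le_trans (nrmD _ _))// nrmBC /K addrC -addrA lerD2l.
    by rewrite (le_trans (ltW xx1))// lerDr nrm_ge0.
  have yK : nrm y <= K by rewrite /K addrAC lerDr addr_ge0 ?nrm_ge0.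
  move: xx2 yy2; rewrite !ltr_pdivlMr ?mulr_gt0// => xx2 yy2.
  apply: le_lt_trans (nrmD _ _) _; rewrite (splitr e) ltrD//.
    apply: le_lt_trans (nrmM _ _) _; rewrite ltr_pdivlMr//.
    by apply: le_lt_trans xx2; rewrite -mulrA ler_wpM2l ?nrm_ge0// mulrC ler_pM2l.
  apply: le_lt_trans (nrmM _ _) _; rewrite ltr_pdivlMr//.
  by apply: le_lt_trans yy2; rewrite (mulrC (nrm x')) -mulrA ler_wpM2l ?nrm_ge0// mulrC ler_pM2l.
- move=> x /closure_nrmP Sx; apply/closure_nrmP => e /Sx[y Sy xy].
  by exists (cadj y); [exact: lin_span_adj|rewrite -cadjB nrm_adj].
Qed.

Lemma cstar_generated_sub S (D : set A) :
  cstar_subalgebra D -> S `<=` D -> cstar_generated S `<=` D.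
Proof. by move=> hD SD x; apply. Qed.

Lemma cstar_generated_gen S : S `<=` cstar_generated S.
Proof. by move=> x Sx D [_]; apply. Qed.

Lemma cstar_generated_subalgebra S : cstar_subalgebra (cstar_generated S).
Proof.
split.
- by apply: closed_bigI => D [hD _]; exact: csub_closed hD.
- by move=> D [hD _]; exact: csub0 hD.
- by move=> x y Sx Sy D hD; apply: (csubD hD.1); [exact: Sx|exact: Sy].
- by move=> a x Sx D hD; apply: (csubZ hD.1); exact: Sx.
- by move=> x y Sx Sy D hD; apply: (csubM hD.1); [exact: Sx|exact: Sy].
- by move=> x Sx D hD; apply: (csub_adj hD.1); exact: Sx.
Qed.

End Span.

Lemma geometric_cauchy (R : realType) (V : normedZmodType R[i]) (u : nat -> V) (r : R) :
  0 <= r -> r < 1 -> (forall n, nrm (u n.+1 - u n) <= r ^+ n) -> cauchy_nrm u.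
Proof.
move=> r0 r1 hu.
have r1' : 0 < 1 - r by rewrite subr_gt0.
have tail n k : nrm (u (n + k)%N - u n) <= r ^+ n / (1 - r).
  suff : nrm (u (n + k)%N - u n) <= r ^+ n * (1 - r ^+ k) / (1 - r).
    move=> h; apply: le_trans h _; apply: ler_wpM2r; first by rewrite invr_ge0 ltW.
    by rewrite ler_piMr ?exprn_ge0// gerBl exprn_ge0.
  elim: k => [|k IH]; first by rewrite addn0 !subrr nrm0 mulr0 mul0r.
  rewrite addnS (le_trans (nrm_triang (u (n + k)%N) _ _))//.
  apply: le_trans (lerD (hu _) IH) _.
  rewrite ler_pdivlMr// mulrDl mulfVK ?gt_eqF// exprD exprS le_eqVlt; apply/orP; left.
  by apply/eqP; ring.
move=> e e0.
have [N _ hN] : \forall n \near \oo, r ^+ n < e * (1 - r) / 2.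
  have := @cvg_expr R r; rewrite ger0_norm// => /(_ r1)/cvgrPdist_lt.
  move=> /(_ (e * (1 - r) / 2)); rewrite divr_gt0 ?mulr_gt0// => /(_ isT).
  by apply: filterS => n; rewrite sub0r normrN ger0_norm// exprn_ge0.
exists N => m n Nm Nn.
have half k : (N <= k)%N -> nrm (u k - u N) < e / 2.
  move=> /subnKC <-; apply: le_lt_trans (tail _ _) _.
  by rewrite ltr_pdivrMr// mulrAC hN//=.
apply: le_lt_trans (nrm_triang (u N) _ _) _; rewrite (splitr e) ltrD ?half//.
by rewrite nrmBC half.
Qed.

Section Contractive.
Variables (R : realType) (A : cstarType R).
Local Notation C := R[i].

(** The element [z = 1 - (1 - x^2)^(1/2)], so that [(1 - z)^2 + x^2 = 1], expressed
    without a unit. It is the fixed point of [z |-> (x^2 + z^2) / 2], a contraction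
    of the ball of radius [|x| < 1]. *)
Lemma defect_exists (D : set A) (x : A) : cstar_subalgebra D -> D x ->
  cadj x = x -> nrm x < 1 ->
  exists z, [/\ D z, cadj z = z, x ** z = z ** x & z + z = x ** x + z ** z].
Proof.
move=> hD Dx xa x1; pose r := nrm x.
pose h : C := 2^-1.
have hr : h^*%C = h by rewrite /h conjc_inv conjc_nat.
have h2 : nrm h = 2^-1.
  have -> : h = ((2^-1 : R)%:C)%C by rewrite /h fmorphV rmorph_nat.
  by rewrite nrm_real ger0_norm.
pose g z := h *: (x ** x + z ** z).
pose u n := iter n g 0.
have uD n : [/\ D (u n), cadj (u n) = u n, x ** u n = u n ** x & nrm (u n) <= r].
  elim: n => [|n [Du ua ux ur]].
    by split; [exact: csub0|rewrite /= cadj0|rewrite /= cmul0l cmul0r|rewrite /= nrm0 nrm_ge0].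
  rewrite /u iterS -/(u n) /g; split.
  - by apply/(csubZ hD)/(csubD hD); apply: (csubM hD).
  - by rewrite cadjZ hr cadjD !cadjM xa ua.
  - by rewrite -cscalerAl -cscalerAr cmulDl cmulDr cmulA -!cmulA -ux !cmulA ux.
  - rewrite nrmZ h2 mulrC ler_pdivrMr// (le_trans (nrmD _ _))//.
    rewrite mulr_natr mulr2n lerD// (le_trans (nrmM _ _))//.
      by rewrite ler_piMr ?nrm_ge0// ltW.
    rewrite (le_trans (ler_pM _ _ ur ur)) ?nrm_ge0//.
    by rewrite ler_piMr ?nrm_ge0// ltW.
have step z w : nrm z <= r -> nrm w <= r -> nrm (g z - g w) <= r * nrm (z - w).
  move=> zr wr; rewrite -scalerBr nrmZ h2 opprD addrACA subrr add0r.
  have -> : z ** z - w ** w = z ** (z - w) + (z - w) ** w.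
    by rewrite cmulBr cmulBl addrA subrK.
  rewrite mulrC ler_pdivrMr// (le_trans (nrmD _ _))// mulr_natr mulr2n lerD//.
    by rewrite (le_trans (nrmM _ _))// ler_wpM2r ?nrm_ge0.
  by rewrite (le_trans (nrmM _ _))// mulrC ler_wpM2r ?nrm_ge0.
have cu : cauchy_nrm u.
  apply: (@geometric_cauchy _ _ _ r); rewrite ?nrm_ge0//.
  elim=> [|n IH].
    rewrite /u /= subr0 expr0; have [_ _ _] := uD 1%N; rewrite /u /= => /le_trans; apply.
    exact: ltW.
  rewrite /u !(iterS _ g) -/(u n) -/(u n.+1) (le_trans (step _ _ _ _))//.
  - by have [] := uD n.+1.
  - by have [] := uD n.
  - by rewrite exprS ler_wpM2l ?nrm_ge0.
have [z uz] := complete_seq cu.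
have apx (e : R) : 0 < e -> exists2 n, nrm (z - u n) < e & nrm (z - u n.+1) < e.
  move=> /uz[N hN]; exists N; rewrite nrmBC hN//.
have zr : nrm z <= r.
  by apply: cvg_nrm_le uz _; exists 0%N => n _; have [] := uD n.
have eq0 (w : A) : (forall e : R, 0 < e -> nrm w <= e) -> w = 0.
  move=> hw; apply/nrm0_eq0/le_anti; rewrite nrm_ge0 andbT.
  by apply: le_epsP => e e0; rewrite add0r hw.
exists z; split.
- move/closed_nrmP: (csub_closed hD); apply => e /apx[n zn _].
  by exists (u n) => //; have [] := uD n.
- apply/subr0_eq/eq0 => e e0; have [n zn _] := apx _ (divr_gt0 e0 (ltr0n _ 2)).
  rewrite (le_trans (nrm_triang (u n) _ _))// (splitr e) lerD// ltW//.
    by have [_ <- _ _] := uD n; rewrite -cadjB nrm_adj.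
  by rewrite nrmBC.
- apply/subr0_eq/eq0 => e e0; have [n zn _] := apx _ (divr_gt0 e0 (ltr0n _ 2)).
  rewrite (le_trans (nrm_triang (x ** u n) _ _))// (splitr e) lerD// ltW//.
    rewrite -cmulBr (le_lt_trans (nrmM _ _))// (le_lt_trans _ zn)//.
    by rewrite ler_piMl ?nrm_ge0// ltW.
  have [_ _ -> _] := uD n.
  rewrite -cmulBl (le_lt_trans (nrmM _ _))// nrmBC (le_lt_trans _ zn)//.
  by rewrite ler_piMr ?nrm_ge0// ltW.
- have zg : z = g z.
    apply/subr0_eq/eq0 => e e0; have [n zn zn1] := apx _ (divr_gt0 e0 (ltr0n _ 2)).
    rewrite (le_trans (nrm_triang (u n.+1) _ _))// (splitr e) lerD// ltW//.
    rewrite /u iterS -/(u n) nrmBC (le_lt_trans (step _ _ _ _))//.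
      by have [] := uD n.
    by apply: le_lt_trans zn; rewrite ler_piMl ?nrm_ge0// ltW.
  rewrite {1 2}zg /g -scalerDl -[RHS]scale1r; congr (_ *: _).
  by rewrite /h -mulr2n -(mulr_natr 2^-1) mulVf// pnatr_eq0.
Qed.

End Contractive.

Section StarHom.
Variables (R : realType) (B A : cstarType R) (D : set B) (f : B -> A).
Local Notation C := R[i].
Hypothesis hD : cstar_subalgebra D.
Hypothesis hf : star_hom_on D f.

Lemma shom0 : f 0 = 0.
Proof. by rewrite -(scale0r (0 : B)) (shomZ hf) ?scale0r//; exact: csub0. Qed.

Lemma csubN x : D x -> D (- x).
Proof. by move=> Dx; rewrite -scaleN1r; exact: csubZ. Qed.

Lemma csubB x y : D x -> D y -> D (x - y).
Proof. by move=> Dx Dy; apply: csubD => //; exact: csubN. Qed.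

Lemma shomN x : D x -> f (- x) = - f x.
Proof. by move=> Dx; rewrite -scaleN1r (shomZ hf)// scaleN1r. Qed.

Lemma shomB x y : D x -> D y -> f (x - y) = f x - f y.
Proof. by move=> Dx Dy; rewrite (shomD hf) ?shomN//; exact: csubN. Qed.

(** With [z] the defect of [x], the elements [1 - f z +- i f x] act isometrically
    on [A] by left multiplication, and [i f x] is half their difference. Only
    algebraic identities cross [f], whose continuity is not assumed. *)
Lemma shom_selfadj_le1 x : D x -> cadj x = x -> nrm x < 1 -> nrm (f x) <= 1.
Proof.
move=> Dx xa x1; have [z [Dz za xz zz]] := defect_exists hD Dx xa x1.
set a := f x; set c := f z.
have aa : cadj a = a by rewrite /a -(shom_adj hf)// xa.
have ca : cadj c = c by rewrite /c -(shom_adj hf)// za.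
have ac : a ** c = c ** a by rewrite /a /c -!(shomM hf)// xz.
have cc : c + c = a ** a + c ** c.
  by rewrite /a /c -!(shomM hf)// -!(shomD hf)// ?zz//; exact: (csubM hD).
(* [s] stands for [i] or [- i]. *)
have unit (s : C) y : s * s = -1 -> s^*%C = - s -> nrm (y - c ** y + s *: (a ** y)) = nrm y.
  move=> s2 sc; set w := y - _ + _.
  have /(congr1 (@nrm R A)) : cadj w ** w = cadj y ** y.
    pose b := c ** y; pose d := a ** y.
    have cab : cadj b ** b = cadj y ** (c ** c ** y).
      by rewrite /b cadjM ca !cmulA.
    have cad : cadj d ** d = cadj y ** (a ** a ** y).
      by rewrite /d cadjM aa !cmulA.
    have bd : cadj b ** d = cadj d ** b.
      by rewrite /b /d !cadjM aa ca -!cmulA; congr (_ ** _); rewrite !cmulA ac.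
    have yb : cadj b ** y = cadj y ** b by rewrite /b cadjM ca cmulA.
    have yd : cadj d ** y = cadj y ** d by rewrite /d cadjM aa cmulA.
    have ybb : cadj y ** b + cadj y ** b = cadj d ** d + cadj b ** b.
      rewrite cab cad -!cmulDr; congr (_ ** _).
      by rewrite /b -!cmulDl cmulDr -cmulDl cc.
    have cross : cadj (y - b) ** (s *: d) + cadj (s *: d) ** (y - b) = 0.
      rewrite cadjZ sc -cscalerAl -cscalerAr scaleNr -scalerBr cadjB.
      by rewrite cmulBl cmulBr yd bd subrr scaler0.
    have sd : cadj (s *: d) ** (s *: d) = cadj d ** d.
      by rewrite cadjZ sc -cscalerAl -cscalerAr scalerA mulNr s2 opprK scale1r.
    have -> : w = y - b + s *: d by [].
    set e := y - b in cross *; have eE : e = y - b by []; clearbody e.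
    rewrite cadjD cmulDl !cmulDr addrA sd -(addrA (cadj e ** e)) cross addr0.
    rewrite eE cadjB cmulBl !cmulBr yb opprB addrACA -opprD addrAC -(addrA (cadj y ** y)).
    by rewrite (addrC (cadj b ** b)) -ybb addrK.
  rewrite !nrm_cstar => /eqP; rewrite eqrXn2 ?nrm_ge0// => /eqP//.
have is2 : ('i * 'i = -1 :> C)%C by rewrite -expr2 sqr_i.
have isc : ('i^* = - 'i :> C)%C by apply/eqP; rewrite eq_complex /= oppr0 !eqxx.
have lmul y : nrm (a ** y) <= nrm y.
  have up := unit ('i)%C y is2 isc.
  have um : nrm (y - c ** y - 'i%C *: (a ** y)) = nrm y.
    rewrite -scaleNr; apply: unit; first by rewrite mulrNN.
    by apply/eqP; rewrite eq_complex /= !oppr0 !eqxx.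
  have n2 : nrm (2%:R * 'i%C : C) = 2.
    have -> : (2%:R : C) = ((2%:R : R)%:C)%C by rewrite rmorph_nat.
    rewrite nrmcM nrm_real ger0_norm// /nrm normc_def /= expr0n expr1n add0r.
    by rewrite sqrtr1 mulr1.
  rewrite -(ler_pM2l (ltr0n _ 2)) -{1}n2 -nrmZ -scalerA scaler_nat mulr2n.
  have -> : 'i%C *: (a ** y) + 'i%C *: (a ** y) =
      (y - c ** y + 'i%C *: (a ** y)) - (y - c ** y - 'i%C *: (a ** y)).
    by rewrite opprB (addrC (y - c ** y)) addrACA subrr addr0.
  by rewrite (le_trans (nrmB _ _))// up um mulr2n mulrDl mul1r.
have := lmul a; rewrite nrm_selfadj// expr2.
have [->//|n0] := eqVneq (nrm a) 0.
rewrite -{3}(mul1r (nrm a)) ler_pM2r// lt_neqAle eq_sym n0; exact: nrm_ge0.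
Qed.

(** The C*-identity reduces the claim to self-adjoint elements, and scaling to
    the open unit ball. *)
Lemma shom_contractive x : D x -> nrm (f x) <= nrm x.
Proof.
suff sa y : D y -> cadj y = y -> nrm (f y) <= nrm y.
  move=> Dx; rewrite -(@ler_pXn2r _ 2)// ?nnegrE ?nrm_ge0// -!nrm_cstar.
  have Dxx : D (cadj x ** x) by apply: (csubM hD) => //; exact: csub_adj.
  rewrite -(shom_adj hf)// -(shomM hf)//; last exact: csub_adj.
  by apply: sa => //; rewrite cadjM cadjK.
move=> Dy ya; apply: le_epsP => e e0.
set t := nrm y + e; have t0 : 0 < t by rewrite ltr_wpDl ?nrm_ge0.
pose s : C := (t^-1%:C)%C.
have ns : nrm s = t^-1 by rewrite nrm_real ger0_norm// invr_ge0 ltW.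
have : nrm (f (s *: y)) <= 1.
  apply: shom_selfadj_le1; first exact: csubZ.
    by rewrite cadjZ ya /s conjc_real.
  by rewrite nrmZ ns mulrC ltr_pdivrMr// mul1r ltrDl.
by rewrite (shomZ hf)// nrmZ ns mulrC ler_pdivrMr// mul1r.
Qed.

End StarHom.

(** * Bounded adjointable operators on a Hilbert space *)

HB.mixin Record isHilbert (R : realType) H of CompleteNormedModule R[i] H := {
  ip : H -> H -> R[i] ;
  ipDl : forall x y z, ip (x + y) z = ip x z + ip y z ;
  ipZl : forall (a : R[i]) x y, ip (a *: x) y = a * ip x y ;
  ipC : forall x y, ip x y = ((ip y x)^*)%C ;
  ip_norm : forall x, ip x x = ((nrm x ^+ 2)%:C)%C
}.

#[short(type="hilbertType")]
HB.structure Definition Hilbert (R : realType) :=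
  {H of CompleteNormedModule R[i] H & isHilbert R H}.

Section InnerProduct.
Variables (R : realType) (H : hilbertType R).
Local Notation C := R[i].
Implicit Types (x y z : H).

Lemma ipDr x y z : ip x (y + z) = ip x y + ip x z.
Proof. by rewrite ipC ipDl rmorphD/= -!(ipC x). Qed.

Lemma ipZr (a : C) x y : ip x (a *: y) = (a^*)%C * ip x y.
Proof. by rewrite ipC ipZl rmorphM/= -(ipC x). Qed.

Lemma ip0l y : ip 0 y = 0.
Proof. by rewrite -(scale0r (0 : H)) ipZl mul0r. Qed.

Lemma ip0r y : ip y 0 = 0.
Proof. by rewrite ipC ip0l conjc0. Qed.

Lemma ipNl x y : ip (- x) y = - ip x y.
Proof. by rewrite -scaleN1r ipZl mulN1r. Qed.

Lemma ipNr x y : ip x (- y) = - ip x y.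
Proof. by rewrite -scaleN1r ipZr rmorphN1 mulN1r. Qed.

Lemma ipBl x y z : ip (x - y) z = ip x z - ip y z.
Proof. by rewrite ipDl ipNl. Qed.

Lemma ipBr x y z : ip x (y - z) = ip x y - ip x z.
Proof. by rewrite ipDr ipNr. Qed.

Lemma cauchy_schwarz x y : nrm (ip x y) <= nrm x * nrm y.
Proof.
have [->|y0] := eqVneq y 0; first by rewrite ip0r !nrm0 mulr0.
set c := ip x y; pose t := nrm y ^+ 2.
have t0 : 0 < t.
  rewrite exprn_gt0// lt_neqAle nrm_ge0 eq_sym andbT.
  by apply: contraNneq y0 => /nrm0_eq0 ->.
(* Scaling by [t = |y|^2] avoids a division. *)
have : 0 <= nrm ((t%:C)%C *: x - c *: y) ^+ 2 by rewrite exprn_ge0 ?nrm_ge0.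
suff -> : nrm ((t%:C)%C *: x - c *: y) ^+ 2 = t * (t * nrm x ^+ 2 - nrm c ^+ 2).
  rewrite pmulr_rge0// subr_ge0 /t -exprMn mulrC => h.
  by rewrite -(@ler_pXn2r _ 2)// ?nnegrE ?mulr_ge0 ?nrm_ge0.
apply: complexI; rewrite -ip_norm ipBl !ipBr !ipZl !ipZr (ipC y x) -/c !ip_norm -/t.
clearbody t; move: (nrm c ^+ 2) (nrmcE c) (nrm x ^+ 2) => d dE X.
rewrite conjc_real !(rmorphM, rmorphB)/= dE; ring.
Qed.

Lemma ip_eq x y : (forall z, ip x z = ip y z) -> x = y.
Proof.
move=> h; apply/subr0_eq/nrm0_eq0/eqP; rewrite -sqrf_eq0; apply/eqP/complexI.
by rewrite -ip_norm ipBl h subrr.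
Qed.

End InnerProduct.

Section BoundedOperators.
Variables (R : realType) (H : hilbertType R).
Local Notation C := R[i].

(** Linearity is a consequence of having an adjoint. *)
Definition adjointable (T : H -> H) : Prop := exists (T' : H -> H) (K : R),
  (forall x y, ip (T x) y = ip x (T' y)) /\ (forall x, nrm (T x) <= K * nrm x).

Definition adjointable_pred : {pred H -> H} := fun T => `[< adjointable T >].

Lemma adjointableP T : reflect (adjointable T) (T \in adjointable_pred).
Proof. exact: asboolP. Qed.

Lemma adjointable_submod : submod_closed adjointable_pred.
Proof.
split=> [|a S T /adjointableP[S' [K [S1 S2]]] /adjointableP[T' [L [T1 T2]]]].
  apply/adjointableP; exists (fun=> 0), 0; split=> [x y|x] /=.
    by rewrite ip0l ip0r.
  by rewrite nrm0 mul0r.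
apply/adjointableP; exists (fun x => (a^*)%C *: S' x + T' x), (nrm a * K + L).
split=> [x y|x]; first by rewrite ipDl ipZl S1 T1 ipDr ipZr conjcK.
rewrite (le_trans (nrmD _ _))// mulrDl lerD//.
by rewrite nrmZ -mulrA ler_wpM2l ?nrm_ge0.
Qed.

HB.instance Definition _ := GRing.isSubmodClosed.Build C (H -> H) adjointable_pred
  adjointable_submod.

Record bop := Bop { bop_fun :> H -> H ; bop_subproof : bop_fun \in adjointable_pred }.

HB.instance Definition _ := [isSub for bop_fun].
HB.instance Definition _ := [Choice of bop by <:].
HB.instance Definition _ := [SubChoice_isSubLmodule of bop by <:].

Lemma bopP (S T : bop) : S =1 T -> S = T.
Proof. by move=> ST; apply/val_inj/funext. Qed.

Lemma bop_adjointable (T : bop) : adjointable T.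
Proof. exact/adjointableP/bop_subproof. Qed.

Lemma bop0E x : (0 : bop) x = 0. Proof. by []. Qed.
Lemma bopDE (S T : bop) x : (S + T) x = S x + T x. Proof. by []. Qed.
Lemma bopBE (S T : bop) x : (S - T) x = S x - T x. Proof. by []. Qed.
Lemma bopZE (a : C) (T : bop) x : (a *: T) x = a *: T x. Proof. by []. Qed.

Lemma bopB (T : bop) x y : T (x - y) = T x - T y.
Proof.
have [T' [K [T1 _]]] := bop_adjointable T.
by apply: ip_eq => z; rewrite ipBl !T1 ipBl.
Qed.

Lemma bopZ (T : bop) (a : C) x : T (a *: x) = a *: T x.
Proof.
have [T' [K [T1 _]]] := bop_adjointable T.
by apply: ip_eq => z; rewrite ipZl !T1 ipZl.
Qed.

Lemma bop0 (T : bop) : T 0 = 0.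
Proof. by have := bopZ T 0 0; rewrite !scale0r. Qed.

Lemma bopD (T : bop) x y : T (x + y) = T x + T y.
Proof. by rewrite -{1}(opprK y) bopB -(sub0r y) bopB bop0 sub0r opprK. Qed.

Lemma bop_sum (T : bop) I (r : seq I) (P : pred I) (F : I -> H) :
  T (\sum_(i <- r | P i) F i) = \sum_(i <- r | P i) T (F i).
Proof. by apply: (big_morph T) => [y z|]; rewrite ?bopD ?bop0. Qed.

Definition opnorm (T : bop) : R := sup [set nrm (T x) | x in [set x | nrm x <= 1]].

Lemma opnorm_sup (T : bop) : has_sup [set nrm (T x) | x in [set x | nrm x <= 1]].
Proof.
have [_ [K [_ TK]]] := bop_adjointable T.
split; first by exists (nrm (T 0)), 0 => //=; rewrite nrm0.
exists `|K| => _ [x /= x1 <-]; rewrite (le_trans (TK x))//.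
rewrite (le_trans (ler_wpM2r (nrm_ge0 _) (ler_norm K)))//.
by rewrite ler_piMr.
Qed.

Lemma opnorm_ge0 T : 0 <= opnorm T.
Proof.
rewrite (le_trans (nrm_ge0 (T 0)))//; apply: (sup_upper_bound (opnorm_sup T)).
by exists 0 => //=; rewrite nrm0.
Qed.

Lemma opnormP (T : bop) x : nrm (T x) <= opnorm T * nrm x.
Proof.
have [->|x0] := eqVneq x 0; first by rewrite bop0 !nrm0 mulr0.
have xp : 0 < nrm x.
  rewrite lt_neqAle nrm_ge0 eq_sym andbT.
  by apply: contraNneq x0 => /nrm0_eq0 ->.
rewrite -ler_pdivrMr// mulrC.
have nx : nrm (((nrm x)^-1)%:C%C : C) = (nrm x)^-1.
  by rewrite nrm_real ger0_norm// invr_ge0 ltW.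
rewrite -nx -nrmZ -bopZ; apply: (sup_upper_bound (opnorm_sup T)).
by exists (((nrm x)^-1)%:C%C *: x) => //=; rewrite nrmZ nx mulVf// gt_eqF.
Qed.

Lemma opnorm_le (T : bop) K : 0 <= K -> (forall x, nrm (T x) <= K * nrm x) -> opnorm T <= K.
Proof.
move=> K0 TK; apply: ge_sup; first exact: (opnorm_sup T).1.
by move=> _ [x /= x1 <-]; rewrite (le_trans (TK x))// ler_piMr.
Qed.

Definition opnormC (T : bop) : C := (opnorm T)%:C%C.

Lemma opnormC_triangle S T : opnormC (S + T) <= opnormC S + opnormC T.
Proof.
rewrite /opnormC -rmorphD lecR opnorm_le ?addr_ge0 ?opnorm_ge0// => x.
by rewrite bopDE (le_trans (nrmD _ _))// mulrDl lerD ?opnormP.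
Qed.

Lemma opnormCZ (a : C) T : opnormC (a *: T) = `|a| * opnormC T.
Proof.
rewrite /opnormC nrmE -rmorphM/=; congr (_%:C)%C; apply/le_anti/andP; split.
  rewrite opnorm_le ?mulr_ge0 ?nrm_ge0 ?opnorm_ge0// => x.
  by rewrite bopZE nrmZ -mulrA ler_wpM2l ?nrm_ge0 ?opnormP.
have [->|a0] := eqVneq a 0; first by rewrite nrm0 mul0r opnorm_ge0.
have ap : 0 < nrm a.
  rewrite lt_neqAle nrm_ge0 eq_sym andbT.
  by apply: contraNneq a0 => /nrm0_eq0 ->.
rewrite mulrC -ler_pdivlMr// opnorm_le ?divr_ge0 ?opnorm_ge0 ?nrm_ge0// => x.
rewrite mulrAC ler_pdivlMr// mulrC -nrmZ -bopZE; exact: opnormP.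
Qed.

Lemma opnormC_eq0 T : opnormC T = 0 -> T = 0.
Proof.
move=> /(@complexI _ _ 0) T0; apply: bopP => x; apply: nrm0_eq0; apply/le_anti.
by rewrite nrm_ge0 andbT (le_trans (opnormP T x))// T0 mul0r.
Qed.

HB.instance Definition _ := Lmodule_isNormed.Build C bop
  opnormC_triangle opnormCZ opnormC_eq0.

Lemma nrm_bopP (T : bop) x : nrm (T x) <= nrm T * nrm x.
Proof. exact: opnormP. Qed.

Lemma nrm_bop_le (T : bop) K : 0 <= K -> (forall x, nrm (T x) <= K * nrm x) -> nrm T <= K.
Proof. exact: opnorm_le. Qed.

(** ** The adjoint *)

Lemma badj_subproof (T : bop) : {S : bop | forall x y, ip (T x) y = ip x (S y)}.
Proof.
apply: cid; have [S [K [TS TK]]] := bop_adjointable T.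
suff hS : S \in adjointable_pred by exists (Bop hS).
apply/adjointableP; exists T, (nrm T); split=> [x y|y].
  by rewrite ipC -TS -ipC.
have [->|Sy0] := eqVneq (S y) 0; first by rewrite nrm0 mulr_ge0 ?nrm_ge0.
have yp : 0 < nrm (S y).
  rewrite lt_neqAle nrm_ge0 eq_sym andbT.
  by apply: contraNneq Sy0 => /nrm0_eq0 ->.
rewrite -(ler_pM2l yp) -expr2 -[leLHS]ger0_norm ?exprn_ge0 ?nrm_ge0//.
rewrite -nrm_real -ip_norm -TS (le_trans (cauchy_schwarz _ _))//.
by rewrite mulrCA mulrA ler_wpM2r ?nrm_ge0 ?nrm_bopP.
Qed.

Definition badj (T : bop) : bop := sval (badj_subproof T).

Lemma badjP (T : bop) x y : ip (T x) y = ip x (badj T y).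
Proof. by rewrite /badj; case: badj_subproof. Qed.

Lemma badjP' (T : bop) x y : ip (badj T x) y = ip x (T y).
Proof. by rewrite ipC -badjP -ipC. Qed.

Lemma badj_unique (T S : bop) : (forall x y, ip (T x) y = ip x (S y)) -> badj T = S.
Proof.
move=> TS; apply: bopP => x; apply: ip_eq => z.
by rewrite ipC -badjP TS -ipC.
Qed.

Lemma bmul_subproof (S T : bop) : (fun x => S (T x)) \in adjointable_pred.
Proof.
apply/adjointableP; exists (fun x => badj T (badj S x)), (nrm S * nrm T).
split=> [x y|x]; first by rewrite !badjP.
by rewrite (le_trans (nrm_bopP _ _))// -mulrA ler_wpM2l ?nrm_ge0 ?nrm_bopP.
Qed.

Definition bmul (S T : bop) : bop := Bop (bmul_subproof S T).

Lemma badjD : {morph badj : S T / S + T}.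
Proof.
by move=> S T; apply: badj_unique => x y; rewrite bopDE ipDl !badjP ipDr.
Qed.

Lemma badjZ (a : C) T : badj (a *: T) = (a^*)%C *: badj T.
Proof.
by apply: badj_unique => x y; rewrite bopZE ipZl badjP ipZr conjcK.
Qed.

Lemma badjM S T : badj (bmul S T) = bmul (badj T) (badj S).
Proof. by apply: badj_unique => x y /=; rewrite !badjP. Qed.

Lemma badjK : involutive badj.
Proof. by move=> T; apply: badj_unique => x y; rewrite badjP'. Qed.

Lemma nrm_bmul S T : nrm (bmul S T) <= nrm S * nrm T.
Proof.
rewrite nrm_bop_le ?mulr_ge0 ?nrm_ge0// => x /=.
by rewrite (le_trans (nrm_bopP _ _))// -mulrA ler_wpM2l ?nrm_ge0 ?nrm_bopP.
Qed.

Lemma bop_sqr_le (T : bop) x : nrm (T x) ^+ 2 <= nrm (bmul (badj T) T) * nrm x ^+ 2.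
Proof.
rewrite -[leLHS]ger0_norm ?exprn_ge0 ?nrm_ge0// -nrm_real -ip_norm badjP.
rewrite (le_trans (cauchy_schwarz _ _))// expr2 mulrCA.
by rewrite ler_wpM2l ?nrm_ge0// (nrm_bopP (bmul (badj T) T)).
Qed.

(** Half of the C*-identity; it bounds [T] by its adjoint, which gives the other. *)
Lemma nrm_badj_mul_ge T : nrm T ^+ 2 <= nrm (bmul (badj T) T).
Proof.
set S := bmul _ _; rewrite -(sqr_sqrtr (nrm_ge0 S)).
rewrite ler_pXn2r ?nnegrE ?nrm_ge0 ?sqrtr_ge0//.
rewrite nrm_bop_le ?sqrtr_ge0// => x.
rewrite -(@ler_pXn2r _ 2)// ?nnegrE ?mulr_ge0 ?nrm_ge0 ?sqrtr_ge0//.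
by rewrite exprMn (sqr_sqrtr (nrm_ge0 S)) bop_sqr_le.
Qed.

Lemma nrm_badj T : nrm (badj T) = nrm T.
Proof.
suff h S : nrm S <= nrm (badj S).
  by apply/le_anti/andP; split=> //; rewrite -{2}(badjK T) h.
have [->|y0] := eqVneq (nrm S) 0; first exact: nrm_ge0.
have yp : 0 < nrm S by rewrite lt_neqAle eq_sym y0 nrm_ge0.
by rewrite -(ler_pM2r yp) -expr2 (le_trans (nrm_badj_mul_ge S))// nrm_bmul.
Qed.

Lemma nrm_badj_mul T : nrm (bmul (badj T) T) = nrm T ^+ 2.
Proof.
apply/le_anti; rewrite nrm_badj_mul_ge andbT.
by rewrite (le_trans (nrm_bmul _ _))// nrm_badj expr2.
Qed.

(** ** Completeness *)

(** A Cauchy sequence of operators converges pointwise, as do the adjoints, and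
    the two limits are adjoint to each other. *)
Lemma bop_complete (u : nat -> bop) : cauchy_nrm u -> exists l, cvg_nrm u l.
Proof.
have pointwise (v : nat -> bop) x : cauchy_nrm v -> exists l, cvg_nrm (fun n => v n x) l.
  move=> cv; apply: complete_seq => e e0.
  have x1 : 0 < nrm x + 1 by rewrite ltr_wpDl ?nrm_ge0.
  have [N hN] := cv _ (divr_gt0 e0 x1); exists N => m n Nm Nn.
  have := hN m n Nm Nn; rewrite ltr_pdivlMr// => h.
  rewrite -bopBE (le_lt_trans (nrm_bopP _ _))// (le_lt_trans _ h)//.
  by rewrite ler_wpM2l ?nrm_ge0// lerDl.
move=> cu; have cu' : cauchy_nrm (fun n => badj (u n)).
  move=> e /cu[N hN]; exists N => m n Nm Nn.
  have := hN m n Nm Nn; rewrite -nrm_badj badjD.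
  by rewrite -(scaleN1r (u n)) badjZ rmorphN1 scaleN1r.
have [g gP] := choice (fun x => pointwise u x cu).
have [g' gP'] := choice (fun x => pointwise _ x cu').
have ipl (v : nat -> H) l y : cvg_nrm v l ->
    cvg_nrm (fun n => ip (v n) y) (ip l y) /\ cvg_nrm (fun n => ip y (v n)) (ip y l).
  move=> vl; have y1 : 0 < nrm y + 1 by rewrite ltr_wpDl ?nrm_ge0.
  split=> e e0; have [N hN] := vl _ (divr_gt0 e0 y1); exists N => n /hN;
    rewrite ltr_pdivlMr// => h; apply: le_lt_trans h.
    rewrite -ipBl (le_trans (cauchy_schwarz _ _))//.
    by rewrite ler_wpM2l ?nrm_ge0// lerDl.
  rewrite -ipBr (le_trans (cauchy_schwarz _ _))// mulrC.
  by rewrite ler_wpM2l ?nrm_ge0// lerDl.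
have hg : g \in adjointable_pred.
  have [N [M hM]] := cauchy_bounded cu.
  apply/adjointableP; exists g', M; split=> [x y|x].
    have [h1 _] := ipl _ _ y (gP x); have [_ h2] := ipl _ _ x (gP' y).
    apply: cvg_nrm_unique h1 _; move=> e /h2[N' hN']; exists N' => n /hN'.
    by rewrite badjP.
  apply: cvg_nrm_le (gP x) _; exists N => n /hM un.
  by rewrite (le_trans (nrm_bopP _ _))// ler_wpM2r ?nrm_ge0.
exists (Bop hg) => e e0; have e20 : 0 < e / 2 by rewrite divr_gt0.
have [N hN] := cu _ e20; exists N => n Nn.
apply: (@le_lt_trans _ _ (e / 2)); last by rewrite ltr_pdivrMr// ltr_pMr// ltr1n.
rewrite nrm_bop_le ?ltW// => x; rewrite bopBE /=.
have : cvg_nrm (fun m => u n x - u m x) (u n x - g x).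
  move=> d d0; have [N' hN'] := gP x d d0; exists N' => m /hN' h'.
  by rewrite opprB addrC addrA subrK nrmBC.
move=> h; apply: cvg_nrm_le h _; exists N => m Nm; rewrite -bopBE.
by rewrite (le_trans (nrm_bopP _ _))// ler_wpM2r ?nrm_ge0// ltW// hN.
Qed.

HB.instance Definition _ := Uniform_isComplete.Build bop
  (seq_complete_filter bop_complete).

Fact bmulA : associative bmul. Proof. by move=> S T U; exact: bopP. Qed.
Fact bmulDl : left_distributive bmul +%R. Proof. by move=> S T U; exact: bopP. Qed.
Fact bmulDr : right_distributive bmul +%R.
Proof. by move=> S T U; apply: bopP => x; exact: bopD. Qed.
Fact bscalerAl (a : C) (S T : bop) : a *: bmul S T = bmul (a *: S) T.
Proof. exact: bopP. Qed.
Fact bscalerAr (a : C) (S T : bop) : a *: bmul S T = bmul S (a *: T).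
Proof. by apply: bopP => x; exact/esym/bopZ. Qed.
Fact bnormM (S T : bop) : `|bmul S T| <= `|S| * `|T|.
Proof. by rewrite !nrmE -rmorphM lecR nrm_bmul. Qed.
Fact bnorm_adj (T : bop) : `|bmul (badj T) T| = `|T| ^+ 2.
Proof. by rewrite !nrmE -rmorphXn nrm_badj_mul. Qed.

HB.instance Definition _ := isCStarAlgebra.Build R bop
  bmulA bmulDl bmulDr bscalerAl bscalerAr badjD badjZ badjM badjK bnormM bnorm_adj.

End BoundedOperators.

(** * The Hilbert space of square-summable families *)

Lemma real_cauchy_cvg (R : realType) (u : nat -> R) :
  (forall e, 0 < e -> exists N, forall m n, (N <= m)%N -> (N <= n)%N -> `|u m - u n| < e) ->
  exists l, forall e, 0 < e -> exists N, forall n, (N <= n)%N -> `|u n - l| < e.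
Proof.
move=> cu; have : cvg (u @ \oo).
  apply: cauchy_cvg; apply/cauchy_ballP => e e0.
  have [N hN] := cu _ e0.
  exists (u @` [set n | (N <= n)%N], u @` [set n | (N <= n)%N]).
    by split; exists N => // n Nn /=; exists n.
  by move=> [x y] /= [[m Nm <-] [n Nn <-]]; rewrite -ball_normE /=; exact: hN.
move=> /cvg_ex[l /cvgrPdist_lt ul]; exists l => e /ul[N _ hN].
by exists N => n Nn; rewrite distrC; exact: hN.
Qed.

Lemma complex_cauchy_cvg (R : realType) (u : nat -> R[i]) :
  cauchy_nrm u -> exists l, cvg_nrm u l.
Proof.
move=> cu.
have [a ha] : exists l, forall e, 0 < e -> exists N, forall n, (N <= n)%N ->
    `|complex.Re (u n) - l| < e.
  apply: real_cauchy_cvg => e /cu[N hN]; exists N => m n Nm Nn.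
  by rewrite (le_lt_trans _ (hN m n Nm Nn))// -raddfB Re_le_nrm.
have [b hb] : exists l, forall e, 0 < e -> exists N, forall n, (N <= n)%N ->
    `|complex.Im (u n) - l| < e.
  apply: real_cauchy_cvg => e /cu[N hN]; exists N => m n Nm Nn.
  by rewrite (le_lt_trans _ (hN m n Nm Nn))// -raddfB Im_le_nrm.
exists (a +i* b)%C => e e0; have e20 : 0 < e / 2 by rewrite divr_gt0.
have [N1 h1] := ha _ e20; have [N2 h2] := hb _ e20.
exists (maxn N1 N2) => n; rewrite geq_max => /andP[/h1 n1 /h2 n2].
rewrite (le_lt_trans (nrm_ReIm _))// (splitr e) !raddfB/= ltrD//.
Qed.

Lemma cvg_nrm_norm (R : realType) (V : normedZmodType R[i]) (u : nat -> V) (l : V) :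
  cvg_nrm u l -> nrm (u n) @[n --> \oo] --> nrm l.
Proof.
have tri (x y : V) : nrm x <= nrm y + nrm (x - y).
  by rewrite addrC -{1}(subrK y x) nrmD.
move=> ul; apply/cvgrPdist_lt => e /ul[N hN]; exists N => // n /= Nn.
apply: le_lt_trans (hN n Nn); rewrite ler_norml.
by have := tri (u n) l; have := tri l (u n); rewrite (nrmBC l); lra.
Qed.

Section UniqSums.
Variable (S : eqType).

Lemma sum_uniq_sub (V : zmodType) (s t : seq S) (h : S -> V) :
  uniq s -> uniq t -> {subset s <= t} ->
  \sum_(i <- t) h i = \sum_(i <- s) h i + \sum_(i <- t | i \notin s) h i.
Proof.
move=> us ut st; rewrite (bigID (mem s)) /=; congr (_ + _).
rewrite -big_filter; apply: perm_big; apply: uniq_perm => //.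
  exact: filter_uniq.
move=> i; rewrite mem_filter; case: (boolP (i \in s)) => //= /st ->//.
Qed.

Lemma sum_uniq_sub0 (V : zmodType) (s t : seq S) (h : S -> V) :
  uniq s -> uniq t -> {subset s <= t} -> (forall i, i \in t -> i \notin s -> h i = 0) ->
  \sum_(i <- t) h i = \sum_(i <- s) h i.
Proof.
move=> us ut st h0; rewrite (sum_uniq_sub _ us ut st) [X in _ + X]big1_seq ?addr0//.
by move=> i /andP[is_ it]; exact: h0.
Qed.

Lemma sum_uniq_le (R : numDomainType) (s t : seq S) (h : S -> R) :
  uniq s -> uniq t -> {subset s <= t} -> (forall i, 0 <= h i) ->
  \sum_(i <- s) h i <= \sum_(i <- t) h i.
Proof.
by move=> us ut st h0; rewrite (sum_uniq_sub _ us ut st) lerDl sumr_ge0.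
Qed.

(** Partially defined changes of variables: indices where [g] is undefined
    contribute nothing. *)
Lemma sum_pmap (V : zmodType) (T : eqType) (g : T -> option S) (h : S -> V) (s : seq T) :
  \sum_(i <- s) oapp h 0 (g i) = \sum_(j <- pmap g s) h j.
Proof.
elim: s => [|i s IH]; first by rewrite !big_nil.
by rewrite big_cons IH /=; case: (g i) => [j|] /=; rewrite ?big_cons ?add0r.
Qed.

End UniqSums.

Lemma pmap_uniq_inj (S T : eqType) (g : T -> option S) (s : seq T) :
  (forall i j k, g i = Some k -> g j = Some k -> i = j) -> uniq s -> uniq (pmap g s).
Proof.
move=> ginj; elim: s => //= i s IH /andP[is_ us]; case gi: (g i) => [k|] /=; last exact: IH.
rewrite IH// andbT mem_pmap; apply: contraNN is_ => /mapP[j js gj].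
by rewrite (ginj i j k).
Qed.

Section L2.
Variables (R : realType) (S : choiceType).
Local Notation C := R[i].
Implicit Types (f g h : S -> C) (s t : seq S).

Definition sqsum (f : S -> C) (s : seq S) : R := \sum_(i <- s) nrm (f i) ^+ 2.

Lemma sqsum_ge0 f s : 0 <= sqsum f s.
Proof. by apply: sumr_ge0 => i _; rewrite exprn_ge0 ?nrm_ge0. Qed.

Definition l2_bound (f : S -> C) (K : R) :=
  0 <= K /\ forall s, uniq s -> sqsum f s <= K ^+ 2.

(** Minkowski's inequality for every finite subfamily at once. *)
Lemma l2_boundD f g K L : l2_bound f K -> l2_bound g L -> l2_bound (f + g) (K + L).
Proof.
move=> [K0 hf] [L0 hg]; split=> [|s us]; first exact: addr_ge0.
have pos A B : K < A -> L < B -> sqsum (f + g) s <= (A + B) ^+ 2.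
  move=> KA LB; have A0 := le_lt_trans K0 KA; have B0 := le_lt_trans L0 LB.
  have fA : sqsum f s <= A ^+ 2.
    by rewrite (le_trans (hf s us))// ler_pXn2r// ?nnegrE// ltW.
  have gB : sqsum g s <= B ^+ 2.
    by rewrite (le_trans (hg s us))// ler_pXn2r// ?nnegrE// ltW.
  have : sqsum (f + g) s <= (1 + B / A) * sqsum f s + (1 + A / B) * sqsum g s.
    rewrite /sqsum !mulr_sumr -big_split /=; apply: ler_sum => i _.
    set a := nrm (f i); set b := nrm (g i).
    apply: (@le_trans _ _ ((a + b) ^+ 2)).
      by rewrite ler_pXn2r ?nnegrE ?addr_ge0 ?nrm_ge0// nrmD.
    (* Weighted form of [2 a b <= a^2 + b^2], an equality when [B a = A b]. *)
    rewrite -subr_ge0; have -> : (1 + B / A) * a ^+ 2 + (1 + A / B) * b ^+ 2 - (a + b) ^+ 2 =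
      (B * a - A * b) ^+ 2 / (A * B) by field; rewrite !gt_eqF.
    by apply: divr_ge0; [exact: sqr_ge0|apply: mulr_ge0; exact: ltW].
  move=> /le_trans; apply.
  apply: (@le_trans _ _ ((1 + B / A) * A ^+ 2 + (1 + A / B) * B ^+ 2)).
    by apply: lerD; apply: ler_wpM2l => //; apply: addr_ge0 => //; apply: divr_ge0; exact: ltW.
  by rewrite le_eqVlt; apply/orP; left; apply/eqP; field; rewrite !gt_eqF.
rewrite -(sqr_sqrtr (sqsum_ge0 _ _)) ler_pXn2r ?nnegrE ?sqrtr_ge0 ?addr_ge0//.
apply: le_epsP => e e0; have e20 : 0 < e / 2 by rewrite divr_gt0.
rewrite (splitr e) addrACA -(@ler_pXn2r _ 2)// ?nnegrE ?sqrtr_ge0//.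
  by rewrite sqr_sqrtr ?sqsum_ge0// pos// ltrDl.
by rewrite !addr_ge0// ltW.
Qed.

Lemma l2_boundZ (a : C) f K : l2_bound f K -> l2_bound (a *: f) (nrm a * K).
Proof.
move=> [K0 hf]; split=> [|s us]; first by rewrite mulr_ge0 ?nrm_ge0.
rewrite /sqsum exprMn; under eq_bigr => i _ do rewrite nrmcM exprMn.
by rewrite -mulr_sumr ler_wpM2l ?exprn_ge0 ?nrm_ge0// hf.
Qed.

Definition square_summable (f : S -> C) : Prop := exists K, l2_bound f K.

Definition square_summable_pred : {pred S -> C} := fun f => `[< square_summable f >].

Lemma square_summableP f : reflect (square_summable f) (f \in square_summable_pred).
Proof. exact: asboolP. Qed.

Lemma square_summable_submod : submod_closed square_summable_pred.
Proof.
split=> [|a f g /square_summableP[K fK] /square_summableP[L gL]]; apply/square_summableP.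
  exists 0; split=> // s us; rewrite /sqsum big1 ?expr0n// => i _.
  by rewrite nrm0 expr0n.
by exists (nrm a * K + L); apply: l2_boundD => //; exact: l2_boundZ.
Qed.

HB.instance Definition _ := GRing.isSubmodClosed.Build C (S -> C) square_summable_pred
  square_summable_submod.

Record l2 := L2 { l2_fun :> S -> C ; l2_subproof : l2_fun \in square_summable_pred }.

HB.instance Definition _ := [isSub for l2_fun].
HB.instance Definition _ := [Choice of l2 by <:].
HB.instance Definition _ := [SubChoice_isSubLmodule of l2 by <:].

Lemma l2P (x y : l2) : x =1 y -> x = y.
Proof. by move=> xy; apply/val_inj/funext. Qed.

Lemma l20E i : (0 : l2) i = 0. Proof. by []. Qed.
Lemma l2DE (x y : l2) i : (x + y) i = x i + y i. Proof. by []. Qed.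
Lemma l2BE (x y : l2) i : (x - y) i = x i - y i. Proof. by []. Qed.
Lemma l2ZE (a : C) (x : l2) i : (a *: x) i = a * x i. Proof. by []. Qed.

Definition l2norm (x : l2) : R := Num.sqrt (sup [set sqsum x s | s in [set s | uniq s]]).

Lemma l2_has_sup (x : l2) : has_sup [set sqsum x s | s in [set s | uniq s]].
Proof.
have [K [K0 xK]] : square_summable x by apply/square_summableP/l2_subproof.
split; first by exists (sqsum x [::]), [::].
by exists (K ^+ 2) => _ [s /= us <-]; exact: xK.
Qed.

Lemma l2normP (x : l2) : l2_bound x (l2norm x).
Proof.
split=> [|s us]; first exact: sqrtr_ge0.
have h t : uniq t -> sqsum x t <= sup [set sqsum x s | s in [set s | uniq s]].
  by move=> ut; apply: (sup_upper_bound (l2_has_sup x)); exists t.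
by rewrite sqr_sqrtr ?h// (le_trans _ (h [::] isT))// sqsum_ge0.
Qed.

Lemma l2norm_le (x : l2) K : l2_bound x K -> l2norm x <= K.
Proof.
move=> [K0 xK]; rewrite -(ger0_norm K0) -sqrtr_sqr ler_wsqrtr//.
by apply: ge_sup; [exact: (l2_has_sup x).1|move=> _ [s /= us <-]; exact: xK].
Qed.

Lemma l2norm_ge0 x : 0 <= l2norm x. Proof. exact: sqrtr_ge0. Qed.

Lemma l2_coord (x : l2) i : nrm (x i) <= l2norm x.
Proof.
rewrite -(@ler_pXn2r _ 2)// ?nnegrE ?nrm_ge0 ?l2norm_ge0//.
by have := (l2normP x).2 [:: i] isT; rewrite /sqsum big_seq1.
Qed.

Definition l2normC (x : l2) : C := (l2norm x)%:C%C.

Lemma l2normC_triangle x y : l2normC (x + y) <= l2normC x + l2normC y.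
Proof. by rewrite /l2normC -rmorphD lecR l2norm_le//; apply: l2_boundD; exact: l2normP. Qed.

Lemma l2normCZ (a : C) x : l2normC (a *: x) = `|a| * l2normC x.
Proof.
rewrite /l2normC nrmE -rmorphM/=; congr (_%:C)%C; apply/le_anti/andP; split.
  by apply: l2norm_le; apply: l2_boundZ; exact: l2normP.
have [->|a0] := eqVneq a 0; first by rewrite nrm0 mul0r l2norm_ge0.
have an0 : nrm a != 0 by apply: contraNneq a0 => /nrm0_eq0 ->.
have ap : 0 < nrm a by rewrite lt_neqAle nrm_ge0 eq_sym an0.
rewrite mulrC -ler_pdivlMr// l2norm_le//; split; first by rewrite divr_ge0 ?l2norm_ge0// ltW.
move=> s us; have := (l2normP (a *: x)).2 s us.
rewrite expr_div_n ler_pdivlMr ?exprn_gt0// mulrC /sqsum mulr_sumr.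
by under eq_bigr => i _ do rewrite nrmcM exprMn.
Qed.

Lemma l2normC_eq0 x : l2normC x = 0 -> x = 0.
Proof.
move=> /(@complexI _ _ 0) x0; apply: l2P => i; apply: nrm0_eq0; apply/le_anti.
by rewrite nrm_ge0 andbT -x0 l2_coord.
Qed.

HB.instance Definition _ := Lmodule_isNormed.Build C l2
  l2normC_triangle l2normCZ l2normC_eq0.

Lemma nrm_l2E (x : l2) : nrm x = l2norm x. Proof. by []. Qed.

(** The limit is taken coordinatewise; bounds on finite subfamilies survive it. *)
Lemma l2_complete (u : nat -> l2) : cauchy_nrm u -> exists l, cvg_nrm u l.
Proof.
move=> cu.
have pw i : exists l, cvg_nrm (fun n => u n i) l.
  apply: complex_cauchy_cvg => e /cu[N hN]; exists N => m n Nm Nn.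
  by rewrite -l2BE (le_lt_trans (l2_coord _ _))// hN.
have [g gP] := choice pw.
have sumlim (v : nat -> S -> C) (w : S -> C) M :
    (forall i, cvg_nrm (fun n => v n i) (w i)) -> 0 <= M ->
    (exists N, forall n, (N <= n)%N -> forall s, uniq s -> sqsum (v n) s <= M ^+ 2) ->
    l2_bound w M.
  move=> vw M0 [N hN]; split=> // s us.
  apply: (@cvgr_to_le _ \oo _ _ (fun n => sqsum (v n) s)).
    apply: cvg_big => [|i _]; first exact: add_continuous.
    by apply: cvgM; exact: cvg_nrm_norm.
  by exists N => // n /= Nn; exact: hN.
have [N0 [M hM]] := cauchy_bounded cu.
have gM : l2_bound g `|M|.
  apply: sumlim gP (normr_ge0 M) _; exists N0 => n /hM un s us.
  rewrite (le_trans ((l2normP (u n)).2 s us))// ler_pXn2r ?nnegrE ?l2norm_ge0//.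
  by rewrite (le_trans un)// ler_norm.
have hg : g \in square_summable_pred by apply/square_summableP; exists `|M|.
exists (L2 hg) => e e0; have e20 : 0 < e / 2 by rewrite divr_gt0.
have [N hN] := cu _ e20; exists N => n Nn.
apply: (@le_lt_trans _ _ (e / 2)); last by rewrite ltr_pdivrMr// ltr_pMr// ltr1n.
apply: l2norm_le; apply: (sumlim (fun m => u n - u m : S -> C)); last 2 first.
- exact: ltW.
- exists N => m Nm s us; rewrite (le_trans ((l2normP (u n - u m)).2 s us))//.
  by rewrite ler_pXn2r ?nnegrE ?l2norm_ge0 ?(ltW e20)// ltW// hN.
move=> i d d0; have [N' hN'] := gP i d d0; exists N' => m /hN' h'.
by rewrite !l2BE /= opprB addrC addrA subrK nrmBC.
Qed.

HB.instance Definition _ := Uniform_isComplete.Build l2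
  (seq_complete_filter l2_complete).

(** ** The inner product *)

(** Unordered summation over the finite subsets of [S], which are represented
    by duplicate-free sequences. *)
Definition sum_to (h : S -> C) (z : C) := forall e : R, 0 < e ->
  exists s, forall t, uniq t -> {subset s <= t} -> nrm (\sum_(i <- t) h i - z) < e.

Lemma sum_to_unique h z w : sum_to h z -> sum_to h w -> z = w.
Proof.
move=> hz hw; apply/subr0_eq/nrm0_eq0/le_anti; rewrite nrm_ge0 andbT.
apply: le_epsP => e e0; have e20 : 0 < e / 2 by rewrite divr_gt0.
have [s hs] := hz _ e20; have [t ht] := hw _ e20.
have u := undup_uniq (s ++ t).
rewrite add0r (le_trans (nrm_triang (\sum_(i <- undup (s ++ t)) h i) _ _))//.
rewrite (splitr e) lerD// ltW//.
  by rewrite nrmBC hs// => i si; rewrite mem_undup mem_cat si.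
by rewrite ht// => i ti; rewrite mem_undup mem_cat ti orbT.
Qed.

Lemma sum_toD h k z w : sum_to h z -> sum_to k w -> sum_to (fun i => h i + k i) (z + w).
Proof.
move=> hz hw e e0; have e20 : 0 < e / 2 by rewrite divr_gt0.
have [s hs] := hz _ e20; have [t ht] := hw _ e20; exists (s ++ t) => r ur str.
rewrite big_split /= opprD addrACA (le_lt_trans (nrmD _ _))// (splitr e).
by rewrite ltrD ?hs ?ht// => i ii; rewrite str// mem_cat ii ?orbT.
Qed.

Lemma sum_toZ (a : C) h z : sum_to h z -> sum_to (fun i => a * h i) (a * z).
Proof.
move=> hz e e0; have a1 : 0 < nrm a + 1 by rewrite ltr_wpDl ?nrm_ge0.
have [s hs] := hz _ (divr_gt0 e0 a1); exists s => t ut st.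
have := hs t ut st; rewrite ltr_pdivlMr// => h1; apply: le_lt_trans h1.
by rewrite -mulr_sumr -mulrBr nrmcM mulrC ler_wpM2l ?nrm_ge0// lerDl.
Qed.

Lemma sum_to_conj h z : sum_to h z -> sum_to (fun i => (h i)^*%C) (z^*)%C.
Proof.
move=> hz e /hz[s hs]; exists s => t ut st.
by rewrite -rmorph_sum -rmorphB nrm_conj hs.
Qed.

Lemma sum_to_nonneg (h : S -> R) (z : R) : (forall i, 0 <= h i) ->
  (forall s, uniq s -> \sum_(i <- s) h i <= z) ->
  (forall e, 0 < e -> exists2 s, uniq s & z - e < \sum_(i <- s) h i) ->
  sum_to (fun i => (h i)%:C%C) (z%:C%C).
Proof.
move=> h0 hz zh e /zh[s us hs]; exists s => t ut st.
rewrite -rmorph_sum -rmorphB nrm_real distrC ger0_norm ?subr_ge0 ?hz//.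
by rewrite ltrBlDr -ltrBlDl (lt_le_trans hs)// sum_uniq_le.
Qed.

Lemma sum_to_sqr (x : l2) : sum_to (fun i => x i * (x i)^*%C) ((nrm x ^+ 2)%:C%C).
Proof.
have -> : (fun i => x i * (x i)^*%C) = (fun i => (nrm (x i) ^+ 2)%:C%C).
  by apply/funext => i; rewrite nrmcE.
apply: sum_to_nonneg => [i|s us|e e0]; first by rewrite exprn_ge0 ?nrm_ge0.
  exact: (l2normP x).2.
have [y [s /= us <-]] := sup_adherent e0 (l2_has_sup x).
move=> h; exists s => //; rewrite nrm_l2E sqr_sqrtr//.
by apply: (le_trans (sqsum_ge0 x [::])); apply: (sup_upper_bound (l2_has_sup x)); exists [::].
Qed.

(** The polarization identity reduces convergence of the inner product to that
    of monotone sums. *)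
Lemma l2_ip_subproof (x y : l2) : exists z, sum_to (fun i => x i * (y i)^*%C) z.
Proof.
pose j : C := 'i%C.
have jj : j * j = -1 by rewrite -expr2 sqr_i.
have jc : j^*%C = - j by apply/eqP; rewrite eq_complex /= oppr0 !eqxx.
clearbody j; pose sq (k : C) := x + k *: y.
pose z := 4^-1 * ((nrm (sq 1) ^+ 2)%:C%C + (- 1) * (nrm (sq (-1)) ^+ 2)%:C%C
  + j * (nrm (sq j) ^+ 2)%:C%C + (- j) * (nrm (sq (- j)) ^+ 2)%:C%C).
exists z.
have -> : (fun i => x i * (y i)^*%C) = (fun i => 4^-1 *
   (sq 1 i * (sq 1 i)^*%C + (-1) * (sq (-1) i * (sq (-1) i)^*%C)
    + j * (sq j i * (sq j i)^*%C)
    + (- j) * (sq (- j) i * (sq (- j) i)^*%C))).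
  apply/funext => i; rewrite /sq !l2DE !l2ZE; move: (x i) (y i) => a b.
  have n4 : (4 : C) != 0 by rewrite pnatr_eq0.
  apply: (mulfI n4); rewrite [RHS]mulrA mulfV// mul1r !(rmorphD, rmorphM, rmorphN) rmorph1 /= jc.
  move: (a^*%C) (b^*%C) => a' b'.
  ring: jj.
exact (sum_toZ _ (sum_toD (sum_toD (sum_toD (sum_to_sqr (sq 1)) (sum_toZ _ (sum_to_sqr (sq (-1)))))
  (sum_toZ _ (sum_to_sqr (sq j)))) (sum_toZ _ (sum_to_sqr (sq (- j)))))).
Qed.

Definition l2_ip (x y : l2) : C := sval (cid (l2_ip_subproof x y)).

Lemma l2_ipP (x y : l2) : sum_to (fun i => x i * (y i)^*%C) (l2_ip x y).
Proof. by rewrite /l2_ip; case: cid. Qed.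

Fact l2_ipDl x y z : l2_ip (x + y) z = l2_ip x z + l2_ip y z.
Proof.
apply: sum_to_unique (l2_ipP _ _) _; rewrite [X in sum_to X](_ : _ =
  fun i => x i * (z i)^*%C + y i * (z i)^*%C); first exact: sum_toD (l2_ipP _ _) (l2_ipP _ _).
by apply/funext => i; rewrite l2DE mulrDl.
Qed.

Fact l2_ipZl (a : C) x y : l2_ip (a *: x) y = a * l2_ip x y.
Proof.
apply: sum_to_unique (l2_ipP _ _) _; rewrite [X in sum_to X](_ : _ =
  fun i => a * (x i * (y i)^*%C)); first exact: sum_toZ (l2_ipP _ _).
by apply/funext => i; rewrite l2ZE mulrA.
Qed.

Fact l2_ipC x y : l2_ip x y = ((l2_ip y x)^*)%C.
Proof.
apply: sum_to_unique (l2_ipP _ _) _; rewrite [X in sum_to X](_ : _ =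
  fun i => ((y i * (x i)^*%C)^*)%C); first exact: sum_to_conj (l2_ipP _ _).
by apply/funext => i; rewrite rmorphM /= conjcK mulrC.
Qed.

Fact l2_ip_norm x : l2_ip x x = ((nrm x ^+ 2)%:C)%C.
Proof. exact: sum_to_unique (l2_ipP _ _) (sum_to_sqr x). Qed.

HB.instance Definition _ := isHilbert.Build R l2 l2_ipDl l2_ipZl l2_ipC l2_ip_norm.

Lemma ip_sum_to (x y : l2) (z : C) : sum_to (fun i => x i * (y i)^*%C) z -> ip x y = z.
Proof. exact: sum_to_unique (l2_ipP x y). Qed.

End L2.

(** * Operators on square-summable families *)

Section L2Operators.
Variables (R : realType) (S : choiceType).
Local Notation C := R[i].
Local Notation H := (l2 R S).
Implicit Types (x y : H) (i j z : S).

Fact delta_subproof z : (fun i => (i == z)%:R : C) \in @square_summable_pred R S.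
Proof.
apply/square_summableP; exists 1; split=> // s us; rewrite expr1n /sqsum.
case: (boolP (z \in s)) => zs.
  rewrite (sum_uniq_sub0 (s := [:: z])) => // [|i|i _].
  - by rewrite big_seq1 eqxx /nrm normr1 expr1n.
  - by rewrite inE => /eqP->.
  - by rewrite inE => /negbTE->; rewrite nrm0 expr0n.
rewrite big1_seq// => i /= is_.
by case: eqVneq is_ => [->|_ _]; rewrite ?(negbTE zs)// nrm0 expr0n.
Qed.

Definition delta z : H := L2 (delta_subproof z).

Lemma deltaE z i : delta z i = (i == z)%:R. Proof. by []. Qed.

Lemma ip_delta x z : ip x (delta z) = x z.
Proof.
apply: ip_sum_to => e e0; exists [:: z] => t ut st.
rewrite (sum_uniq_sub0 (s := [:: z])) => // [|i _]; last first.
  by rewrite inE deltaE => /negbTE->; rewrite conjc0 mulr0.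
by rewrite big_seq1 deltaE eqxx conjc1 mulr1 subrr nrm0.
Qed.

Lemma nrm_delta z : nrm (delta z) = 1.
Proof.
have : ((nrm (delta z) ^+ 2)%:C)%C = (1%:C)%C :> C by rewrite -ip_norm ip_delta deltaE eqxx.
by move=> /complexI /eqP; rewrite sqrp_eq1 ?nrm_ge0// => /eqP.
Qed.

Lemma badj_delta (T : bop H) i z : badj T (delta i) z = ((T (delta z) i)^*)%C.
Proof. by rewrite -ip_delta badjP' ipC ip_delta. Qed.

(** Passing to adjoints turns columns into rows, so no density argument is needed. *)
Lemma bop_deltaP (T U : bop H) : (forall z, T (delta z) = U (delta z)) -> T = U.
Proof.
move=> TU; rewrite -(badjK T) -(badjK U); congr badj; apply: bopP => x; apply: l2P => z.
by rewrite -!ip_delta !badjP' TU.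
Qed.

Definition odelta (o : option S) : H := oapp delta 0 o.

(** ** Partial permutation operators *)

Definition partial_inverse (f g : S -> option S) :=
  forall i j, f j = Some i <-> g i = Some j.

Lemma partial_inverse_sym f g : partial_inverse f g -> partial_inverse g f.
Proof. by move=> fg i j; split=> /fg. Qed.

Lemma partial_inverse_inj f g : partial_inverse f g ->
  forall i j k, g i = Some k -> g j = Some k -> i = j.
Proof. by move=> fg i j k /fg fk /fg; rewrite fk => -[]. Qed.

Definition pull (g : S -> option S) (x : H) : S -> C := fun i => oapp x 0 (g i).

Section Shift.
Variables (f g : S -> option S).
Hypothesis fg : partial_inverse f g.

Lemma pull_bound x : l2_bound (pull g x) (nrm x).
Proof.
split=> [|s us]; first exact: nrm_ge0.
rewrite /sqsum (eq_bigr (fun i => oapp (fun j => nrm (x j) ^+ 2) 0 (g i))); last first.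
  by move=> i _; rewrite /pull; case: (g i) => //=; rewrite nrm0 expr0n.
rewrite sum_pmap; apply: (l2normP x).2.
by apply: pmap_uniq_inj us; exact: partial_inverse_inj fg.
Qed.

Definition push x : H := L2 (introT (square_summableP _) (ex_intro _ _ (pull_bound x))).

Lemma pushE x i : push x i = oapp x 0 (g i). Proof. by []. Qed.

Lemma nrm_push x : nrm (push x) <= nrm x.
Proof. exact: (@l2norm_le _ _ (push x) _ (pull_bound x)). Qed.

(** Reindexing an unordered sum along a partial bijection; indices outside its
    domain must not contribute. *)
Lemma sum_to_pull (k : S -> C) (z : C) : (forall j, f j = None -> k j = 0) ->
  sum_to k z -> sum_to (fun i => oapp k 0 (g i)) z.
Proof.
move=> k0 kz e /kz[s hs]; exists (pmap f s) => t ut st.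
rewrite sum_pmap; pose u := undup (s ++ pmap g t).
have up : uniq (pmap g t) by apply: pmap_uniq_inj ut; exact: partial_inverse_inj fg.
rewrite -(@sum_uniq_sub0 _ _ _ u) => //.
- by apply: hs => [|i si]; rewrite ?undup_uniq// mem_undup mem_cat si.
- exact: undup_uniq.
- by move=> i it; rewrite mem_undup mem_cat it orbT.
- move=> j; rewrite mem_undup mem_cat => /orP[js|-> //].
  case fj: (f j) => [i|]; last by move=> _; exact: k0.
  rewrite mem_pmap => /negP[]; apply/mapP; exists i; last by apply/esym/fg.
  by apply: st; rewrite mem_pmap; apply/mapP; exists j.
Qed.

End Shift.

Lemma ip_push f g (fg : partial_inverse f g) x y :
  ip (push fg x) y = ip x (push (partial_inverse_sym fg) y).
Proof.
apply: ip_sum_to; rewrite [X in sum_to X](_ : _ =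
  fun i => oapp (fun j => x j * (push (partial_inverse_sym fg) y j)^*%C) 0 (g i)).
  apply: (sum_to_pull fg) => [j fj|]; last exact: l2_ipP.
  by rewrite /= /pull fj conjc0 mulr0.
apply/funext => i; rewrite pushE; case gi: (g i) => [j|] /=; last by rewrite mul0r.
by have /fg fj := gi; rewrite /pull fj.
Qed.

Fact shift_subproof f g (fg : partial_inverse f g) : push fg \in @adjointable_pred R H.
Proof.
apply/adjointableP; exists (push (partial_inverse_sym fg)), 1; split=> [x y|x].
  exact: ip_push.
by rewrite mul1r nrm_push.
Qed.

Definition shift f g (fg : partial_inverse f g) : bop H := Bop (shift_subproof fg).

Lemma shift_delta f g (fg : partial_inverse f g) z : shift fg (delta z) = odelta (f z).
Proof.
apply: l2P => i; rewrite pushE.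
case fz: (f z) => [j|]; case gi: (g i) => [k|] //=; rewrite ?deltaE.
- have /fg gj := fz; case: (eqVneq i j) => [ij|ij].
    by move: gi; rewrite ij gj => -[->]; rewrite eqxx.
  case: eqVneq => // kz; case/negP: ij; apply/eqP.
  by move: gi; rewrite kz => /(partial_inverse_inj fg); apply.
- by have /fg gj := fz; case: eqVneq => // ij; move: gi; rewrite ij gj.
- by case: eqVneq => // kz; have /fg := gi; rewrite kz fz.
Qed.

Lemma badj_shift f g (fg : partial_inverse f g) :
  badj (shift fg) = shift (partial_inverse_sym fg).
Proof. by apply: badj_unique => x y; exact: ip_push. Qed.

(** ** Multiplication operators and the diagonal of an operator *)

Section Diagonal.
Variables (d : S -> C) (K : R).
Hypothesis K0 : 0 <= K.
Hypothesis dK : forall i, nrm (d i) <= K.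

Lemma dmul_bound x : l2_bound (fun i => d i * x i) (K * nrm x).
Proof.
split=> [|s us]; first by rewrite mulr_ge0 ?nrm_ge0.
apply: (@le_trans _ _ (K ^+ 2 * sqsum x s)).
  rewrite /sqsum mulr_sumr ler_sum// => i _.
  by rewrite nrmcM exprMn ler_wpM2r ?exprn_ge0 ?nrm_ge0// ler_pXn2r ?nnegrE ?nrm_ge0.
by rewrite exprMn ler_wpM2l ?exprn_ge0// (l2normP x).2.
Qed.

Definition dmul x : H := L2 (introT (square_summableP _) (ex_intro _ _ (dmul_bound x))).

End Diagonal.

Fact dmul_subproof d K (K0 : 0 <= K) (dK : forall i, nrm (d i) <= K) :
  dmul K0 dK \in @adjointable_pred R H.
Proof.
have dK' i : nrm ((d i)^*)%C <= K by rewrite nrm_conj.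
apply/adjointableP; exists (dmul K0 dK'), K; split=> [x y|x].
  apply: ip_sum_to; rewrite [X in sum_to X](_ : _ =
    fun i => x i * (dmul K0 dK' y i)^*%C); first exact: l2_ipP.
  by apply/funext => i /=; rewrite rmorphM /= conjcK mulrCA mulrA.
exact: (@l2norm_le _ _ (dmul K0 dK x) _ (dmul_bound K0 dK x)).
Qed.

Definition diagop d K (K0 : 0 <= K) (dK : forall i, nrm (d i) <= K) : bop H :=
  Bop (dmul_subproof K0 dK).

Lemma diagopE d K (K0 : 0 <= K) (dK : forall i, nrm (d i) <= K) x i :
  diagop K0 dK x i = d i * x i.
Proof. by []. Qed.

Lemma nrm_diagop d K (K0 : 0 <= K) (dK : forall i, nrm (d i) <= K) :
  nrm (diagop K0 dK) <= K.
Proof. by apply: nrm_bop_le => // x; exact: (@l2norm_le _ _ (dmul K0 dK x) _ (dmul_bound K0 dK x)). Qed.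

Lemma diagop_delta d K (K0 : 0 <= K) (dK : forall i, nrm (d i) <= K) z :
  diagop K0 dK (delta z) = d z *: delta z.
Proof.
apply: l2P => i; rewrite diagopE l2ZE deltaE.
by case: eqVneq => [->//|_]; rewrite !mulr0.
Qed.

Definition entry (T : bop H) z : C := T (delta z) z.

Lemma entry_bound T z : nrm (entry T z) <= nrm T.
Proof.
rewrite (le_trans (l2_coord _ _))// -nrm_l2E.
by rewrite (le_trans (nrm_bopP T _))// nrm_delta mulr1.
Qed.

Definition diag_part (T : bop H) : bop H := diagop (nrm_ge0 T) (entry_bound T).

Lemma diag_partE T x i : diag_part T x i = entry T i * x i.
Proof. by []. Qed.

Lemma diag_part_delta (T : bop H) z : diag_part T (delta z) = entry T z *: delta z.
Proof. exact: diagop_delta. Qed.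

Lemma entry_diag_part T z : entry (diag_part T) z = entry T z.
Proof. by rewrite /entry diag_part_delta l2ZE deltaE eqxx mulr1. Qed.

Lemma entryD T U z : entry (T + U) z = entry T z + entry U z.
Proof. by rewrite /entry bopDE l2DE. Qed.

Lemma entryZ (a : C) T z : entry (a *: T) z = a * entry T z.
Proof. by rewrite /entry bopZE l2ZE. Qed.

Lemma diag_partD T U : diag_part (T + U) = diag_part T + diag_part U.
Proof. by apply: bop_deltaP => z; rewrite bopDE !diag_part_delta entryD scalerDl. Qed.

Lemma diag_partZ (a : C) T : diag_part (a *: T) = a *: diag_part T.
Proof. by apply: bop_deltaP => z; rewrite bopZE !diag_part_delta entryZ scalerA. Qed.

Lemma diag_part0 : diag_part 0 = 0.
Proof. by rewrite -(scale0r 0) diag_partZ !scale0r. Qed.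

Lemma diag_partB T U : diag_part (T - U) = diag_part T - diag_part U.
Proof. by rewrite -!(scaleN1r U) diag_partD diag_partZ scaleN1r. Qed.

Lemma nrm_diag_part T : nrm (diag_part T) <= nrm T.
Proof. exact: nrm_diagop. Qed.

Lemma nrm_diag_part_le T K : 0 <= K -> (forall z, nrm (entry T z) <= K) ->
  nrm (diag_part T) <= K.
Proof.
move=> K0 TK; rewrite (_ : diag_part T = diagop K0 TK); first exact: nrm_diagop.
by apply: bop_deltaP => z; rewrite diag_part_delta diagop_delta.
Qed.

Definition diagonal (T : bop H) := diag_part T = T.

Lemma diagonalP (T : bop H) : (forall z, T (delta z) = entry T z *: delta z) -> diagonal T.
Proof. by move=> h; apply: bop_deltaP => z; rewrite diag_part_delta h. Qed.

Lemma diagonal_delta (T : bop H) z : diagonal T -> T (delta z) = entry T z *: delta z.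
Proof. by move=> <-; rewrite diag_part_delta entry_diag_part. Qed.

Lemma entry_adj (T : bop H) z : entry (cadj T) z = ((entry T z)^*)%C.
Proof. exact: badj_delta. Qed.

Lemma bop_mulE (T U : bop H) x : (T ** U) x = T (U x). Proof. by []. Qed.

Lemma diagonal_mull (D T : bop H) : diagonal D -> diag_part (D ** T) = D ** diag_part T.
Proof.
move=> dD; apply: bop_deltaP => z.
rewrite diag_part_delta bop_mulE diag_part_delta bopZ diagonal_delta// scalerA.
by congr (_ *: _); rewrite /entry bop_mulE -[in LHS]dD diag_partE mulrC.
Qed.

Lemma diagonal_mulr (D T : bop H) : diagonal D -> diag_part (T ** D) = diag_part T ** D.
Proof.
move=> dD; apply: bop_deltaP => z.
rewrite diag_part_delta bop_mulE diagonal_delta// bopZ diag_part_delta scalerA.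
by congr (_ *: _); rewrite {1}/entry bop_mulE diagonal_delta// bopZ l2ZE.
Qed.

(** This identity is what makes the compression to the diagonal faithful, and
    what makes the diagonal of a positive operator nonnegative. *)
Lemma entry_sqr (T : bop H) z : entry (cadj T ** T) z = ((nrm (T (delta z)) ^+ 2)%:C)%C.
Proof. by rewrite /entry bop_mulE -ip_delta badjP' ip_norm. Qed.

Lemma diag_part_faithful (T : bop H) : diag_part (cadj T ** T) = 0 -> T = 0.
Proof.
move=> h; apply: bop_deltaP => z; apply: nrm0_eq0; apply/eqP; rewrite -sqrf_eq0.
apply/eqP/(@complexI _ _ 0); rewrite -entry_sqr -entry_diag_part h.
by [].
Qed.

End L2Operators.

(** * Entry-free cycles *)

Section Graph.
Variable E : digraph.
Implicit Types (u v w : vertex E) (e f : edge E) (l m : seq (edge E)).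

Definition psrc v l : vertex E := last v (map (@esource E) l).

Lemma psrc_cons v e l : psrc v (e :: l) = psrc (esource e) l. Proof. by []. Qed.

Lemma psrc_cat v l m : psrc v (l ++ m) = psrc (psrc v l) m.
Proof. by rewrite /psrc map_cat last_cat. Qed.

Lemma is_path_cat v l m : is_path v (l ++ m) = is_path v l && is_path (psrc v l) m.
Proof. by elim: l v => //= e l IH v; rewrite IH andbA. Qed.

Lemma psourceE (a : gpath E) : psource a = psrc (prange a) (pedges a). Proof. by []. Qed.

Definition edge_entry_free e : Prop :=
  exists2 m : gpath E, entry_free_cycle m & e \in pedges m.

Lemma class_edges_cyclic (m : gpath E) :
  class_edges (cyclic_class m) = [set e | e \in pedges m].
Proof.
apply/seteqP; split=> e /=.
  by move=> [n [k nk]]; rewrite nk mem_rot.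
by move=> em; exists m => //; exists 0%N; rewrite rot0.
Qed.

Lemma entry_free_edgesE e : entry_free_edges e <-> edge_entry_free e.
Proof.
split.
  by move=> [C [m cm ->]]; rewrite class_edges_cyclic /= => em; exists m.
move=> [m cm em]; exists (cyclic_class m); first by exists m.
by rewrite class_edges_cyclic.
Qed.

Lemma is_path_range v l e : is_path v l -> e \in l ->
  exists l1 l2, [/\ l = l1 ++ e :: l2, erange e = psrc v l1 & is_path (esource e) l2].
Proof.
move=> lp /splitPr el; case: el lp => l1 l2; rewrite is_path_cat /= => /and3P[_ /eqP re p2].
by exists l1, l2.
Qed.

Lemma cycle_next (m : gpath E) e : is_cycle m -> e \in pedges m ->
  exists2 f, f \in pedges m & erange f = esource e.
Proof.
move=> [m1 mc _] em; have := path_valP m; rewrite -/(pedges m) -/(prange m) => mp.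
have [l1 [l2 [ml _ p2]]] := is_path_range mp em.
case: l2 => [|f l2] in ml p2 *.
  case ml1 : (pedges m) => [|f l]; first by rewrite ml1 in em.
  exists f; first by rewrite mem_head.
  move: mp mc; rewrite /psource -/(psrc _ _) ml psrc_cat -ml ml1 /= => /andP[/eqP -> _] ->.
  by [].
exists f; first by rewrite ml mem_cat !inE eqxx !orbT.
by move: p2 => /= /andP[/eqP].
Qed.

(** Paths are read against the direction of their edges, so without entrance each
    step is forced: a path starting on the cycle never leaves it. *)
Lemma entry_free_path (m : gpath E) e l : entry_free_cycle m -> e \in pedges m ->
  is_path (erange e) l -> {subset l <= pedges m}.
Proof.
move=> [mc mn]; elim: l e => [|f l IH] e em //= /andP[/eqP fe pl].
have fm : f \in pedges m by rewrite (mn f e).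
have [g gm gf] := cycle_next mc fm.
by move=> h; rewrite inE => /predU1P[->//|]; apply: (IH g) => //; rewrite gf.
Qed.

Lemma ef_path e l : edge_entry_free e -> is_path (erange e) l ->
  forall f, f \in l -> edge_entry_free f.
Proof. by move=> [m cm em] pl f fl; exists m => //; exact: entry_free_path pl f fl. Qed.

Lemma ef_unique e f : edge_entry_free e -> erange f = erange e -> f = e.
Proof. by move=> [m [_ mn] em]; exact: mn. Qed.

Definition unique_entry l := forall e f, f \in l -> erange e = erange f -> e = f.

Lemma unique_entry_take v l m : unique_entry l -> is_path v l -> is_path v m ->
  (size m <= size l)%N -> m = take (size m) l.
Proof.
elim: l v m => [|e l IH] v [|f m]//= ul /andP[/eqP ev pl] /andP[/eqP fv pm] sz.
have ef : f = e by apply: ul; rewrite ?mem_head// fv.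
rewrite ef in pm *; congr (_ :: _); apply: IH pl pm sz => a b bl; apply: ul.
by rewrite inE bl orbT.
Qed.

(** Where incoming edges are unique, the continuations from two visits of the same
    vertex agree as long as both last. The one from the later visit ends with the
    path, so the final vertex is also met earlier. *)
Lemma unique_entry_repeat v l : unique_entry l -> is_path v l ->
  ~~ uniq (map (@esource E) l) ->
  exists l1 l2, [/\ l = l1 ++ l2, l1 != [::], l2 != [::] & psrc v l1 = psrc v l].
Proof.
elim: l v => //= e l IH v ul /andP[_ pl]; rewrite negb_and negbK.
have ul' : unique_entry l by move=> a b bl; apply: ul; rewrite inE bl orbT.
move=> /orP[/mapP[f fl ef]|nu].
  have [la [lb [ll _ pb]]] := is_path_range pl fl; rewrite -ef in pb.
  have sz : (size lb < size l)%N by rewrite ll size_cat /= addnS ltnS leq_addl.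
  have lbE := unique_entry_take ul' pl pb (ltnW sz).
  exists (e :: take (size lb) l), (drop (size lb) l); split=> //.
  - by rewrite /= cat_take_drop.
  - by rewrite -size_eq0 size_drop subn_eq0 -ltnNge.
  - by rewrite !psrc_cons -lbE [in RHS]ll psrc_cat psrc_cons -ef.
have [l1 [l2 [ll l10 l20 h]]] := IH _ ul' pl nu.
by exists (e :: l1), l2; split=> //; rewrite ll.
Qed.

(** If the sources are distinct then the path is a cycle; otherwise it splits, by
    [unique_entry_repeat], into two shorter closed paths at the same vertex. *)
Lemma closed_unique_entry v l : is_path v l -> l != [::] -> psrc v l = v -> unique_entry l ->
  (exists l1 (m : gpath E), [/\ entry_free_cycle m, l = l1 ++ pedges m, psrc v l1 = v & prange m = v]) /\
  (forall e, e \in l -> edge_entry_free e).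
Proof.
have [n] := ubnP (size l); elim: n l => // n IH l /ltnSE ln pl l0 cl ul.
have [uq|] := boolP (uniq (map (@esource E) l)).
  pose m := @GPath E (v, l) pl.
  have mc : entry_free_cycle m.
    split; last exact: ul.
    split; [|exact: (esym cl)|exact: uq].
    by rewrite /plength lt0n size_eq0.
  split; first by exists [::], m.
  by move=> e el; exists m.
move=> /(unique_entry_repeat ul pl)[l1 [l2 [ll l10 l20 h]]].
have c1 : psrc v l1 = v := etrans h cl.
move: pl cl; rewrite ll is_path_cat psrc_cat c1 => /andP[p1 p2] c2.
have sub l' : {subset l' <= l} -> unique_entry l'.
  by move=> l'l a b bl'; apply: ul; exact: l'l.
have u1 : unique_entry l1 by apply: sub => e el; rewrite ll mem_cat el.
have u2 : unique_entry l2 by apply: sub => e el; rewrite ll mem_cat el orbT.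
have [s1 s2] : (size l1 < n /\ size l2 < n)%N.
  move: ln; rewrite ll size_cat -(size_eq0 l1) -(size_eq0 l2) in l10 l20 *.
  rewrite -!lt0n in l10 l20; move=> ln; split; apply: leq_trans ln.
    by rewrite -[ltnLHS]addn0 ltn_add2l.
  by rewrite -[ltnLHS]add0n ltn_add2r.
have [_ e1] := IH _ s1 p1 l10 c1 u1.
have [[l3 [m [mc lm c3 mv]]] e2] := IH _ s2 p2 l20 c2 u2.
split; first by exists (l1 ++ l3), m; split=> //; rewrite ?psrc_cat ?c1// -catA -lm.
by move=> e; rewrite mem_cat => /orP[/e1|/e2].
Qed.

(** Edges of entry-free cycles get weight 0, so that the grading by weight is
    compatible with the relation that makes such cycles act as vertices. *)
Definition wt1 e : nat := if `[< edge_entry_free e >] then 0%N else 1%N.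

Definition wt l : nat := sumn (map wt1 l).

Lemma wt_cat l m : wt (l ++ m) = (wt l + wt m)%N.
Proof. by rewrite /wt map_cat sumn_cat. Qed.

Lemma wt0P l : wt l = 0%N -> forall e, e \in l -> edge_entry_free e.
Proof.
elim: l => // e l IH /eqP; rewrite addn_eq0 => /andP[/eqP we /eqP wl] f.
rewrite inE => /predU1P[->|]; last exact: IH.
by move: we; rewrite /wt1; case: asboolP.
Qed.

Lemma wt_ef l : (forall e, e \in l -> edge_entry_free e) -> wt l = 0%N.
Proof.
elim: l => // e l IH h; rewrite /wt /= -/(wt l) IH => [|f fl].
  by rewrite /wt1 asboolT//; apply: h; rewrite mem_head.
by apply: h; rewrite inE fl orbT.
Qed.

(** A closed path of weight 0 has no entrance, hence ends with an entry-free cycle. *)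
Lemma closed_wt0_pathsW (a b : gpath E) l : pedges b = pedges a ++ l -> l != [::] ->
  prange a = prange b -> psource b = psource a -> wt l = 0%N -> ~ pathsW b.
Proof.
move=> bal l0 rab sab wl; apply.
have := path_valP b; rewrite -/(pedges b) -/(prange b) bal is_path_cat => /andP[pa pl].
have cl : psrc (psource a) l = psource a.
  by rewrite -[RHS]sab !psourceE bal psrc_cat rab.
have ul : unique_entry l.
  by move=> e f fl ef; apply: (ef_unique (wt0P wl fl)).
have pl' : is_path (psource a) l by rewrite psourceE rab.
have [[l1 [m [mc lm c1 mr]]] _] := closed_unique_entry pl' l0 cl ul.
have pb' : is_path (prange b) (pedges a ++ l1).
  have := path_valP b; rewrite -/(pedges b) -/(prange b) bal lm catA is_path_cat.
  by case/andP.
exists (@GPath E (prange b, pedges a ++ l1) pb'), m; split=> //; split=> //.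
  rewrite psourceE /= psrc_cat mr.
  by change (psrc (psrc (prange b) (pedges a)) l1 = psource a); rewrite -rab.
by rewrite bal lm catA.
Qed.

(** Without an entrance the path would be a product of entry-free cycles and have
    weight 0. The path [m] follows [l] up to an entrance and leaves through it. *)
Lemma closed_entrance v l : is_path v l -> l != [::] -> psrc v l = v -> wt l <> 0%N ->
  exists m, [/\ is_path v m, (size m <= size l)%N & ~~ prefix m l].
Proof.
move=> pl l0 cl wl; have [ul|] := pselect (unique_entry l).
  by have [_ /wt_ef] := closed_unique_entry pl l0 cl ul.
move=> /existsNP[e /existsNP[f /not_implyP[fl /not_implyP[ef nef]]]].
have [l1 [l2 [ll rf _]]] := is_path_range pl fl.
exists (rcons l1 e); split.
- rewrite -cats1 is_path_cat /= ef rf eqxx !andbT.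
  by move: pl; rewrite ll is_path_cat => /andP[].
- by rewrite ll size_rcons size_cat /= addnS ltnS leq_addr.
- apply/negP => /prefixP[l3 l3E]; apply: nef.
  move: l3E; rewrite ll cat_rcons => /eqP; rewrite eqseq_cat// eqxx /=.
  by move=> /eqP[].
Qed.

(** Both cycles are determined by any one of their edges. *)
Lemma cycles_share_edge (m n : gpath E) e : entry_free_cycle m -> entry_free_cycle n ->
  e \in pedges m -> e \in pedges n -> {subset pedges m <= pedges n}.
Proof.
move=> [mc mn] nc em en.
have := path_valP m; rewrite -/(pedges m) -/(prange m) => pm.
have [l1 [l2 [ml re p2]]] := is_path_range pm em.
have : is_path (erange e) (e :: l2) by rewrite /= eqxx.
move=> /(entry_free_path nc en) sub.
have [f fn fr] : exists2 f, f \in pedges n & erange f = prange m.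
  have [f fn fs] := cycle_next nc.1 (sub _ (mem_last e l2)); exists f => //.
  have [_ -> _] := mc; rewrite fs /psource -/(psrc _ _) ml psrc_cat psrc_cons.
  by rewrite /psrc last_map.
by rewrite -fr in pm; exact: (entry_free_path nc fn).
Qed.

(** One edge is chosen from each edge set, rather than from each class, because
    different classes are only known to have disjoint or equal edge sets. *)
Lemma cutting_set_exists : exists X, cutting_set (E := E) X.
Proof.
have pick (D : set (edge E)) : exists o : option (edge E),
    (exists2 C, entry_free_classes C & D = class_edges C) -> exists2 e, o = Some e & D e.
  have [[C [m mc ->] ->]|nC] := pselect (exists2 C, entry_free_classes C & D = class_edges C);
    last by exists None => /nC.
  have [[m1 _ _] _] := mc; rewrite class_edges_cyclic.
  case ml : (pedges m) => [|e l]; first by rewrite /plength ml in m1.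
  by exists (Some e) => _; exists e => //=; rewrite mem_head.
have [c cP] := choice pick.
exists [set e | exists2 C, entry_free_classes C & c (class_edges C) = Some e]; split.
  move=> e [C hC ce]; exists C => //.
  by have [|f] := cP (class_edges C); [exists C|rewrite ce => -[->]].
move=> C hC; have [|e ce Ce] := cP (class_edges C); first by exists C.
exists e; apply/seteqP; split=> f /=; last by move=> ->; split=> //; exists C.
move=> [[C' hC' ce'] Cf]; have [|f'] := cP (class_edges C'); first by exists C'.
rewrite ce' => -[<-] C'f.
suff CC' : class_edges C = class_edges C' by move: ce'; rewrite -CC' ce => -[].
move: hC hC' Cf C'f => [m mc ->] [n nc ->]; rewrite !class_edges_cyclic /= => fm fn.
apply/seteqP; split=> g /=; first exact: (cycles_share_edge mc nc fm fn).
exact: (cycles_share_edge nc mc fn fm).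
Qed.

End Graph.

(** ** Operators that permute basis vectors *)

Section Implements.
Variables (R : realType) (S : choiceType).
Local Notation H := (l2 R S).
Implicit Types (f g : S -> option S) (T U : bop H).

Definition pinj f := forall i j k, f i = Some k -> f j = Some k -> i = j.

Definition oinv f (k : S) : option S :=
  if pselect (exists i, f i = Some k) is left h then Some (sval (cid h)) else None.

Lemma oinvP f : pinj f -> partial_inverse f (oinv f).
Proof.
move=> fi k i; rewrite /oinv; case: pselect => [h|nh]; split=> //.
- by move: (cid h) => [j fj] /= fk; rewrite (fi _ _ _ fj fk).
- by move: (cid h) => [j fj] /= ji; rewrite -(Some_inj ji).
- by move=> fik; case: nh; exists i.
Qed.

(** The operators of the family send basis vectors to basis vectors or to zero, so that
    identities between them reduce to identities of partial functions. *)
Definition implements T f := forall z, T (delta R z) = odelta R (f z).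

Lemma implements_odelta T f o : implements T f -> T (odelta R o) = odelta R (obind f o).
Proof. by move=> Tf; case: o => [z|]; [exact: Tf|exact: bop0]. Qed.

Lemma implements_eq T U f : implements T f -> implements U f -> T = U.
Proof. by move=> Tf Uf; apply: bop_deltaP => z; rewrite Tf Uf. Qed.

Lemma implements_mul T U f g : implements T f -> implements U g ->
  implements (T ** U) (fun z => obind f (g z)).
Proof. by move=> Tf Ug z; rewrite bop_mulE Ug (implements_odelta _ Tf). Qed.

Lemma implements_adj T f : pinj f -> implements T f -> implements (cadj T) (oinv f).
Proof.
move=> fi Tf; rewrite (implements_eq Tf (shift_delta R (oinvP fi))) => z.
have -> : cadj (shift R (oinvP fi)) = shift R (partial_inverse_sym (oinvP fi)).
  exact: badj_shift.
exact: shift_delta.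
Qed.

Lemma oinv_some f i k : pinj f -> f i = Some k -> oinv f k = Some i.
Proof. by move=> fi /(oinvP fi). Qed.

Lemma oinv_none f k : (forall i, f i <> Some k) -> oinv f k = None.
Proof. by move=> nf; rewrite /oinv; case: pselect => [[i fi]|//]; have := nf i fi. Qed.

Lemma odelta_neq0 (z : S) : odelta R (Some z) <> 0.
Proof.
move=> h; have := nrm_delta R z; rewrite -[delta R z]/(odelta R (Some z)) h nrm0.
by move=> /eqP; rewrite eq_sym oner_eq0.
Qed.

Lemma entry_implements T f z : implements T f -> entry T z = (f z == Some z)%:R.
Proof.
move=> Tf; rewrite /entry Tf; case: (f z) => [w|//].
by change (delta R w z = (w == z)%:R); rewrite deltaE eq_sym.
Qed.

End Implements.

(** * A Toeplitz-Cuntz-Krieger family on the boundary of the graph *)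

Section States.
Variable (E : digraph).
Implicit Types (u v w : vertex E) (e f : edge E) (l m : seq (edge E)).

(** A fixed choice of an incoming edge at each vertex that has one. Following it
    backwards indefinitely gives one distinguished boundary path per vertex. *)
Definition canon v : option (edge E) :=
  if pselect (exists e : edge E, erange e = v) is left h then Some (sval (cid h)) else None.

Lemma canon_exists e : exists2 f, canon (erange e) = Some f & erange f = erange e.
Proof.
rewrite /canon; case: pselect => [h|[]]; last by exists e.
by exists (sval (cid h)) => //; move: (cid h) => [f fv].
Qed.

Lemma canon_ef e : edge_entry_free e -> canon (erange e) = Some e.
Proof. by move=> he; have [f -> /(ef_unique he) ->] := canon_exists e. Qed.

(** [(v, l, k)] stands for the boundary path with range [v] that follows [l] and then
    the distinguished boundary path of the source of [l], together with a degree [k].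
    The degree separates a boundary path from its images under closed paths: without
    it periodic boundary paths would give [s_a s_b^*] with [a != b] a nonzero diagonal. *)
Definition state : choiceType := (vertex E * seq (edge E) * int)%type.

Definition rg (z : state) : vertex E := z.1.1.

(** Prolonging [l] by distinguished edges does not change the boundary path, so the
    last edge of [l] is required not to be distinguished. *)
Definition nonfinal (l : seq (edge E)) : bool :=
  if l is e :: m then canon (erange (last e m)) != Some (last e m) else true.

Definition valid (z : state) : bool := is_path z.1.1 z.1.2 && nonfinal z.1.2.

Definition push1 e (z : state) : state :=
  (erange e,
   (if (z.1.2 == [::]) && (canon (erange e) == Some e) then [::] else e :: z.1.2),
   z.2 + (wt1 e)%:Z).

Definition pushl l (z : state) : state := foldr push1 z l.

Lemma valid_push1 e z : valid z -> rg z = esource e -> valid (push1 e z).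
Proof.
case: z => [[v l] k] /andP[/= pl nl] ve; rewrite /rg /= in ve.
rewrite /valid /push1 /=; case: ifP => //= h.
rewrite eqxx -ve pl /=; move: h nl; case: l {pl} => [|f l] //= /negbT.
by case/orP: (orbN true).
Qed.

Lemma push1_inj e f y z : valid y -> valid z -> rg y = esource e -> rg z = esource f ->
  push1 e y = push1 f z -> e = f /\ y = z.
Proof.
case: y z => [[v l] k] [[w m] j] /andP[/= pl nl] /andP[/= pm nm]; rewrite /rg /=.
move=> ve wf; rewrite /push1 /=.
case: ifP => [/andP[/eqP l0 /eqP ce]|h1]; case: ifP => [/andP[/eqP m0 /eqP cf]|h2] // [ef].
  move=> kj; have fe : e = f by move: ce; rewrite ef cf => -[].
  by rewrite fe in ve kj *; split=> //; rewrite ve wf l0 m0; congr (_, _); exact: addIr kj.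
move=> fe lm kj; rewrite fe in ve kj *; split=> //; rewrite ve wf lm; congr (_, _).
exact: addIr kj.
Qed.

Lemma push1_surj z e : valid z -> erange e = rg z ->
  exists f y, [/\ valid y, rg y = esource f & z = push1 f y].
Proof.
case: z => [[v [|f l]] k] /andP[/= pl nl] ev; rewrite /rg /= in ev.
  have [f cf fe] := canon_exists e; exists f, (esource f, [::], k - (wt1 f)%:Z); split=> //.
  by rewrite /push1 /= fe cf eqxx ev subrK.
move: pl => /andP[/eqP fv pl].
exists f, (esource f, l, k - (wt1 f)%:Z); split=> //.
  by rewrite /valid /= pl; case: l nl {pl}.
rewrite /push1 /= fv subrK; congr (_, _, _).
by case: l nl {pl} => //=; rewrite fv => /negbTE ->.
Qed.

Lemma pushl_cat l m z : pushl (l ++ m) z = pushl l (pushl m z).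
Proof. by rewrite /pushl foldr_cat. Qed.

Lemma rg_pushl v l z : is_path v l -> rg z = psrc v l -> rg (pushl l z) = v.
Proof. by case: l => //= e l /andP[/eqP]. Qed.

Lemma valid_pushl v l z : is_path v l -> valid z -> rg z = psrc v l -> valid (pushl l z).
Proof.
elim: l v => //= e l IH v /andP[_ pl] vz zl; apply: valid_push1; first exact: IH pl vz zl.
exact: rg_pushl pl zl.
Qed.

Lemma deg_pushl l z : (pushl l z).2 = z.2 + (wt l)%:Z.
Proof.
elim: l => [|e l IH] /=; first by rewrite addr0.
by rewrite IH -addrA -PoszD addnC.
Qed.

(** Removing edges one by one from both sides until one path is exhausted. *)
Lemma pushl_inj v w l m y z : is_path v l -> is_path w m -> valid y -> valid z ->
  rg y = psrc v l -> rg z = psrc w m -> pushl l y = pushl m z ->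
  v = w /\ ((exists2 d, m = l ++ d & y = pushl d z) \/ (exists2 d, l = m ++ d & pushl d y = z)).
Proof.
elim: l v w m => [|e l IH] v w [|f m] /=.
- move=> _ _ _ _ yv zw yz; split; last by left; exists [::].
  have <- : rg y = v := yv; have <- : rg z = w := zw; by rewrite yz.
- move=> _ /andP[/eqP fw pm] vy vz yv zm yE; split.
    have <- : rg y = v := yv; by rewrite yE.
  by left; exists (f :: m).
- move=> /andP[/eqP ev pl] _ vy vz yv zw yE; split.
    have <- : rg z = w := zw; by rewrite -yE.
  by right; exists (e :: l).
move=> /andP[/eqP ev pl] /andP[/eqP fw pm] vy vz yl zm.
have vy' := valid_pushl pl vy yl; have vz' := valid_pushl pm vz zm.
move=> /(push1_inj vy' vz' (rg_pushl pl yl) (rg_pushl pm zm))[ef E2].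
have [_ h] := IH _ _ _ pl pm vy vz yl zm E2; split; first by rewrite -ev -fw ef.
by case: h => -[d dE yE]; [left|right]; exists d; rewrite // dE ef.
Qed.

End States.

Section Family.
Variables (R : realType) (E : digraph).
Implicit Types (u v w : vertex E) (e f : edge E) (l m d : seq (edge E)) (z y : state E).
Local Notation C := R[i].
Local Notation B := (bop (l2 R (state E))).
Local Notation "'\d' z" := (delta R (z : state E)) (at level 8).

Definition act v l z : option (state E) :=
  if valid z && (rg z == psrc v l) then Some (pushl l z) else None.

Lemma act_inj v l : is_path v l -> pinj (act v l).
Proof.
move=> pl y z k; rewrite /act; case: ifP => // /andP[vy /eqP yl] yk.
case: ifP => // /andP[vz /eqP zl]; rewrite -yk => /Some_inj h.
have [_ [[x lx ->]|[x lx <-]]] := pushl_inj pl pl vz vy zl yl h.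
  by have : size x == 0%N by [rewrite -(eqn_add2l (size l)) -size_cat -lx addn0]; case: x lx.
by have : size x == 0%N by [rewrite -(eqn_add2l (size l)) -size_cat -lx addn0]; case: x lx.
Qed.

Lemma is_path1 e : is_path (erange e) [:: e]. Proof. by rewrite /= eqxx. Qed.

Definition bvertex v : B := shift R (oinvP (@act_inj v [::] isT)).
Definition bedge e : B := shift R (oinvP (act_inj (is_path1 e))).

Lemma bvertexE v : implements (bvertex v) (act v [::]). Proof. exact: shift_delta. Qed.

Lemma bedgeE e : implements (bedge e) (act (erange e) [:: e]). Proof. exact: shift_delta. Qed.

(** Unbundled form of [path_elt], in which products of paths are concatenations
    of lists. *)
Definition lpath_elt (A : cstarType R) (p : vertex E -> A) (s : edge E -> A) v l : A :=
  if l is e :: m then edges_elt s e m else p v.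

Local Notation bpath := (lpath_elt bvertex bedge).

Lemma bpathE v l : is_path v l -> implements (bpath v l) (act v l).
Proof.
case: l => [_|e l]; first exact: bvertexE.
elim: l v e => [|f l IH] v e; first by move=> _; exact: bedgeE.
move=> /andP[_ pl] z; have := IH _ _ pl => /(implements_mul (bedgeE e)) h.
rewrite [LHS](h z) /act; congr odelta; rewrite !psrc_cons.
case: ifP => //= /andP[vz /eqP zl].
have vz' : valid (pushl (f :: l) z) by exact: (@valid_pushl _ (esource e) (f :: l) z pl vz zl).
have rz : rg (pushl (f :: l) z) = esource e by exact: (@rg_pushl _ (esource e) (f :: l) z pl zl).
by move: vz' rz => /= -> ->; rewrite eqxx.
Qed.

Lemma bpath_cat v l m : is_path v (l ++ m) ->
  bpath v (l ++ m) = bpath v l ** bpath (psrc v l) m.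
Proof.
move=> plm; have := plm; rewrite is_path_cat => /andP[pl pm].
apply: (implements_eq (bpathE plm)) => z.
rewrite (implements_mul (bpathE pl) (bpathE pm)) /act; congr odelta.
rewrite psrc_cat; case: ifP => //= /andP[vz /eqP zl].
by rewrite (valid_pushl pm)// (rg_pushl pm)// eqxx pushl_cat.
Qed.

Lemma bpath_adj_mul v l d : is_path v (l ++ d) ->
  cadj (bpath v l) ** bpath v (l ++ d) = bpath (psrc v l) d.
Proof.
move=> pld; have := pld; rewrite is_path_cat => /andP[pl pd].
apply: bop_deltaP => z.
rewrite (implements_mul (implements_adj (act_inj pl) (bpathE pl)) (bpathE pld)).
rewrite (bpathE pd); congr odelta; rewrite /act psrc_cat; case: ifP => //= /andP[vz /eqP zl].
apply: oinv_some; first exact: act_inj.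
by rewrite /act (valid_pushl pd)// (rg_pushl pd)// eqxx pushl_cat.
Qed.

Lemma bpath_isom v l : is_path v l -> cadj (bpath v l) ** bpath v l = bvertex (psrc v l).
Proof. by move=> pl; rewrite -[in X in _ ** X](cats0 l) bpath_adj_mul ?cats0. Qed.

(** Every product of elements of the family is computed from this trichotomy. In the last
    case the ranges are orthogonal because no state is reached along both paths. *)
Lemma bpath_cases v l w m : is_path v l -> is_path w m ->
  [\/ exists d, [/\ v = w, m = l ++ d & cadj (bpath v l) ** bpath w m = bpath (psrc v l) d],
      exists d, [/\ v = w, l = m ++ d & cadj (bpath v l) ** bpath w m = cadj (bpath (psrc w m) d)]
    | cadj (bpath v l) ** bpath w m = 0].
Proof.
move=> pl pm.
have [[y [z [vy vz yl zm h]]]|no] := pselect (exists y z,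
    [/\ valid y, valid z, rg y = psrc v l, rg z = psrc w m & pushl l y = pushl m z]).
  have [vw [[d md _]|[d ld _]]] := pushl_inj pl pm vy vz yl zm h; subst w.
    by apply: Or31; exists d; split=> //; rewrite md bpath_adj_mul// -md.
  apply: Or32; exists d; split=> //.
  by rewrite -[LHS]cadjK cadjM cadjK ld bpath_adj_mul// -ld.
apply: Or33; apply: bop_deltaP => z.
rewrite (implements_mul (implements_adj (act_inj pl) (bpathE pl)) (bpathE pm)).
rewrite {2}/act; case: ifP => //= /andP[vz /eqP zm].
rewrite oinv_none// => y; rewrite /act; case: ifP => // /andP[vy /eqP yl] /Some_inj h.
by apply: no; exists y, z.
Qed.

Lemma bvertex_mul v w : bvertex v ** bvertex w = if v == w then bvertex v else 0.
Proof.
apply: bop_deltaP => z; rewrite (implements_mul (bvertexE v) (bvertexE w)).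
case: eqVneq => [<-|vw].
  by rewrite bvertexE; congr odelta; rewrite /act; case: ifP => //= ->.
rewrite [RHS]bop0E {2}/act; case: ifP => //= /andP[vz /eqP zw].
by rewrite /act vz zw eq_sym (negbTE vw).
Qed.

Lemma bvertex_proj v : is_projection (bvertex v).
Proof.
have vv : bvertex v ** bvertex v = bvertex v by rewrite bvertex_mul eqxx.
split=> //; have := @bpath_isom v [::] isT; rewrite /= => h.
by rewrite -[in LHS]h cadjM cadjK h.
Qed.

Lemma bvertex_neq0 v : bvertex v <> 0.
Proof.
move=> v0; have := bvertexE v (v, [::], 0); rewrite v0 /act.
have -> : valid (v, [::], 0) && (rg (v, [::], 0) == psrc v [::]) by rewrite /valid /rg /= eqxx.
by move=> /esym; exact: odelta_neq0.
Qed.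

Lemma bvertex_bpath v l : is_path v l -> bvertex v ** bpath v l = bpath v l.
Proof. by move=> pl; exact/esym/(@bpath_cat v [::] l). Qed.

Lemma bpath_bvertex v l : is_path v l -> bpath v l ** bvertex (psrc v l) = bpath v l.
Proof. by move=> pl; have := @bpath_cat v l [::]; rewrite cats0 => <-. Qed.

Lemma nrm_bpath_le1 v l : is_path v l -> nrm (bpath v l) <= 1.
Proof.
move=> pl; rewrite -(@ler_pXn2r _ 2)// ?nnegrE ?nrm_ge0// -nrm_cstar bpath_isom//.
by rewrite (nrm_proj (bvertex_proj _) (@bvertex_neq0 _)) expr1n.
Qed.

Lemma bop_sumE I (r : seq I) (F : I -> B) x : (\sum_(i <- r) F i) x = \sum_(i <- r) F i x.
Proof. by apply: (big_morph (fun T : B => T x)). Qed.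

Lemma bedge_range_in e y : valid y -> rg y = esource e ->
  (bedge e ** cadj (bedge e)) (\d (push1 e y)) = \d (push1 e y).
Proof.
move=> vy ry; have ae : act (erange e) [:: e] y = Some (push1 e y) by rewrite /act vy ry eqxx.
have ie := implements_adj (act_inj (is_path1 e)) (bedgeE e).
by rewrite (implements_mul (bedgeE e) ie) (oinv_some (act_inj (is_path1 e)) ae) /= ae.
Qed.

Lemma bedge_range_out e z : (forall y, valid y -> rg y = esource e -> z <> push1 e y) ->
  (bedge e ** cadj (bedge e)) (\d z) = 0.
Proof.
move=> no; have ie := implements_adj (act_inj (is_path1 e)) (bedgeE e).
rewrite (implements_mul (bedgeE e) ie) oinv_none// => y; rewrite /act.
by case: ifP => // /andP[vy /eqP ry] /Some_inj h; apply: (no y).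
Qed.

(** A boundary path starts with at most one edge, so the defect
    [p_v - \sum_(e in F) s_e s_e^*] is a diagonal projection. *)
Lemma bfamily_toeplitz : toeplitz_CK_family bvertex bedge.
Proof.
split.
- exact: bvertex_proj.
- by move=> v w /eqP vw; rewrite bvertex_mul (negbTE vw).
- by move=> e; rewrite -[RHS](bpath_isom (is_path1 e)).
move=> v F finF Fv; set D : B := _ - _.
have DE z : D (\d z) = \d z \/ D (\d z) = 0.
  rewrite /D bopBE fsbig_finite// bop_sumE bvertexE /act.
  case: ifP => [/andP[vz /eqP rz]|no]; last first.
    rewrite big1_seq ?subr0; first by right.
    move=> e /andP[_]; rewrite in_fset_set// inE => Fe; apply: bedge_range_out => y vy ry zy.
    case/negP: no; rewrite {1}zy valid_push1//= zy /rg /=.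
    by rewrite (Fv _ Fe : erange e = v).
  have [[e [y [Fe vy ry zy]]]|no] := pselect (exists e y,
      [/\ F e, valid y, rg y = esource e & z = push1 e y]); last first.
    rewrite big1_seq ?subr0; first by left.
    move=> e /andP[_]; rewrite in_fset_set// inE => Fe; apply: bedge_range_out => y vy ry zy.
    by apply: no; exists e, y.
  right; rewrite (bigD1_seq e); [|by rewrite in_fset_set// inE|exact: finmap.fset_uniq].
  rewrite zy bedge_range_in//.
  rewrite big1 ?Monoid.mulm1; first exact: subrr.
  move=> f fe; apply: bedge_range_out => y' vy' ry' zy'.
  by have [ef _] := push1_inj vy vy' ry ry' zy'; rewrite ef eqxx in fe.
exists D; apply: bop_deltaP => z.
have dD : diagonal D.
  apply: diagonalP => x; rewrite /entry; case: (DE x) => ->.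
    by rewrite deltaE eqxx scale1r.
  by rewrite l20E scale0r.
have -> : cadj D = D.
  apply: bop_deltaP => x; apply: l2P => i.
  rewrite [LHS]badj_delta !diagonal_delta// !l2ZE !deltaE (eq_sym x).
  case: eqVneq => [->|]; last by rewrite !mulr0 conjc0.
  rewrite !mulr1 /entry; case: (DE x) => ->; rewrite ?l20E ?conjc0//.
  by rewrite deltaE eqxx conjc1.
by rewrite bop_mulE; case: (DE z) => [h|->]; rewrite ?bop0// !h.
Qed.

End Family.

(** * Compressing by long paths *)

Section Compress.
Variables (R : realType) (E : digraph).
Implicit Types (u v w : vertex E) (e f : edge E) (l m d : seq (edge E)) (z y : state E).
Implicit Types (a b c : gpath E).
Local Notation C := R[i].
Local Notation B := (bop (l2 R (state E))).
Local Notation Q := (@bvertex R E).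
Local Notation bpath := (lpath_elt (@bvertex R E) (@bedge R E)).
Local Notation P := (path_elt (@bvertex R E) (@bedge R E)).

Lemma path_eltE (A : cstarType R) (p : vertex E -> A) (s : edge E -> A) a :
  path_elt p s a = lpath_elt p s (prange a) (pedges a).
Proof. by []. Qed.

Lemma gpathP a : is_path (prange a) (pedges a). Proof. exact: path_valP. Qed.

Lemma gpath_eq a b : prange a = prange b -> pedges a = pedges b -> a = b.
Proof.
case: a b => [[v l] pl] [[w m] pm]; rewrite /prange /pedges /= => vw lm.
by apply: val_inj; rewrite /= vw lm.
Qed.

Definition generators (A : cstarType R) (p : vertex E -> A) (s : edge E -> A)
    (W : set (gpath E)) : set A :=
  [set x | exists a b : gpath E,
     [/\ W a, W b, psource a = psource b & x = path_elt p s a ** cadj (path_elt p s b)]].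

(** ** Paths around entry-free cycles act trivially *)

(** A path that starts on an entry-free cycle consists of distinguished edges, whereas
    the last edge of a nonempty [l] in a valid state is not distinguished. *)
Lemma state_entry_free z e : valid z -> edge_entry_free e -> erange e = rg z ->
  z = (rg z, [::], z.2).
Proof.
case: z => [[v l] k] /andP[/= pl nl] he; rewrite /rg /= => ev.
case: l pl nl => // f l pl nl; rewrite -ev in pl.
have := ef_path he pl (mem_last f l) => /canon_ef; move: nl; rewrite /nonfinal => /eqP nl h.
by case: nl.
Qed.

Lemma pushl_entry_free v l k : is_path v l -> (forall e, e \in l -> edge_entry_free e) ->
  pushl l (psrc v l, [::], k) = (v, [::], k + (wt l)%:Z).
Proof.
elim: l v => [|e l IH] v /=; first by rewrite addr0.
move=> /andP[/eqP ev pl] h; rewrite psrc_cons IH//; last first.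
  by move=> f fl; apply: h; rewrite inE fl orbT.
rewrite /push1 /= canon_ef ?eqxx /=; last by apply: h; rewrite mem_head.
by rewrite ev -addrA -PoszD addnC.
Qed.

Lemma bpath_wt0 v l : is_path v l -> psrc v l = v -> wt l = 0%N -> bpath v l = Q v.
Proof.
case: l => // e l pl cl wl; apply: bop_deltaP => z; rewrite (bpathE R pl) bvertexE.
have h := wt0P wl; have he := h e (mem_head _ _).
congr odelta; rewrite /act cl; case: ifP => // /andP[vz /eqP zv]; congr Some.
have ev : erange e = rg z by rewrite zv; case/andP: pl => /eqP.
rewrite (state_entry_free vz he ev) zv -[in LHS]cl pushl_entry_free// wl addr0.
by [].
Qed.

Lemma bpath_cycle a : entry_free_cycle a -> P a = Q (prange a).
Proof.
move=> ca; apply: bpath_wt0; first exact: gpathP.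
  by have [[_ am _] _] := ca; rewrite -psourceE am.
by apply: wt_ef => e ea; exists a.
Qed.

(** Entry-free cycles at the end of a path can be removed one after the other. *)
Lemma path_elt_pathsW a : exists b, [/\ pathsW b, psource b = psource a & P b = P a].
Proof.
have [n] := ubnP (plength a); elim: n a => // n IH a /ltnSE an.
have [aW|] := pselect (pathsW a); first by exists a.
move=> /contrapT[b [m [mc [bm ab abm]]]].
have bn : (plength b < n)%N.
  apply: leq_trans an; rewrite /plength abm size_cat -[ltnLHS]addn0 ltn_add2l.
  by case: mc => -[].
have [c [cW cb Pc]] := IH b bn; exists c; split=> //.
  have [[_ mm _] _] := mc.
  by rewrite cb [RHS]psourceE abm psrc_cat ab -psourceE bm -psourceE -mm.
have pa := gpathP a; rewrite abm ab in pa.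
rewrite Pc [RHS]path_eltE abm ab bpath_cat// -psourceE bm -!path_eltE (bpath_cycle mc).
by rewrite -bm psourceE bpath_bvertex// gpathP.
Qed.

Lemma generators_pathsW :
  generators (@bvertex R E) (@bedge R E) setT = generators (@bvertex R E) (@bedge R E) (@pathsW E).
Proof.
apply/seteqP; split=> x [a [b [aW bW ab xE]]]; last by exists a, b.
have [a' [aW' as' Pa']] := path_elt_pathsW a.
have [b' [bW' bs' Pb']] := path_elt_pathsW b.
by exists a', b'; split=> //; [rewrite as' bs'|rewrite Pa' Pb'].
Qed.

(** ** The algebra of the family *)

Local Notation gens := (generators (@bvertex R E) (@bedge R E) setT).

Lemma generators_mul (X Y : B) : gens X -> gens Y -> lin_span gens (X ** Y).
Proof.
move=> [a [b [_ _ ab ->]]] [c [d [_ _ cd ->]]].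
rewrite -!cmulA (cmulA (cadj (P b))).
have [[l [bc cE ->]]|[l [bc bE ->]]|->] := bpath_cases R (gpathP b) (gpathP c).
- have pal : is_path (prange a) (pedges a ++ l).
    rewrite is_path_cat gpathP /= -psourceE ab psourceE.
    by have := gpathP c; rewrite cE -bc is_path_cat => /andP[].
  apply: lin_span_gen; exists (@GPath E (prange a, pedges a ++ l) pal), d; split=> //.
    rewrite psourceE; change (psrc (prange a) (pedges a ++ l) = psource d).
    by rewrite psrc_cat -psourceE ab -cd !psourceE cE bc psrc_cat.
  rewrite cmulA; congr (_ ** _).
  by rewrite [RHS]path_eltE [RHS](bpath_cat R pal) -[psrc (prange a) _]psourceE ab.
- have pdl : is_path (prange d) (pedges d ++ l).
    rewrite is_path_cat gpathP /= -psourceE -cd psourceE.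
    by have := gpathP b; rewrite bE bc is_path_cat => /andP[].
  apply: lin_span_gen; exists a, (@GPath E (prange d, pedges d ++ l) pdl); split=> //.
    rewrite [RHS]psourceE; change (psource a = psrc (prange d) (pedges d ++ l)).
    by rewrite psrc_cat -psourceE -cd ab !psourceE bE bc psrc_cat.
  congr (_ ** _); rewrite -cadjM; congr cadj.
  by rewrite [RHS]path_eltE [RHS](bpath_cat R pdl) -[psrc (prange d) _]psourceE -cd.
- by rewrite cmul0l cmul0r; exact: lin_span0.
Qed.

Lemma generators_adj (X : B) : gens X -> gens (cadj X).
Proof.
by move=> [a [b [_ _ ab ->]]]; exists b, a; rewrite cadjM cadjK; split.
Qed.

Definition vpath v : gpath E := @GPath E (v, [::]) isT.

Lemma family_algebra_span :
  family_algebra (@bvertex R E) (@bedge R E) =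
  closure (lin_span gens).
Proof.
apply/seteqP; split.
  apply: cstar_generated_sub.
    exact: closure_span_subalgebra generators_mul generators_adj.
  move=> x [[v _ <-]|[e _ <-]]; apply: subset_closure; apply: lin_span_gen.
    exists (vpath v), (vpath v); split=> //.
    by have [vv va] := bvertex_proj R v; change (Q v = Q v ** cadj (Q v)); rewrite va vv.
  exists (@GPath E (erange e, [:: e]) (is_path1 e)), (vpath (esource e)); split=> //.
  have [vv va] := bvertex_proj R (esource e).
  change (bedge R e = bedge R e ** cadj (Q (esource e))); rewrite va.
  exact: esym (bpath_bvertex R (is_path1 e)).
apply: closure_sub_closed; first exact: (csub_closed (cstar_generated_subalgebra _)).
apply: lin_span_sub; first exact: cstar_generated_subalgebra.
have hF := cstar_generated_subalgebra (range (@bvertex R E) `|` range (@bedge R E)).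
have Pin a : family_algebra (@bvertex R E) (@bedge R E) (P a).
  rewrite path_eltE; case: (pedges a) => [|e l] /=.
    by apply: cstar_generated_gen; left; exists (prange a).
  have Te f : family_algebra (@bvertex R E) (@bedge R E) (bedge R f).
    by apply: cstar_generated_gen; right; exists f.
  by elim: l e => [|f l IH] e; [exact: Te|exact: (csubM hF (Te e) (IH f))].
by move=> x [a [b [_ _ _ ->]]]; exact: (csubM hF (Pin a) (csub_adj hF (Pin b))).
Qed.

(** ** Removing closed paths by compression *)

Definition compress v l (X : B) : B := cadj (bpath v l) ** X ** bpath v l.

Lemma compress_cat v l m X : is_path v (l ++ m) ->
  compress v (l ++ m) X = compress (psrc v l) m (compress v l X).
Proof. by move=> plm; rewrite /compress bpath_cat// cadjM !cmulA. Qed.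

Lemma compress0 v l : compress v l 0 = 0.
Proof. by rewrite /compress cmul0r cmul0l. Qed.

Lemma compressQ v l : is_path v l -> compress v l (Q v) = Q (psrc v l).
Proof. by move=> pl; rewrite /compress -cmulA bvertex_bpath// bpath_isom. Qed.

Lemma compress_adj v l X : compress v l (cadj X) = cadj (compress v l X).
Proof. by rewrite /compress !cadjM cadjK cmulA. Qed.

Lemma compress_sum v l n (c : 'I_n -> C) (X : 'I_n -> B) :
  compress v l (\sum_i c i *: X i) = \sum_i c i *: compress v l (X i).
Proof.
rewrite /compress cmul_sumr cmul_suml; apply: eq_bigr => i _.
by rewrite -cscalerAr -cscalerAl.
Qed.

Lemma entry_sum n (c : 'I_n -> C) (X : 'I_n -> B) z :
  entry (\sum_i c i *: X i) z = \sum_i c i * entry (X i) z.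
Proof.
have h (r : seq 'I_n) : entry (\sum_(i <- r) c i *: X i) z = \sum_(i <- r) c i * entry (X i) z.
  elim: r => [|i r IH]; first by rewrite !big_nil.
  rewrite !big_cons.
  rewrite entryD.
  rewrite entryZ.
  by rewrite IH.
exact: h.
Qed.

(** Compressing by a longer path keeps an operator in this class, and a suitable
    path sends any member of it to zero. *)
Definition removable w (X : B) := X = 0 \/ exists l,
  [/\ is_path w l, psrc w l = w, wt l <> 0%N & X = bpath w l \/ X = cadj (bpath w l)].

Lemma removable_adj w X : removable w X -> removable w (cadj X).
Proof.
move=> [->|[l [pl cl wl h]]]; [by left; rewrite cadj0|right; exists l; split=> //].
by case: h => ->; [right|left; rewrite cadjK].
Qed.

Lemma compress_closed w l m : is_path w l -> psrc w l = w -> wt l <> 0%N -> is_path w m ->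
  removable (psrc w m) (compress w m (bpath w l)).
Proof.
move=> pl cl wl pm; have plm : is_path w (l ++ m) by rewrite is_path_cat pl cl.
have l0 : (0 < size l)%N by case: l wl {pl cl plm}.
have lmM : bpath w l ** bpath w m = bpath w (l ++ m) by rewrite bpath_cat// cl.
rewrite /compress -cmulA lmM.
have [[d [_ lmE ->]]|[d [_ mE _]]|->] := bpath_cases R pm plm; last by left.
  right; exists d; split; last by left.
  - by move: plm; rewrite lmE is_path_cat => /andP[].
  - by rewrite -psrc_cat -lmE psrc_cat cl.
  - have := congr1 (@wt E) lmE; rewrite !wt_cat addnC => /addnI <-//.
have := congr1 size mE; rewrite !size_cat -addnA addnCA -{1}[size m]addn0.
by move=> /addnI/esym/eqP; rewrite addn_eq0 => /andP[/eqP s0]; rewrite s0 in l0.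
Qed.

Lemma compress_removable w m X : removable w X -> is_path w m ->
  removable (psrc w m) (compress w m X).
Proof.
move=> [->|[l [pl cl wl h]]] pm; first by left; rewrite compress0.
by case: h => ->; rewrite ?compress_adj; try apply: removable_adj; exact: compress_closed pm.
Qed.

(** If [m] leaves the closed path [l] through an entrance then [m] and [l m] do not
    extend one another, whence [s_m^* s_l s_m = 0]. *)
Lemma remove_one w X : removable w X -> exists m, is_path w m /\ compress w m X = 0.
Proof.
move=> [->|[l [pl cl wl h]]]; first by exists [::]; rewrite compress0.
have l0 : l != [::] by case: l wl {pl cl h}.
have [m [pm sm np]] := closed_entrance pl l0 cl wl; exists m; split=> //.
suff Z : compress w m (bpath w l) = 0 by case: h => ->//; rewrite compress_adj Z cadj0.
have plm : is_path w (l ++ m) by rewrite is_path_cat pl cl.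
have lmM : bpath w l ** bpath w m = bpath w (l ++ m) by rewrite bpath_cat// cl.
rewrite /compress -cmulA lmM.
have [[d [_ lmE _]]|[d [_ mE _]]|->//] := bpath_cases R pm plm.
  case/negP: np; have mE : take (size m) l = m.
    by rewrite -[RHS](take_size_cat d (erefl (size m))) -lmE takel_cat.
  by rewrite -mE prefix_take.
have := congr1 size mE; rewrite !size_cat -addnA addnCA -{1}[size m]addn0.
move=> /addnI/esym/eqP; rewrite addn_eq0 => /andP[]; rewrite size_eq0 => l00.
by rewrite l00 in l0.
Qed.

(** The removing paths are concatenated: after compressing by the first one, the
    remaining operators are again of the class [removable]. *)
Lemma remove_all (I : eqType) w (X : I -> B) (r : seq I) :
  (forall i, i \in r -> removable w (X i)) ->
  exists m, is_path w m /\ forall i, i \in r -> compress w m (X i) = 0.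
Proof.
elim: r => [|i r IH] h; first by exists [::].
have [|m [pm mX]] := IH; first by move=> j jr; apply: h; rewrite inE jr orbT.
have [d [pd dX]] := remove_one (compress_removable (h i (mem_head _ _)) pm).
have pmd : is_path w (m ++ d) by rewrite is_path_cat pm.
exists (m ++ d); split=> // j; rewrite inE compress_cat// => /predU1P[->//|/mX ->].
by rewrite compress0.
Qed.

(** ** Diagonal entries as compressions *)

Lemma entryQ v y : valid y -> rg y = v -> entry (Q v) y = 1.
Proof.
move=> vy <-; rewrite (entry_implements y (bvertexE R (rg y))) /act vy.
by rewrite -[psrc _ _]/(rg y) !eqxx.
Qed.

(** A closed path of positive weight changes the degree of each state it acts on. *)
Lemma entry_removable w X y : valid y -> rg y = w -> removable w X -> entry X y = 0.
Proof.
move=> vy yw rX.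
have closed0 l : is_path w l -> wt l <> 0%N -> entry (bpath w l) y = 0.
  move=> pl wl; rewrite (entry_implements y (bpathE R pl)) /act.
  case: ifP => // _; case: eqVneq => // /Some_inj /(congr1 snd).
  rewrite deg_pushl -[RHS]addr0 => /addrI /eqP; rewrite eqz_nat => /eqP//.
case: rX => [->//|[l [pl _ wl [|]->]]]; first exact: closed0.
by rewrite entry_adj closed0// conjc0.
Qed.

Lemma entry_compress v l X y : is_path v l -> valid y -> rg y = psrc v l ->
  entry (compress v l X) y = entry X (pushl l y).
Proof.
move=> pl vy ry; have ay : act v l y = Some (pushl l y) by rewrite /act vy ry eqxx.
have dy : bpath v l (delta R y) = delta R (pushl l y) by rewrite (bpathE R pl) ay.
by rewrite /entry /compress !bop_mulE dy -[LHS]ip_delta badjP' dy ip_delta.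
Qed.

(** Unfolding stops at a vertex that receives no edge. No path can be prolonged there
    either, which serves [compress_generator] as well as length does. *)
Lemma unfold_state z (n : nat) : valid z -> exists v l y,
  [/\ is_path v l, valid y, rg y = psrc v l, z = pushl l y &
      (n <= size l)%N \/ (forall e, erange e <> rg y)].
Proof.
move=> vz; elim: n => [|n [v [l [y [pl vy ry zy h]]]]].
  by exists (rg z), [::], z; split=> //; left.
have [[e er]|no] := pselect (exists e, erange e = rg y); last first.
  by exists v, l, y; split=> //; right => e er; apply: no; exists e.
case: h => [nl|/(_ e)//].
have [f [x [vx rx yx]]] := push1_surj vy er.
exists v, (rcons l f), x; split=> //.
- by rewrite -cats1 is_path_cat pl /= andbT -ry yx.
- by rewrite -cats1 psrc_cat.
- by rewrite -cats1 pushl_cat zy yx.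
- by left; rewrite size_rcons.
Qed.

(** For [l] long enough the two paths [a] and [b] are absorbed, and what remains is a
    closed path at the source of [l] or the adjoint of one. *)
Lemma compress_generator v l y a b : is_path v l -> valid y -> rg y = psrc v l ->
  psource a = psource b -> (plength b <= size l)%N \/ (forall e, erange e <> rg y) ->
  compress v l (P a ** cadj (P b)) = Q (psrc v l) \/
  removable (psrc v l) (compress v l (P a ** cadj (P b))).
Proof.
move=> pl vy ry ab long; rewrite /compress -!cmulA.
have closed0 w d : is_path w d -> psrc w d = w ->
    (bpath w d = Q w \/ removable w (bpath w d)) /\
    (cadj (bpath w d) = Q w \/ removable w (cadj (bpath w d))).
  move=> pd cd; have [wd|wd] := pselect (wt d = 0%N).
    by have [_ qa] := bvertex_proj R w; rewrite bpath_wt0// qa; split; left.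
  by split; right; right; exists d; split=> //; [left|right].
have main d : v = prange b -> l = pedges b ++ d ->
    cadj (P b) ** bpath v l = bpath (psource b) d ->
    cadj (bpath v l) ** (P a ** (cadj (P b) ** bpath v l)) = Q (psrc v l) \/
    removable (psrc v l) (cadj (bpath v l) ** (P a ** (cadj (P b) ** bpath v l))).
  move=> vb lE ->; have pad : is_path (prange a) (pedges a ++ d).
    rewrite is_path_cat gpathP /= -psourceE ab psourceE -vb.
    by move: pl; rewrite lE is_path_cat => /andP[].
  have sad : psrc (prange a) (pedges a ++ d) = psrc v l.
    by rewrite psrc_cat -psourceE ab lE psrc_cat psourceE vb.
  have -> : P a ** bpath (psource b) d = bpath (prange a) (pedges a ++ d).
    by rewrite bpath_cat// -psourceE ab.
  have [[k [va kE ->]]|[k [va kE ->]]|->] := bpath_cases R pl pad; last by right; left.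
    apply: (closed0 _ _ _ _).1; last by rewrite -psrc_cat -kE -sad va.
    by move: pad; rewrite kE -va is_path_cat => /andP[].
  have pk : is_path (psrc (prange a) (pedges a ++ d)) k.
    by move: pl; rewrite kE va is_path_cat => /andP[].
  have ck : psrc (psrc (prange a) (pedges a ++ d)) k = psrc (prange a) (pedges a ++ d).
    by rewrite -psrc_cat -kE sad va.
  by rewrite -sad; exact: (closed0 _ _ pk ck).2.
have [[d [bv lE h]]|[d [bv bE h]]|->] := bpath_cases R (gpathP b) pl.
- by apply: (main d).
- case: d bE h => [|e d] bE h.
    apply: (main [::]) => //; rewrite cats0 in bE; first by rewrite cats0.
    by rewrite -bE -bv; exact: (bpath_isom R (gpathP b)).
  exfalso; case: long => [|/(_ e)].
    by rewrite /plength bE size_cat -[leqRHS]addn0 leq_add2l.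
  apply; have := gpathP b; rewrite bE is_path_cat bv ry => /andP[_] /= /andP[/eqP].
  by [].
- by right; left; rewrite !cmul0r.
Qed.

(** Compress by a long initial segment of [z], then by a path that removes the finitely
    many remaining closed paths of positive weight. What is left are the terms that fix
    [z]. This expresses a diagonal entry inside the algebra, where [psi] applies. *)
Lemma entry_as_compression T z : lin_span gens T -> valid z ->
  exists v l, is_path v l /\ compress v l T = entry T z *: Q (psrc v l).
Proof.
move=> [n [c [X [gX TE]]]] vz.
have [ab abP] := choice (fun i => let: ex_intro a (ex_intro b h) := gX i in
  ex_intro (fun ab : gpath E * gpath E => psource ab.1 = psource ab.2 /\
     X i = P ab.1 ** cadj (P ab.2)) (a, b) (let: And4 _ _ h1 h2 := h in conj h1 h2)).
pose L := \max_(i < n) plength (ab i).2.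
have [v [l [y [pl vy ry zy long]]]] := unfold_state L vz.
pose Y i := compress v l (X i).
have YP i : Y i = Q (psrc v l) \/ removable (psrc v l) (Y i).
  have [h XE] := abP i; rewrite /Y XE; apply: (compress_generator pl vy ry h).
  case: long => [Ll|]; [left|by right].
  exact: leq_trans (@leq_bigmax 'I_n (fun i => plength (ab i).2) i) Ll.
pose r := [seq i <- enum 'I_n | `[< removable (psrc v l) (Y i) >]].
have [|m [pm mX]] := @remove_all _ (psrc v l) Y r.
  by move=> i; rewrite mem_filter => /andP[/asboolP h _].
have plm : is_path v (l ++ m) by rewrite is_path_cat pl.
exists v, (l ++ m); split=> //.
have -> : compress v (l ++ m) T = \sum_i c i *: compress v (l ++ m) (X i).
  by rewrite TE; exact: compress_sum.
have -> : entry T z = \sum_i c i * entry (X i) z.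
  by rewrite TE; exact: entry_sum.
rewrite scaler_suml.
apply: eq_bigr => i _.
rewrite -scalerA.
congr (_ *: _).
rewrite compress_cat//.
rewrite psrc_cat zy -(entry_compress _ pl vy ry) -/(Y i).
have [rY|nrY] := pselect (removable (psrc v l) (Y i)).
  rewrite mX; first by rewrite (entry_removable vy ry rY) scale0r.
  by rewrite mem_filter mem_enum andbT asboolT.
by case: (YP i) => // ->; rewrite compressQ// entryQ// scale1r.
Qed.

(** If [a] and [b] send the same state [y] to [z] then one of them, say [b], is [a]
    followed by a closed path that fixes [y]. That path has weight 0, so [b] ends with
    an entry-free cycle unless [a = b]. *)
Lemma entry_generator a b z : pathsW a -> pathsW b -> psource a = psource b ->
  entry (P a ** cadj (P b)) z = if a == b then entry (P a ** cadj (P a)) z else 0.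
Proof.
case: eqVneq => [<-//|ab] aW bW sab.
have ib := implements_adj (act_inj (gpathP b)) (bpathE R (gpathP b)).
rewrite (entry_implements z (implements_mul (bpathE R (gpathP a)) ib)).
case: eqVneq => // h; exfalso.
have fb := oinvP (act_inj (gpathP b)).
case oz : (oinv _ z) h => [y|] //=; have /fb := oz; rewrite /act.
case: ifP => // /andP[vy /eqP yb] /Some_inj bz; case: ifP => // /andP[_ /eqP ya] /Some_inj az.
have noret c (d : gpath E) l : pedges d = pedges c ++ l -> prange c = prange d -> psource d = psource c ->
    pathsW d -> rg y = psource c -> pushl l y = y -> c = d.
  move=> dE rcd sdc dW yc ly; have [l0|l0] := eqVneq l [::].
    by apply: gpath_eq => //; rewrite dE l0 cats0.
  exfalso; apply: (closed_wt0_pathsW dE l0 rcd sdc) dW.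
  by move/(congr1 snd): ly; rewrite deg_pushl -[RHS]addr0 => /addrI/eqP; rewrite eqz_nat => /eqP.
have [rab [[l lE yl]|[l lE yl]]] :=
    pushl_inj (gpathP a) (gpathP b) vy vy ya yb (etrans az (esym bz)).
  by case/eqP: ab; apply: (noret _ _ l).
by case/eqP: ab; apply/esym; apply: (noret _ _ l).
Qed.

End Compress.

(** * Transfer to the co-universal algebra *)

Lemma le_of_pow_bound (R : realType) (t r K : R) : 0 <= t -> 0 <= r ->
  (forall k, t ^+ (2 ^ k)%N <= K * r ^+ (2 ^ k)%N) -> t <= r.
Proof.
move=> t0 r0 h; rewrite leNgt; apply/negP => rt.
have [r00|rn0] := eqVneq r 0.
  by have := h 0%N; rewrite expn0 !expr1 r00 mulr0 leNgt -r00 rt.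
have rp : 0 < r by rewrite lt_neqAle eq_sym rn0.
pose q := t / r; have q1 : 1 < q by rewrite ltr_pdivlMr// mul1r.
have bern (m : nat) : 1 + m%:R * (q - 1) <= q ^+ m.
  elim: m => [|m IH]; first by rewrite mul0r addr0 expr0.
  rewrite exprS; apply: (@le_trans _ _ (q * (1 + m%:R * (q - 1)))).
    rewrite -subr_ge0 -natr1.
    have -> : q * (1 + m%:R * (q - 1)) - (1 + (m%:R + 1) * (q - 1)) = m%:R * (q - 1) ^+ 2.
      by ring.
    by rewrite mulr_ge0 ?sqr_ge0.
  by rewrite ler_pM2l// (lt_trans ltr01).
have qK k : q ^+ (2 ^ k)%N <= K by rewrite expr_div_n ler_pdivrMr ?exprn_gt0.
pose k := Num.bound (K / (q - 1)).
have kK : K / (q - 1) < k%:R.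
  apply: le_lt_trans (archi_boundP _); first exact: lexx.
  rewrite divr_ge0 ?subr_ge0 ?(ltW q1)// (le_trans _ (qK 0%N))// exprn_ge0//.
  exact: ltW (lt_trans ltr01 q1).
have k2 : (k <= 2 ^ k)%N by apply: ltnW; exact: ltn_expl.
have := le_trans (bern (2 ^ k)%N) (qK k); rewrite leNgt => /negP; apply.
rewrite ltr_pdivrMr ?subr_gt0// in kK; apply: (lt_le_trans kK).
rewrite (@le_trans _ _ ((2 ^ k)%:R * (q - 1)))// ?lerDr//.
by rewrite ler_pM2r ?subr_gt0// ler_nat.
Qed.

Section FiniteSupport.
Variables (R : realType) (S : choiceType).
Local Notation H := (l2 R S).

Definition truncate (x : H) (s : seq S) : H := \sum_(z <- s) x z *: delta R z.

Lemma truncateE x s i : uniq s -> truncate x s i = if i \in s then x i else 0.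
Proof.
move=> us; have -> : truncate x s i = \sum_(z <- s) (x z *: delta R z) i.
  by apply: (big_morph (fun y : H => y i)).
case: ifP => [is_|ns].
  rewrite (bigD1_seq i)// l2ZE deltaE eqxx mulr1 big1 ?Monoid.mulm1// => j ji.
  by rewrite l2ZE deltaE eq_sym (negbTE ji) mulr0.
rewrite big1_seq// => j; rewrite andTb => js; rewrite l2ZE deltaE.
by case: eqVneq js => [<-|]; rewrite ?ns ?mulr0.
Qed.

(** A finite subset that almost attains the norm leaves little outside it. *)
Lemma truncate_dense (x : H) (e : R) : 0 < e -> exists2 s, uniq s & nrm (x - truncate x s) < e.
Proof.
move=> e0; have e20 : 0 < e / 2 by rewrite divr_gt0.
have h0 : 0 < (e / 2) ^+ 2 by rewrite exprn_gt0.
have [_ [s /= us <-] hs] := sup_adherent h0 (l2_has_sup x).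
exists s => //; apply: (@le_lt_trans _ _ (e / 2)); last first.
  by rewrite ltr_pdivrMr// ltr_pMr// ltr1n.
apply: l2norm_le; split=> [|t ut]; first exact: ltW.
have nx : sup [set sqsum x s | s in [set s | uniq s]] = nrm x ^+ 2.
  rewrite nrm_l2E sqr_sqrtr//; apply: (le_trans (sqsum_ge0 x [::])).
  by apply: (sup_upper_bound (l2_has_sup x)); exists [::].
rewrite nx in hs.
pose u := undup (s ++ t); have uu : uniq u := undup_uniq _.
have su : {subset s <= u} by move=> i si; rewrite mem_undup mem_cat si.
have tu : {subset t <= u} by move=> i ti; rewrite mem_undup mem_cat ti orbT.
apply: (@le_trans _ _ (sqsum (x - truncate x s) u)).
  by apply: sum_uniq_le => // i; rewrite exprn_ge0 ?nrm_ge0.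
have xu : sqsum x u <= nrm x ^+ 2 := (l2normP x).2 u uu.
suff -> : sqsum (x - truncate x s) u = sqsum x u - sqsum x s.
  by rewrite lerBlDr (le_trans xu)// -lerBlDl ltW.
apply/esym/eqP; rewrite subr_eq; apply/eqP; rewrite /sqsum addrC.
rewrite (sum_uniq_sub _ us uu su); congr (_ + _).
rewrite [RHS](sum_uniq_sub _ us uu su) [X in X + _]big1_seq ?add0r.
  by apply: eq_bigr => i ns; rewrite l2BE truncateE// (negbTE ns) subr0.
by move=> i; rewrite andTb => is_; rewrite l2BE truncateE// is_ subrr nrm0 expr0n.
Qed.

Lemma nrm_bop_le_truncate (T : bop H) (K : R) : 0 <= K ->
  (forall x s, uniq s -> nrm (T (truncate x s)) <= K * nrm (truncate x s)) -> nrm T <= K.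
Proof.
move=> K0 h; apply: nrm_bop_le => // x; apply: le_epsP => e e0.
pose M := nrm T + K + 1.
have M0 : 0 < M by rewrite ltr_wpDl// addr_ge0 ?nrm_ge0.
have [s us xs] := truncate_dense x (divr_gt0 e0 M0).
set y := truncate x s in xs *.
rewrite -{1}(subrK y x) bopD (le_trans (nrmD _ _))//.
have h1 : nrm (T (x - y)) <= nrm T * nrm (x - y) by exact: nrm_bopP.
have h2 : nrm (T y) <= K * nrm y by exact: h.
have h3 : nrm y <= nrm x + nrm (x - y).
  by rewrite (nrmBC x) addrC -{1}(subrK x y) nrmD.
have h4 : K * nrm y <= K * nrm x + K * nrm (x - y) by rewrite -mulrDr ler_wpM2l.
have h5 : nrm (x - y) * M <= e by rewrite -ler_pdivlMr// ltW.
have h6 := nrm_ge0 (x - y).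
by rewrite /M in h5; lra.
Qed.

End FiniteSupport.

(** Here [P k] is [(T^* T)^(2^k)]. The diagonal of [P (k+1)] consists of the squared
    norms of the columns of [P k], so for [x] of finite support [|P k x|] is at most a
    constant times [r^(2^k)]. The moments are log-convex, that is
    [|P k x|^2 <= |P (k+1) x| |x|], and the constant disappears in the limit. *)
Lemma nrm_le_diag_powers (R : realType) (S : choiceType) (T : bop (l2 R S)) (r : R)
    (P : nat -> bop (l2 R S)) : 0 <= r ->
  P 0%N = cadj T ** T -> (forall k, P k.+1 = P k ** P k) ->
  (forall k, nrm (diag_part (P k)) <= r ^+ (2 ^ k)%N) -> nrm T ^+ 2 <= r.
Proof.
move=> r0 P0 PS hd.
have Psa k : cadj (P k) = P k.
  by elim: k => [|k IH]; [rewrite P0 cadjM cadjK|rewrite PS cadjM IH].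
have PS' k : P k.+1 = cadj (P k) ** P k by rewrite Psa PS.
have rk k : 0 <= r ^+ (2 ^ k)%N by rewrite exprn_ge0.
have col k z : nrm (P k (delta R z)) <= r ^+ (2 ^ k)%N.
  rewrite -(@ler_pXn2r _ 2)// ?nnegrE ?nrm_ge0// -exprM -expnSr.
  apply: le_trans (hd k.+1); have := entry_bound (diag_part (P k.+1)) z.
  rewrite entry_diag_part PS' entry_sqr nrm_real ger0_norm//.
  by rewrite exprn_ge0 ?nrm_ge0.
have step (x : l2 R S) k : nrm (P k x) ^+ 2 <= nrm (P k.+1 x) * nrm x.
  rewrite -[leLHS]ger0_norm ?exprn_ge0 ?nrm_ge0// -nrm_real -ip_norm.
  have -> : ip (P k x) (P k x) = ip (P k.+1 x) x.
    by rewrite PS' bop_mulE [RHS]badjP'.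
  exact: cauchy_schwarz.
have step0 (x : l2 R S) : nrm (T x) ^+ 2 <= nrm (P 0%N x) * nrm x.
  rewrite -[leLHS]ger0_norm ?exprn_ge0 ?nrm_ge0// -nrm_real -ip_norm.
  have -> : ip (T x) (T x) = ip (P 0%N x) x by rewrite P0 bop_mulE [RHS]badjP'.
  exact: cauchy_schwarz.
suff fin x s : uniq s -> nrm (T (truncate x s)) <= Num.sqrt r * nrm (truncate x s).
  have := nrm_bop_le_truncate (sqrtr_ge0 r) fin.
  by rewrite -(@ler_pXn2r _ 2)// ?nnegrE ?nrm_ge0 ?sqrtr_ge0// sqr_sqrtr.
move=> us; set y := truncate x s.
have [y0|yn0] := eqVneq (nrm y) 0.
  by rewrite (nrm0_eq0 y0) bop0 !nrm0 mulr0.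
have yp : 0 < nrm y by rewrite lt_neqAle eq_sym yn0 nrm_ge0.
pose K := \sum_(z <- s) nrm (x z).
have Kk k : nrm (P k y) <= K * r ^+ (2 ^ k)%N.
  rewrite /y /truncate bop_sum (le_trans (nrm_sum _ _ _))// /K mulr_suml ler_sum// => z _.
  by rewrite bopZ nrmZ ler_wpM2l ?nrm_ge0.
pose t := nrm (P 0%N y) / nrm y.
have t0 : 0 <= t by rewrite divr_ge0 ?nrm_ge0.
have tk k : t ^+ (2 ^ k)%N <= nrm (P k y) / nrm y.
  elim: k => [|k IH]; first by rewrite expn0 expr1.
  rewrite expnSr exprM (@le_trans _ _ ((nrm (P k y) / nrm y) ^+ 2))//.
    by rewrite ler_pXn2r ?nnegrE ?exprn_ge0// divr_ge0 ?nrm_ge0.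
  rewrite expr_div_n ler_pdivrMr ?exprn_gt0// expr2 mulrA mulfVK ?gt_eqF//.
  exact: step.
have tr : t <= r.
  apply: (@le_of_pow_bound _ _ _ (K / nrm y)) => // k.
  apply: le_trans (tk k) _; rewrite mulrAC ler_wpM2r ?invr_ge0 ?nrm_ge0//.
rewrite -(@ler_pXn2r _ 2)// ?nnegrE ?mulr_ge0 ?nrm_ge0 ?sqrtr_ge0//.
rewrite exprMn (sqr_sqrtr r0); apply: le_trans (step0 y) _.
by rewrite (expr2 (nrm y)) mulrA ler_wpM2r ?nrm_ge0// -ler_pdivrMr.
Qed.

(** ** Isometric images *)

Section Image.
Variables (R : realType) (B A : cstarType R) (D : set B) (f : B -> A).
Hypothesis hD : cstar_subalgebra D.
Hypothesis hf : star_hom_on D f.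
Hypothesis fiso : forall x, D x -> nrm x <= nrm (f x).

Lemma shom_inj x y : D x -> D y -> f x = f y -> x = y.
Proof.
move=> Dx Dy fxy; apply/subr0_eq/nrm0_eq0/le_anti; rewrite nrm_ge0 andbT.
apply: le_trans (fiso _) _; first exact: csubB.
by rewrite (shomB hD hf)// fxy subrr nrm0.
Qed.

(** Preimages of a convergent sequence form a Cauchy sequence because [f] is
    isometric, and their limit is mapped correctly because [f] is contractive. *)
Lemma image_closed Q : closed Q -> Q `<=` D -> closed (f @` Q).
Proof.
move=> /closed_nrmP cQ QD; apply/closed_nrmP => y hy.
have apx (n : nat) : exists2 x, Q x & nrm (y - f x) < n.+1%:R^-1.
  have [|_ [x Qx <-] yx] := hy n.+1%:R^-1; first by rewrite invr_gt0.
  by exists x.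
have /choice[u uP] : forall n : nat, exists x, Q x /\ nrm (y - f x) < n.+1%:R^-1.
  by move=> n; have [x] := apx n; exists x.
have small (e : R) : 0 < e -> exists N, forall n, (N <= n)%N -> nrm (y - f (u n)) < e.
  move=> e0; have [N _ hN] := near_infty_natSinv_lt (PosNum e0).
  by exists N => n Nn; apply: lt_trans (uP n).2 _; exact: (hN n).
have cu : cauchy_nrm u.
  move=> e e0; have [N hN] := small _ (divr_gt0 e0 (ltr0n _ 2)).
  exists N => m n Nm Nn.
  have Dm := QD _ (uP m).1; have Dn := QD _ (uP n).1.
  apply: le_lt_trans (fiso (csubB hD Dm Dn)) _; rewrite (shomB hD hf)//.
  rewrite (le_lt_trans (nrm_triang y _ _))// (splitr e) ltrD ?hN//.
  by rewrite nrmBC hN.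
have [x ux] := complete_seq cu.
have Qx : Q x.
  apply: cQ => e /ux[N hN]; exists (u N); first exact: (uP N).1.
  by rewrite nrmBC hN.
exists x => //; apply/subr0_eq/nrm0_eq0/le_anti; rewrite nrm_ge0 andbT.
apply: le_epsP => e e0; rewrite add0r.
have [N hN] := ux _ (divr_gt0 e0 (ltr0n _ 2)).
have [N' hN'] := small _ (divr_gt0 e0 (ltr0n _ 2)).
have h1 := hN _ (leq_maxl N N'); have h2 := hN' _ (leq_maxr N N').
move: (maxn N N') h1 h2 => k h1 h2.
have Dk := QD _ (uP k).1.
rewrite (le_trans (nrm_triang (f (u k)) _ _))// (splitr e) lerD//.
  rewrite -(shomB hD hf)//; last exact: QD.
  apply: le_trans (shom_contractive hD hf _) _; first by apply: csubB => //; exact: QD.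
  by rewrite nrmBC ltW.
by rewrite nrmBC ltW.
Qed.

Lemma image_subalgebra Q : cstar_subalgebra Q -> Q `<=` D -> cstar_subalgebra (f @` Q).
Proof.
move=> hQ QD; split.
- exact: image_closed (csub_closed hQ) QD.
- by exists 0; [exact: csub0 hQ|exact: shom0 hD hf].
- move=> _ _ [x Qx <-] [y Qy <-]; exists (x + y); first exact: csubD.
  by rewrite (shomD hf)//; exact: QD.
- move=> a _ [x Qx <-]; exists (a *: x); first exact: csubZ.
  by rewrite (shomZ hf)//; exact: QD.
- move=> _ _ [x Qx <-] [y Qy <-]; exists (x ** y); first exact: csubM.
  by rewrite (shomM hf)//; exact: QD.
- move=> _ [x Qx <-]; exists (cadj x); first exact: csub_adj.
  by rewrite (shom_adj hf)//; exact: QD.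
Qed.

Lemma image_closure_span S : S `<=` D ->
  f @` closure (lin_span S) = closure (lin_span (f @` S)).
Proof.
move=> SD.
have spD : lin_span S `<=` D := lin_span_sub hD SD.
have clD : closure (lin_span S) `<=` D := closure_sub_closed (csub_closed hD) spD.
have img x : lin_span S x -> lin_span (f @` S) (f x).
  move=> Sx; suff : D x /\ lin_span (f @` S) (f x) by case.
  elim/lin_span_ind : Sx => [|c {}x y Sx [Dy Sy]].
    by split; [exact: csub0|rewrite (shom0 hD hf); exact: lin_span0].
  have Dx := SD _ Sx; split; first by apply: csubD => //; exact: csubZ.
  rewrite (shomD hf)//; last exact: csubZ.
  by rewrite (shomZ hf)//; apply: lin_span_cons => //; exists x.
apply/seteqP; split=> [_ [x Sx <-]|].
  have /closure_nrmP Sx' := Sx; apply/closure_nrmP => e /Sx'[y Sy xy].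
  exists (f y); first exact: img.
  rewrite -(shomB hD hf); [|exact: clD|exact: spD].
  apply: le_lt_trans (shom_contractive hD hf _) xy.
  by apply: (csubB hD); [exact: clD|exact: spD].
apply: closure_sub_closed.
  by apply: image_closed clD; exact: closed_closure.
apply: lin_span_ind => [|c _ _ [x Sx <-] [y Sy <-]].
  exists 0; last exact: shom0 hD hf.
  by apply: subset_closure; exact: lin_span0.
have Dx := SD _ Sx; exists (c *: x + y).
  have /closure_nrmP Sy' := Sy; apply/closure_nrmP => e /Sy'[z Sz yz].
  exists (c *: x + z); first exact: lin_span_cons.
  by rewrite opprD addrACA subrr add0r.
rewrite (shomD hf); [|exact: csubZ|exact: clD].
by rewrite (shomZ hf).
Qed.

End Image.

Section Sqrt.
Variables (R : realType) (S : choiceType).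
Local Notation C := R[i].
Local Notation B := (bop (l2 R S)).

(** Polynomials in [t] without constant term that converge to the square root
    uniformly on [0, 1]; they make sense in an algebra without unit. *)
Fixpoint sqrt_iter (t : R) (n : nat) : R :=
  if n is m.+1 then let y := sqrt_iter t m in y + (t - y ^+ 2) / 2 else 0.

(** With [s] the square root, each step multiplies the error by [1 - (s + y) / 2], which
    is at most [1 - s / 2]; the second estimate is the resulting bound
    [s / (1 + n s / 2)] on the error, free of division. *)
Lemma sqrt_iter_bound (t : R) n : 0 <= t <= 1 ->
  0 <= sqrt_iter t n <= Num.sqrt t /\
  (Num.sqrt t - sqrt_iter t n) * (1 + n%:R * Num.sqrt t / 2) <= Num.sqrt t.
Proof.
move=> /andP[t0 t1]; have := sqr_sqrtr t0; have := sqrtr_ge0 t; move: (Num.sqrt t) => s s0 st.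
have s1 : s <= 1 by rewrite -(@ler_pXn2r _ 2)// ?nnegrE// st expr1n.
elim: n => [|n [/andP[y0 ys] IH]] /=.
  by rewrite lexx s0 subr0 mul0r mul0r addr0 mulr1.
move: (sqrt_iter t n) y0 ys IH => y y0 ys IH; rewrite -st.
have e : s - (y + (s ^+ 2 - y ^+ 2) / 2) = (s - y) * (1 - (s + y) / 2) by field.
have d0 : 0 <= s - y by rewrite subr_ge0.
have f0 : 0 <= 1 - (s + y) / 2 by lra.
split.
  have : 0 <= (s ^+ 2 - y ^+ 2) / 2 by rewrite divr_ge0// subr_ge0 ler_pXn2r ?nnegrE.
  have : 0 <= s - (y + (s ^+ 2 - y ^+ 2) / 2) by rewrite e mulr_ge0.
  lra.
rewrite e; have n0 : 0 <= n%:R :> R by [].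
apply: le_trans IH; rewrite -mulrA ler_wpM2l//.
apply: (@le_trans _ _ ((1 - s / 2) * (1 + n.+1%:R * s / 2))).
  rewrite ler_wpM2r ?addr_ge0 ?divr_ge0 ?mulr_ge0//; lra.
rewrite -[n.+1%:R]natr1; have : 0 <= n%:R * s ^+ 2 by rewrite mulr_ge0 ?sqr_ge0.
have : 0 <= s ^+ 2 := sqr_ge0 s.
have -> : (1 - s / 2) * (1 + (n%:R + 1) * s / 2) =
  1 + n%:R * s / 2 - (n%:R * s ^+ 2) / 4 - s ^+ 2 / 4 by field.
lra.
Qed.

Lemma sqrt_iter_error (t : R) n : 0 <= t <= 1 ->
  `|Num.sqrt t - sqrt_iter t n| * n%:R <= 2.
Proof.
move=> t01; have [/andP[y0 ys] h] := sqrt_iter_bound n t01.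
rewrite ger0_norm ?subr_ge0//.
have s0 := sqrtr_ge0 t; move: (Num.sqrt t) s0 h y0 ys => s s0 h y0 ys.
move: (sqrt_iter t n) h y0 ys => y h y0 ys.
have [s00|sn0] := eqVneq s 0.
  have -> : s - y = 0 by lra.
  by rewrite mul0r.
have sp : 0 < s by rewrite lt_neqAle eq_sym sn0.
rewrite -(ler_pM2r sp); have d0 : 0 <= s - y by rewrite subr_ge0.
have -> : (s - y) * n%:R * s = 2 * ((s - y) * (1 + n%:R * s / 2) - (s - y)) by field.
lra.
Qed.

(** The square root is the multiplication operator by the square roots of the entries.
    It stays in [D] as a uniform limit of polynomials in [G] without constant term. *)
Lemma diagonal_sqrt (D : set B) (G : B) (t : S -> R) : cstar_subalgebra D -> D G ->
  (forall z, 0 <= t z <= 1) -> (forall z, G (delta R z) = (t z)%:C%C *: delta R z) ->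
  exists T, [/\ D T, cadj T = T & T ** T = G].
Proof.
move=> hD DG t01 Gt.
pose Y := fix Y n := if n is m.+1 then Y m + (2^-1 : C) *: (G - Y m ** Y m) else 0 : B.
have YS n : Y n.+1 = Y n + (2^-1 : C) *: (G - Y n ** Y n) by [].
have YD n : D (Y n).
  elim: n => [|n IH]; first exact: csub0.
  apply: (csubD hD) => //; apply: (csubZ hD); apply: (csubB hD) => //.
  exact: (csubM hD).
have YE n z : Y n (delta R z) = (sqrt_iter (t z) n)%:C%C *: delta R z.
  elim: n => [|n IH]; first by rewrite bop0E scale0r.
  rewrite YS bopDE bopZE bopBE bop_mulE IH bopZ IH Gt scalerA -scalerBl scalerA -scalerDl.
  congr (_ *: _); rewrite rmorphD rmorphM rmorphB rmorphXn fmorphV rmorph_nat /= expr2.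
  by rewrite [X in _ + X]mulrC.
pose d z : C := (Num.sqrt (t z))%:C%C.
have d1 z : nrm (d z) <= 1.
  rewrite nrm_real ger0_norm ?sqrtr_ge0// -(@ler_pXn2r _ 2)// ?nnegrE ?sqrtr_ge0//.
  by have /andP[t0 t1] := t01 z; rewrite sqr_sqrtr// expr1n.
pose T := diagop ler01 d1; exists T; split.
- move/closed_nrmP: (csub_closed hD); apply=> e e0.
  pose n := (Num.bound (2 / e)).+1; exists (Y n) => //.
  have n0 : 0 < n%:R :> R by rewrite ltr0n.
  have TY z : nrm (d z - (sqrt_iter (t z) n)%:C%C) <= 2 / n%:R.
    by rewrite -rmorphB nrm_real ler_pdivlMr// sqrt_iter_error.
  have K0 : 0 <= 2 / n%:R :> R by rewrite divr_ge0// ltW.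
  have -> : T - Y n = diagop K0 TY.
    by apply: bop_deltaP => z; rewrite bopBE !diagop_delta YE scalerBl.
  apply: le_lt_trans (nrm_diagop K0 TY) _.
  rewrite ltr_pdivrMr// mulrC -ltr_pdivrMr//.
  apply: lt_trans (archi_boundP _) _; first by rewrite divr_ge0// ltW.
  by rewrite ltr_nat.
- apply: bop_deltaP => z; apply: l2P => i.
  rewrite [LHS]badj_delta !diagop_delta !l2ZE !deltaE (eq_sym z).
  case: eqVneq => [->|]; last by rewrite !mulr0 conjc0.
  by rewrite !mulr1 /d conjc_real.
- apply: bop_deltaP => z; rewrite bop_mulE diagop_delta bopZ diagop_delta scalerA Gt.
  have /andP[t0 _] := t01 z.
  by rewrite /d -rmorphM -expr2 sqr_sqrtr.
Qed.

End Sqrt.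

(** * The co-universal algebra *)

Section Transfer.
Variables (R : realType) (E : digraph) (A : cstarType R).
Variables (p : vertex E -> A) (s : edge E -> A).
Local Notation C := R[i].
Local Notation B := (bop (l2 R (state E))).
Local Notation Q := (@bvertex R E).
Local Notation bpath := (lpath_elt (@bvertex R E) (@bedge R E)).
Local Notation P := (path_elt (@bvertex R E) (@bedge R E)).
Local Notation gens := (generators (@bvertex R E) (@bedge R E)).
Local Notation T := (family_algebra (@bvertex R E) (@bedge R E)).
Variable psi : B -> A.
Hypothesis hpsi : star_hom_on T psi.
Hypothesis psi_vertex : forall v, psi (Q v) = p v.
Hypothesis psi_edge : forall e, psi (bedge R e) = s e.
Hypothesis p_neq0 : forall v, p v <> 0.
Hypothesis generated : family_algebra p s = setT.
Implicit Types (a b : gpath E) (X Y : B).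

Let hT : cstar_subalgebra T := cstar_generated_subalgebra _.

Lemma bvertex_in v : T (Q v).
Proof. by apply: cstar_generated_gen; left; exists v. Qed.

Lemma bedge_in e : T (bedge R e).
Proof. by apply: cstar_generated_gen; right; exists e. Qed.

Lemma edges_elt_in e l : T (edges_elt (@bedge R E) e l).
Proof.
by elim: l e => [|f l IH] e; [exact: bedge_in|exact: (csubM hT (bedge_in e) (IH f))].
Qed.

Lemma lpath_in v l : T (bpath v l).
Proof. by case: l => [|e l]; [exact: bvertex_in|exact: edges_elt_in]. Qed.

Lemma psi_lpath v l : psi (bpath v l) = lpath_elt p s v l.
Proof.
case: l => [|e l]; first exact: psi_vertex.
elim: l e => [|f l IH] e; first exact: psi_edge.
rewrite [LHS](shomM hpsi (bedge_in e) (edges_elt_in f l)) psi_edge.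
by congr (_ ** _); exact: IH.
Qed.

Lemma psi_path a : psi (P a) = path_elt p s a. Proof. exact: psi_lpath. Qed.

Lemma path_in a : T (P a). Proof. exact: lpath_in. Qed.

Lemma psi_path2 a b : psi (P a ** cadj (P b)) = path_elt p s a ** cadj (path_elt p s b).
Proof.
have Tb := csub_adj hT (path_in b).
by rewrite (shomM hpsi (path_in a) Tb) (shom_adj hpsi (path_in b)) !psi_path.
Qed.

Lemma gens_in W : gens W `<=` T.
Proof.
by move=> _ [a [b [_ _ _ ->]]]; exact: (csubM hT (path_in a) (csub_adj hT (path_in b))).
Qed.

Lemma span_gens_in W : lin_span (gens W) `<=` T.
Proof. exact: lin_span_sub hT (@gens_in W). Qed.

Lemma nrm_p v : nrm (p v) = 1.
Proof.
have [vv va] := bvertex_proj R v; have Qv := bvertex_in v.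
apply: nrm_proj; last exact: p_neq0.
by rewrite -psi_vertex; split; [rewrite -(shomM hpsi)// vv|rewrite -(shom_adj hpsi)// va].
Qed.

(** ** Injectivity on the diagonal *)

(** By [entry_as_compression] the entry is the coefficient in a compression by an element
    of norm at most 1, and [psi] maps this compression to a multiple of a nonzero
    projection. *)
Lemma entry_le_psi X z : lin_span (gens setT) X -> nrm (entry X z) <= nrm (psi X).
Proof.
move=> SX; have TX := span_gens_in SX.
have [vz|nz] := boolP (valid z); last first.
  have -> : entry X z = 0.
    rewrite /entry; suff -> : X (delta R z) = 0 by [].
    elim/lin_span_ind : SX => [//|c _ Y [a [b [_ _ _ ->]]] Y0].
    rewrite bopDE bopZE Y0 bop_mulE addr0.
    have ib := implements_adj (act_inj (gpathP b)) (bpathE R (gpathP b)).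
    rewrite ib oinv_none ?(bop0 (P a)) ?scaler0// => y; rewrite /act.
    case: ifP => // /andP[vy /eqP yb] /Some_inj h.
    by case/negP: nz; rewrite -h; exact: (valid_pushl (gpathP b) vy yb).
  by rewrite nrm0 nrm_ge0.
have [v [l [pl cX]]] := entry_as_compression SX vz.
have Tp := lpath_in v l; have Ta := csub_adj hT Tp.
have TaX := csubM hT Ta TX.
have := congr1 psi cX; rewrite (shomZ hpsi _ (bvertex_in _)) psi_vertex /compress.
rewrite (shomM hpsi TaX Tp) (shomM hpsi Ta TX) => /(congr1 (@nrm R A)).
rewrite nrmZ nrm_p mulr1 => <-.
have le1 Y : T Y -> nrm Y <= 1 -> nrm (psi Y) <= 1.
  by move=> TY; apply: le_trans; exact: shom_contractive hT hpsi Y TY.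
have n1 := le1 _ Tp (nrm_bpath_le1 R pl).
have n2 : nrm (psi (cadj (bpath v l))) <= 1.
  by apply: (le1 _ Ta); rewrite nrm_adj; exact: nrm_bpath_le1.
rewrite (le_trans (nrmM _ _))// -[leRHS]mulr1 ler_pM ?nrm_ge0//.
by rewrite (le_trans (nrmM _ _))// -[leRHS]mul1r ler_pM ?nrm_ge0.
Qed.

Lemma family_closure X : T X -> forall e : R, 0 < e ->
  exists2 Y, lin_span (gens setT) Y & nrm (X - Y) < e.
Proof. by rewrite family_algebra_span => /closure_nrmP. Qed.

Lemma diag_part_le_psi X : T X -> nrm (diag_part X) <= nrm (psi X).
Proof.
move=> TX; apply: le_epsP => e e0.
have [Y SY XY] := family_closure TX (divr_gt0 e0 (ltr0n _ 2)).
have TY := span_gens_in SY.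
have h1 : nrm (diag_part Y) <= nrm (psi Y).
  by apply: nrm_diag_part_le => [|z]; [exact: nrm_ge0|exact: entry_le_psi].
have h2 : nrm (diag_part X) <= nrm (diag_part Y) + nrm (X - Y).
  rewrite -{1}(subrK Y X) diag_partD addrC (le_trans (nrmD _ _))// lerD2l.
  exact: nrm_diag_part.
have h3 : nrm (psi Y) <= nrm (psi X) + nrm (X - Y).
  rewrite -{1}(subrK (psi X) (psi Y)) addrC (le_trans (nrmD _ _))// lerD2l.
  rewrite -(shomB hT hpsi)// nrmBC.
  have := shom_contractive hT hpsi (csubB hT TY TX).
  by rewrite (shomB hT hpsi)// nrmBC => /le_trans; apply; rewrite nrmBC.
by lra.
Qed.

(** The bound on diagonals applies to all powers of [X^* X], and these diagonals
    determine the norm of [X] by [nrm_le_diag_powers]. *)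
Lemma psi_isometry X : T X -> nrm X <= nrm (psi X).
Proof.
move=> TX; rewrite -(@ler_pXn2r _ 2)// ?nnegrE ?nrm_ge0//.
have TXX := csubM hT (csub_adj hT TX) TX.
pose H := fix H k := if k is m.+1 then H m ** H m else cadj X ** X.
have TH k : T (H k) by elim: k => [|k IH]; [exact: TXX|exact: (csubM hT IH IH)].
have nH k : nrm (psi (H k)) <= (nrm (psi X) ^+ 2) ^+ (2 ^ k)%N.
  elim: k => [|k IH].
    rewrite expn0 expr1 /= (shomM hpsi)//; last exact: (csub_adj hT).
    by rewrite (shom_adj hpsi)// nrm_cstar.
  rewrite [H _]/= (shomM hpsi)// (le_trans (nrmM _ _))// expnSr exprM [leRHS]expr2.
  by rewrite ler_pM ?nrm_ge0.
apply: (@nrm_le_diag_powers _ _ X _ H) => // [|k]; first by rewrite exprn_ge0 ?nrm_ge0.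
exact: le_trans (diag_part_le_psi (TH k)) (nH k).
Qed.

(** The image of an isometry is closed, so it is a C*-subalgebra that contains the
    generators. *)
Lemma psi_surjective y : exists2 X, T X & psi X = y.
Proof.
have hI := image_subalgebra hT hpsi psi_isometry hT (fun=> id).
suff : (psi @` T) y by [].
have : family_algebra p s y by rewrite generated.
apply: cstar_generated_sub => // x [[v _ <-]|[e _ <-]].
  by exists (Q v); [exact: bvertex_in|exact: psi_vertex].
by exists (bedge R e); [exact: bedge_in|exact: psi_edge].
Qed.

Lemma psi_generators W : psi @` gens W = generators p s W.
Proof.
apply/seteqP; split=> [_ [_ [a [b [Wa Wb ab ->]]] <-]|_ [a [b [Wa Wb ab ->]]]].
  by exists a, b; split=> //; exact: psi_path2.
by exists (P a ** cadj (P b)); [exists a, b|exact: psi_path2].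
Qed.

Lemma span_pathsW : [set: A] = closure (lin_span (generators p s (@pathsW E))).
Proof.
rewrite -psi_generators -(image_closure_span hT hpsi psi_isometry (@gens_in _)).
rewrite -generators_pathsW -family_algebra_span; apply/esym/seteqP; split=> // y _.
by have [X TX <-] := psi_surjective y; exists X.
Qed.

(** ** The diagonal subalgebra *)

Definition projections (A' : cstarType R) (p' : vertex E -> A') (s' : edge E -> A') : set A' :=
  [set x | exists a : gpath E, x = path_elt p' s' a ** cadj (path_elt p' s' a)].

Local Notation projs := (projections (@bvertex R E) (@bedge R E)).
Local Notation DB := (closure (lin_span projs)).

Lemma projections_in : projs `<=` T.
Proof. by move=> _ [a ->]; exact: (csubM hT (path_in a) (csub_adj hT (path_in a))). Qed.

Lemma projections_mul X Y : projs X -> projs Y -> lin_span projs (X ** Y).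
Proof.
move=> [a ->] [b ->]; rewrite -!cmulA (cmulA (cadj (P a))).
have [[l [ab bE ->]]|[l [ab aE ->]]|->] := bpath_cases R (gpathP a) (gpathP b).
- apply: lin_span_gen; exists b; rewrite cmulA; congr (_ ** _).
  have pb : is_path (prange a) (pedges a ++ l) by rewrite -bE ab; exact: gpathP.
  by rewrite [RHS]path_eltE -ab bE (bpath_cat R pb).
- apply: lin_span_gen; exists a; congr (_ ** _); rewrite -cadjM; congr cadj.
  have pa : is_path (prange b) (pedges b ++ l) by rewrite -aE -ab; exact: gpathP.
  by rewrite [RHS]path_eltE ab aE (bpath_cat R pa).
- by rewrite cmul0l cmul0r; exact: lin_span0.
Qed.

Lemma projections_adj X : projs X -> projs (cadj X).
Proof. by move=> [a ->]; exists a; rewrite cadjM cadjK. Qed.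

Let hDB : cstar_subalgebra DB := closure_span_subalgebra projections_mul projections_adj.

Lemma diag_in : DB `<=` T.
Proof.
apply: closure_sub_closed; first exact: csub_closed hT.
exact: lin_span_sub hT projections_in.
Qed.

Lemma projection_diagonal a : diagonal (P a ** cadj (P a)).
Proof.
apply: diagonalP => z; set X := _ ** _.
have ia := implements_adj (act_inj (gpathP a)) (bpathE R (gpathP a)).
have iX : implements X _ := implements_mul (bpathE R (gpathP a)) ia.
have fa := oinvP (act_inj (gpathP a)).
rewrite (entry_implements z iX) iX.
case oz : (oinv _ z) => [y|] /=; last by rewrite scale0r.
by have /fa -> := oz; rewrite eqxx scale1r.
Qed.

Lemma diag_diagonal X : DB X -> diagonal X.
Proof.
have cl : closed [set X : B | diagonal X].
  apply/closed_nrmP => Y hY; apply/subr0_eq/nrm0_eq0/le_anti; rewrite nrm_ge0 andbT.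
  apply: le_epsP => e e0; have [Z dZ YZ] := hY _ (divr_gt0 e0 (ltr0n _ 2)).
  have h1 : nrm (diag_part Y - diag_part Z) <= e / 2.
    by rewrite -diag_partB; apply: le_trans (nrm_diag_part _) _; exact: ltW.
  have h2 : nrm (Z - Y) <= e / 2 by rewrite nrmBC; exact: ltW.
  rewrite dZ in h1; rewrite add0r (splitr e).
  exact: le_trans (nrm_triang Z (diag_part Y) Y) (lerD h1 h2).
apply: closure_sub_closed X; first exact: cl.
apply: lin_span_ind => [|c _ Y [a ->] dY]; first exact: diag_part0.
by rewrite /diagonal diag_partD diag_partZ dY projection_diagonal.
Qed.

Lemma diag_part_generator a b : pathsW a -> pathsW b -> psource a = psource b ->
  diag_part (P a ** cadj (P b)) = if a == b then P a ** cadj (P a) else 0.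
Proof.
move=> aW bW ab; apply: bop_deltaP => z; rewrite diag_part_delta entry_generator//.
case: eqP => _; last by rewrite scale0r.
by rewrite -diagonal_delta//; exact: projection_diagonal.
Qed.

Lemma diag_part_in X : T X -> DB (diag_part X).
Proof.
rewrite family_algebra_span generators_pathsW => /closure_nrmP hX.
move/closed_nrmP: (csub_closed hDB); apply=> e /hX[Y SY XY].
exists (diag_part Y); last by rewrite -diag_partB (le_lt_trans (nrm_diag_part _)).
elim/lin_span_ind : SY {XY} => [|c _ Z [a [b [aW bW ab ->]]] dZ].
  by rewrite diag_part0; exact: csub0 hDB.
rewrite diag_partD diag_partZ; apply: (csubD hDB) dZ; apply: (csubZ hDB).
rewrite diag_part_generator//; case: eqP => _; last exact: csub0 hDB.
by apply: subset_closure; apply: lin_span_gen; exists a.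
Qed.

(** ** The conditional expectation *)

Let pre y : {X | T X /\ psi X = y}.
Proof. by apply: cid; have [X TX Xy] := psi_surjective y; exists X. Qed.

(** The compression to the diagonal, carried over by the isomorphism [psi]. *)
Definition expectation (y : A) : A := psi (diag_part (sval (pre y))).

Lemma expectationE X : T X -> expectation (psi X) = psi (diag_part X).
Proof.
move=> TX; rewrite /expectation; case: (pre _) => Y /= [TY YX].
by rewrite (shom_inj hT hpsi psi_isometry TY TX YX).
Qed.

Lemma diagonal_image : closure (lin_span (projections p s)) = psi @` DB.
Proof.
rewrite (image_closure_span hT hpsi psi_isometry projections_in); congr (closure (lin_span _)).
apply/seteqP; split=> [_ [a ->]|_ [_ [a ->] <-]].
  by exists (P a ** cadj (P a)); [exists a|exact: psi_path2].
by exists a; exact: psi_path2.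
Qed.

(** The diagonal of [X^* X] has nonnegative entries, so it is the square of a
    self-adjoint element of the diagonal algebra. *)
Lemma expectation_positive x : cpositive x -> cpositive (expectation x).
Proof.
move=> [y ->]; have [X TX <-] := psi_surjective y.
have TXX := csubM hT (csub_adj hT TX) TX.
rewrite -(shom_adj hpsi)// -(shomM hpsi)//; last exact: (csub_adj hT).
rewrite expectationE//; set G := diag_part _.
have DG : DB G by exact: diag_part_in.
(* [M] is a nonzero scale that brings the entries into [0, 1]. *)
pose M := nrm X + 1; have M0 : 0 < M by rewrite ltr_wpDl// nrm_ge0.
pose t z := (nrm (X (delta R z)) / M) ^+ 2.
have t01 z : 0 <= t z <= 1.
  have h0 : 0 <= nrm (X (delta R z)) / M by rewrite divr_ge0 ?nrm_ge0// ltW.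
  rewrite exprn_ge0//= expr_le1// ler_pdivrMr// mul1r (le_trans (nrm_bopP X _))//.
  by rewrite nrm_delta mulr1 lerDl.
pose c : C := (M^-1 %:C)%C.
have cM : ((M%:C)%C : C) * c = 1 by rewrite -rmorphM mulfV// gt_eqF.
have cc : (c^*)%C = c by rewrite /c conjc_real.
have MM : (((M%:C)%C : C)^*)%C = (M%:C)%C by rewrite conjc_real.
have Gt z : (c * c *: G) (delta R z) = (t z)%:C%C *: delta R z.
  rewrite bopZE diag_part_delta entry_sqr scalerA; congr (_ *: _).
  by rewrite /t /c expr_div_n -!rmorphM; congr (_%:C)%C; field; rewrite gt_eqF.
have [W [DW Wa WW]] := diagonal_sqrt hDB (csubZ hDB (c * c) DG) t01 Gt.
have TW := diag_in DW; exists (psi ((M%:C)%C *: W)).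
have TMW : T ((M%:C)%C *: W) by exact: (csubZ hT).
rewrite -(shom_adj hpsi)// -(shomM hpsi)//; last exact: (csub_adj hT).
congr psi; rewrite cadjZ Wa MM -cscalerAl -cscalerAr scalerA WW scalerA.
by rewrite mulrACA cM mulr1 scale1r.
Qed.

Lemma expectation_conditional :
  conditional_expectation (closure (lin_span (projections p s))) expectation.
Proof.
rewrite diagonal_image; split.
- exact (image_subalgebra hT hpsi psi_isometry hDB diag_in).
- move=> y; have [X TX <-] := psi_surjective y; rewrite expectationE//.
  by exists (diag_part X) => //; exact: diag_part_in.
- by move=> _ [X DX <-]; rewrite expectationE ?(diag_diagonal DX)//; exact: diag_in.
- move=> x y; have [X TX <-] := psi_surjective x; have [Y TY <-] := psi_surjective y.
  have dX := diag_in (diag_part_in TX); have dY := diag_in (diag_part_in TY).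
  rewrite -(shomD hpsi TX TY) !expectationE//; last exact: (csubD hT).
  by rewrite diag_partD (shomD hpsi).
- move=> a x; have [X TX <-] := psi_surjective x.
  have dX := diag_in (diag_part_in TX).
  rewrite -(shomZ hpsi a TX) !expectationE//; last exact: (csubZ hT).
  by rewrite diag_partZ (shomZ hpsi).
- move=> x; have [X TX <-] := psi_surjective x; rewrite expectationE// !nrmE lecR.
  apply: le_trans (psi_isometry TX); apply: le_trans (nrm_diag_part X).
  exact (shom_contractive hT hpsi (diag_in (diag_part_in TX))).
- exact: expectation_positive.
- move=> _ x [D DD <-]; have [X TX <-] := psi_surjective x; have TD := diag_in DD.
  have dX := diag_in (diag_part_in TX).
  rewrite -(shomM hpsi TD TX) !expectationE//; last exact: (csubM hT).
  by rewrite diagonal_mull ?(shomM hpsi)//; exact: diag_diagonal.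
- move=> x _ [D DD <-]; have [X TX <-] := psi_surjective x; have TD := diag_in DD.
  have dX := diag_in (diag_part_in TX).
  rewrite -(shomM hpsi TX TD) !expectationE//; last exact: (csubM hT).
  by rewrite diagonal_mulr ?(shomM hpsi)//; exact: diag_diagonal.
Qed.

Lemma expectation_faithful : faithful expectation.
Proof.
move=> x; have [X TX <-] := psi_surjective x.
have TXX := csubM hT (csub_adj hT TX) TX.
rewrite -(shom_adj hpsi)// -(shomM hpsi)//; last exact: (csub_adj hT).
rewrite expectationE// => h; suff -> : X = 0 by exact: shom0 hT hpsi.
apply: diag_part_faithful; apply: (shom_inj hT hpsi psi_isometry).
- exact: diag_in (diag_part_in TXX).
- exact: csub0 hT.
- by rewrite h (shom0 hT hpsi).
Qed.

Lemma expectation_generator a b : pathsW a -> pathsW b -> psource a = psource b ->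
  expectation (path_elt p s a ** cadj (path_elt p s b)) =
  if a == b then path_elt p s a ** cadj (path_elt p s a) else 0.
Proof.
move=> aW bW ab; rewrite -!psi_path2 expectationE; last first.
  exact: (csubM hT (path_in a) (csub_adj hT (path_in b))).
by rewrite diag_part_generator//; case: eqP => // _; exact: shom0 hT hpsi.
Qed.

End Transfer.

Section Cutting.
Variables (R : realType) (E : digraph) (A : cstarType R).
Variables (p : vertex E -> A) (s : edge E -> A).
Local Notation C := R[i].
Local Notation B := (bop (l2 R (state E))).
Local Notation Q := (@bvertex R E).
Local Notation T := (family_algebra (@bvertex R E) (@bedge R E)).

Lemma path_elt_scaled (psi : B -> A) (k : edge E -> C) : star_hom_on T psi ->
  (forall e, psi (bedge R e) = k e *: s e) ->
  forall e l, psi (edges_elt (@bedge R E) e l) = (\prod_(f <- e :: l) k f) *: edges_elt s e l.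
Proof.
move=> hpsi he e l; elim: l e => [|f l IH] e; first by rewrite big_seq1; exact: he.
rewrite [LHS](shomM hpsi (bedge_in e) (edges_elt_in f l)) he IH (big_cons _ _ e).
by rewrite -cscalerAl -cscalerAr scalerA.
Qed.

(** A cutting set meets each entry-free cycle in one edge [x], and both families map
    the cycle to a vertex projection. Since [psi] multiplies the element of the cycle
    by the scalar at [x] only, this scalar is 1. *)
Lemma cutting_scalar_trivial (X : set (edge E)) (kappa : edge E -> C) (psi : B -> A) :
  normalised_reduced_CK_family p s -> (forall v, p v <> 0) ->
  cutting_set X -> star_hom_on T psi -> (forall v, psi (Q v) = p v) ->
  (forall e, ~ X e -> psi (bedge R e) = s e) ->
  (forall x, X x -> psi (bedge R x) = kappa x *: s x) ->
  forall e, psi (bedge R e) = s e.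
Proof.
move=> hp p0 [Xef Xcut] hpsi hv he hx e; have [Xe|/he//] := pselect (X e).
have [m mc em] : edge_entry_free e by apply/entry_free_edgesE; exact: Xef.
have [|x Xx] := Xcut (cyclic_class m); first by exists m.
rewrite class_edges_cyclic in Xx.
have xe : e = x by have : (X `&` [set f | f \in pedges m]) e by []; rewrite Xx.
pose k f : C := if `[< X f >] then kappa f else 1.
have hk f : psi (bedge R f) = k f *: s f.
  rewrite /k; case: asboolP => [/hx//|/he ->]; by rewrite scale1r.
have [[m1 _ um] _] := mc.
have prodk : \prod_(f <- pedges m) k f = kappa e.
  rewrite (bigD1_seq e)//=; last exact: map_uniq um.
  rewrite big_seq_cond big1 ?mulr1.
    by rewrite /k asboolT.
  move=> f /andP[fm fe]; rewrite /k; case: asboolP => // Xf.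
  have : (X `&` [set f | f \in pedges m]) f by [].
  by rewrite Xx -xe => /= ef; rewrite ef eqxx in fe.
have := bpath_cycle R mc => /(congr1 psi); rewrite hv.
rewrite {1}/path_elt; case ml : (pedges m) => [|f l]; first by rewrite /plength ml in m1.
rewrite (path_elt_scaled hpsi hk) -ml prodk.
have := nrck_cycle hp mc; rewrite /path_elt ml => ->.
move=> /eqP; rewrite -subr_eq0 -{2}(scale1r (p _)) -scalerBl scaler_eq0.
case/orP => [/eqP/subr0_eq k1|/eqP/p0//].
by rewrite hx// k1 scale1r.
Qed.

End Cutting.

Theorem proposition4p9 (R : realType) (E : digraph) (hE : row_finite E)
    (A : cstarType R) (p : vertex E -> A) (s : edge E -> A)
    (hA : is_Cmin p s) :
  [set: A] = closure (lin_span
    [set x | exists a b : gpath E,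
       [/\ pathsW a, pathsW b, psource a = psource b
         & x = path_elt p s a ** cadj (path_elt p s b)]])
  /\
  let D := closure (lin_span
    [set x | exists a : gpath E, x = path_elt p s a ** cadj (path_elt p s a)]) in
  exists Psi : A -> A,
    [/\ conditional_expectation D Psi,
        faithful Psi
      & forall a b : gpath E, pathsW a -> pathsW b -> psource a = psource b ->
          Psi (path_elt p s a ** cadj (path_elt p s b)) =
          if a == b then path_elt p s a ** cadj (path_elt p s a) else 0].
Proof.
have [X cX] := cutting_set_exists E.
have [kappa [psi [_ hpsi hv he hx]]] :=
  cmin_couniversal hA (bfamily_toeplitz R E) (@bvertex_neq0 R E) cX.
have p0 := cmin_neq0 hA.
have hs := cutting_scalar_trivial (cmin_family hA) p0 cX hpsi hv he hx.
have gen := cmin_generated hA.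
split; first exact (span_pathsW hpsi hv hs p0 gen).
exists (expectation hpsi hv hs p0 gen); split.
- exact (expectation_conditional hpsi hv hs p0 gen).
- exact: expectation_faithful.
- by move=> a b; exact: expectation_generator.
Qed.
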